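(* Fix $q\in(2,4]$ and let $\mathcal{K}$ be a knot class with $\Sigma_{\mathcal{K}}\neq\emptyset$. Then for every $\vartheta>0$ there exists an arclength parametrized knot $\Gamma_\vartheta\in\Sigma_{\mathcal{K}}$ with $\mathscr{L}(\Gamma_\vartheta)=1$ such that $S_\vartheta(\Gamma_\vartheta)=\inf_{\Sigma_{\mathcal{K}}}S_\vartheta$.
   Context: $\mathscr{L}$ is length; $E(\gamma)=\int_\gamma\kappa^2ds$; $\mathrm{TP}_q(\gamma)=\iint_{(\mathbb{R}/\mathbb{Z})^2} r_{tp}(\gamma(s),\gamma(t))^{-q}|\gamma'(s)||\gamma'(t)|\,ds\,dt$ with $r_{tp}(\gamma(s),\gamma(t))$ the radius of the circle through $\gamma(s),\gamma(t)$ tangent to $\gamma$ at $\gamma(s)$; $E_\vartheta=E+\vartheta\mathrm{TP}_q^{1/(q-2)}$ and $S_\vartheta(\gamma)=\mathscr{L}(\gamma)E_\vartheta(\gamma)$ (the scale-invariant total energy). $\Omega^1_{\mathcal{K}}$ is the set of injective regular ($|\gamma'|>0$) closed curves $\gamma\in W^{2,2}(\mathbb{R}/\mathbb{Z},\mathbb{R}^3)$ of knot type $\mathcal{K}$. $D_2$-symmetry: $R_1=\mathrm{diag}(1,-1,-1)$, $R_2=\mathrm{diag}(-1,1,-1)$, $R_3=\mathrm{diag}(-1,-1,1)$; on $\mathbb{R}/\mathbb{Z}$: $\psi_1(t)=-t+1/2$, $\psi_2(t)=t-1/2$, $\psi_3(t)=-t$; $\Sigma^1$ is the set of $\gamma\in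 C^0(\mathbb{R}/\mathbb{Z},\mathbb{R}^3)$ of finite positive length with $R_i\gamma(\psi_i(t))=\gamma(t)$ for all $t$, $i=1,2,3$. $\Sigma_{\mathcal{K}}=\Sigma^1\cap\Omega^1_{\mathcal{K}}$. *)

(* Defs.v *)
From HB Require Import structures.
From mathcomp Require Import all_boot all_order all_algebra.
From mathcomp Require Import all_classical all_reals all_analysis.
Set Implicit Arguments. Unset Strict Implicit. Unset Printing Implicit Defensive.
Import Order.TTheory GRing.Theory Num.Theory.
Import numFieldNormedType.Exports.
Local Open Scope classical_set_scope.
Local Open Scope ring_scope.

Section Knots.
Variable R : realType.

Notation vec := 'rV[R]_3.
(* closed curves are 1-periodic maps R -> R^3 (i.e. maps on R/Z) *)
Notation curve := (R -> vec).

Definition dotv (u v : vec) : R := \sum_(i < 3) u ord0 i * v ord0 i.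
Definition enorm (u : vec) : R := Num.sqrt (dotv u u).

Definition perpv (tau w : vec) : vec := w - (dotv w tau / dotv tau tau) *: tau.

Definition periodic1 (g : curve) : Prop := forall t, g (t + 1) = g t.

(* gamma in W^{2,2}(R/Z,R^3) (continuous representative): gamma is
   1-periodic and everywhere differentiable, and its derivative is
   absolutely continuous with square integrable derivative, i.e.
   gamma'(t) = gamma'(0) + int_0^t g with g in L^2(0,1) componentwise. *)
Definition W22 (g : curve) : Prop :=
  periodic1 g /\ (forall t, derivable g t 1) /\
  exists h : 'I_3 -> R -> R,
    forall i : 'I_3,
      (lebesgue_measure).-integrable `[0, 1] (fun t => (h i t)%:E) /\
      (lebesgue_measure).-integrable `[0, 1] (fun t => ((h i t) ^+ 2)%:E) /\
      forall t, 0 <= t <= 1 ->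
        (derive1 g t) ord0 i = (derive1 g 0) ord0 i + Rintegral lebesgue_measure `[0, t] (h i).

Definition regular (g : curve) : Prop := forall t, 0 < enorm (derive1 g t).

Definition injective_closed (g : curve) : Prop :=
  forall s t, 0 <= s < 1 -> 0 <= t < 1 -> g s = g t -> s = t.

Definition simple_closed (g : curve) : Prop :=
  continuous g /\ periodic1 g /\ injective_closed g.

Definition same_knot_type (g1 g2 : curve) : Prop :=
  exists H : R -> vec -> vec,
    {within `[0, 1] `*` setT, continuous (fun p : R * vec => H p.1 p.2)} /\
    (forall t, 0 <= t <= 1 -> exists Hi : vec -> vec,
        continuous (H t) /\ continuous Hi /\ cancel (H t) Hi /\ cancel Hi (H t)) /\
    (forall x, H 0 x = x) /\
    (H 1) @` range g1 = range g2.

(* Omega^1_K, where the knot class K is the knot type of the simple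
   closed curve g0 *)
Definition Omega1K (g0 : curve) (g : curve) : Prop :=
  W22 g /\ regular g /\ injective_closed g /\ same_knot_type g g0.

Definition Len (g : curve) : R :=
  Rintegral lebesgue_measure `[0, 1] (fun t => enorm (derive1 g t)).

Definition Rm1 : vec := \row_(j < 3) (if j == 0%N :> nat then 1 else -1).
Definition Rm2 : vec := \row_(j < 3) (if j == 1%N :> nat then 1 else -1).
Definition Rm3 : vec := \row_(j < 3) (if j == 2%N :> nat then 1 else -1).
Definition refl (d x : vec) : vec := \row_(j < 3) (d ord0 j * x ord0 j).

Definition D2sym (g : curve) : Prop :=
  (forall t, refl Rm1 (g (- t + 1/2)) = g t) /\
  (forall t, refl Rm2 (g (t - 1/2)) = g t) /\
  (forall t, refl Rm3 (g (- t)) = g t).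

(* Sigma_K = Sigma^1 cap Omega^1_K (for W^{2,2} curves the length is
   the integral of |gamma'|) *)
Definition SigmaK (g0 : curve) (g : curve) : Prop :=
  Omega1K g0 g /\ continuous g /\ D2sym g /\ 0 < Len g.

(* second derivative (exists a.e. for W^{2,2} curves) *)
Definition d2 (g : curve) : curve := derive1 (derive1 g).

(* bending energy E = int kappa^2 ds,
   kappa = |(gamma'')^perp| / |gamma'|^2, ds = |gamma'| dt *)
Definition Ebend (g : curve) : \bar R :=
  (\int[lebesgue_measure]_(t in `[0%R, 1%R])
     (((enorm (perpv (derive1 g t) (d2 g t)) / (enorm (derive1 g t)) ^+ 2) ^+ 2
       * enorm (derive1 g t))%:E))%E.

(* 1 / r_tp(x,y), where r_tp(x,y) is the radius of the circle through
   x and y tangent to tau at x: r_tp = |x-y|^2 / (2 dist(y, x + R tau)) *)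
Definition inv_rtp (tau x y : vec) : R :=
  2 * enorm (perpv tau (y - x)) / (enorm (y - x)) ^+ 2.

(* tangent-point energy TP_q (nonnegative integrand, written as an
   iterated integral over (R/Z)^2; the diagonal is a null set) *)
Definition TP (q : R) (g : curve) : \bar R :=
  (\int[lebesgue_measure]_(s in `[0%R, 1%R])
    \int[lebesgue_measure]_(t in `[0%R, 1%R])
      ((if s == t then 0 else (inv_rtp (derive1 g s) (g s) (g t)) `^ q)
        * enorm (derive1 g s) * enorm (derive1 g t))%:E)%E.

Definition Etheta (q theta : R) (g : curve) : \bar R :=
  (Ebend g + theta%:E * poweR (TP q g) (1 / (q - 2)))%E.

(* scale-invariant total energy *)
Definition Stheta (q theta : R) (g : curve) : \bar R :=
  ((Len g)%:E * Etheta q theta g)%E.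

Definition arclength (g : curve) : Prop := forall t, enorm (derive1 g t) = 1.

End Knots.

(* Main.v *)
(** The direct method.  Reparametrizing [g] by arclength and rescaling it to
length 1 gives a curve [G] with [G' = v], [|v| = 1], and scale invariance turns
[S(g)] into [Len g * E(g) + theta * TP(G)^(1/(q-2))].  The bending energy is only
used through the dyadic energies [sum_j 2^k |v((j+1)/2^k) - v(j/2^k)|^2]: they are
at most [Len g * E(g)], they pass to pointwise limits, and a bound on all of them
gives back (Riesz) that [v] is absolutely continuous with derivative in [L^2],
hence that [v] is Hoelder with exponent 1/2.

Along a minimizing sequence the tangents are therefore equi-Hoelder, and the
symmetry fixes the position, so that a subsequence converges in [C^1].  A bound on
[TP_q], [q > 2], keeps distant strands apart: at a closest pair of points the chord
is orthogonal to the curve, so that short chords make the energy large.  The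
resulting uniform bound [c |s - t| <= |G s - G t|] makes the limit injective, and
a [C^1]-small perturbation [G_n - G] extends to a Lipschitz vector field [V] on
space with small constant, so that [x + t V(x)] is an isotopy between the limit
and [G_n].  Lower semicontinuity of [TP_q] is Fatou's lemma, applied twice. *)
Require Import Defs.
From HB Require Import structures.
From mathcomp Require Import all_boot all_order all_algebra.
From mathcomp Require Import all_classical all_reals all_analysis.
From mathcomp Require Import measurable_realfun.
From mathcomp Require Import ring lra.
Set Implicit Arguments.
Unset Strict Implicit.
Unset Printing Implicit Defensive.
Import Order.TTheory GRing.Theory Num.Theory.
Import numFieldNormedType.Exports.
Local Open Scope classical_set_scope.
Local Open Scope ring_scope.

(** The bending integrand contains [derive1 (derive1 g)], which exists only almost everywhere and
    has a default value elsewhere, so its measurability is not at hand. Integrals of nonnegative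
    functions are therefore compared as suprema over simple functions, and [Ebend] is computed by
    squeezing. Dyadic energies replace weak compactness for two reasons. They are finite sums of
    point values, hence continuous under pointwise convergence. And a coarse slope is the mean of
    two finer ones, so the slopes form a martingale: energies increase with the level, and their
    differences are squared L^2 distances, which is what produces an L^2 derivative from a mere
    bound. Normalizing a curve must not destroy its symmetry. It does not, because the speed is
    invariant under the parameter maps and arclength is measured from the parameter 0. The
    tangent-point radius involves the tangent at one end of the chord only, so orthogonality at that
    end suffices for the separation estimate, and all its constants depend on [q] and the energy
    bounds alone. *)

Section vectors.
Variable R : realType.
Implicit Types (u v w : 'rV[R]_3) (c : R).

(** * Euclidean geometry of row vectors and scaling of the tangent-point radius *)

Lemma dotvE u v : dotv u v = u ord0 ord0 * v ord0 ord0
  + u ord0 (lift ord0 ord0) * v ord0 (lift ord0 ord0)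
  + u ord0 (lift ord0 (lift ord0 ord0)) * v ord0 (lift ord0 (lift ord0 ord0)).
Proof. by rewrite /dotv !big_ord_recl big_ord0 addr0 addrA. Qed.

Lemma dotvC u v : dotv u v = dotv v u.
Proof. by rewrite !dotvE; ring. Qed.

Lemma dotvDl u v w : dotv (u + v) w = dotv u w + dotv v w.
Proof. by rewrite !dotvE !mxE; ring. Qed.

Lemma dotvZl c u v : dotv (c *: u) v = c * dotv u v.
Proof. by rewrite !dotvE !mxE; ring. Qed.

Lemma dotvNl u v : dotv (- u) v = - dotv u v.
Proof. by rewrite !dotvE !mxE; ring. Qed.

Lemma dotvBl u v w : dotv (u - v) w = dotv u w - dotv v w.
Proof. by rewrite dotvDl dotvNl. Qed.

Lemma dotvBr u v w : dotv u (v - w) = dotv u v - dotv u w.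
Proof. by rewrite dotvC dotvBl !(dotvC u). Qed.

Lemma dotvDr u v w : dotv u (v + w) = dotv u v + dotv u w.
Proof. by rewrite dotvC dotvDl !(dotvC u). Qed.

Lemma dotvZr c u v : dotv u (c *: v) = c * dotv u v.
Proof. by rewrite dotvC dotvZl dotvC. Qed.

Lemma dotv_ge0 u : 0 <= dotv u u.
Proof. by apply: sumr_ge0 => i _; rewrite -expr2 sqr_ge0. Qed.

Lemma enorm_ge0 u : 0 <= enorm u.
Proof. exact: sqrtr_ge0. Qed.

Lemma sqr_enorm u : enorm u ^+ 2 = dotv u u.
Proof. by rewrite sqr_sqrtr// dotv_ge0. Qed.

Lemma cauchy_schwarz_sqr u v : dotv u v ^+ 2 <= dotv u u * dotv v v.
Proof.
rewrite !dotvE -subr_ge0.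
set a := u _ _; set b := u _ _; set c := u _ _.
set x := v _ _; set y := v _ _; set z := v _ _.
rewrite (_ : _ - _ = (a * y - b * x) ^+ 2 + (a * z - c * x) ^+ 2
   + (b * z - c * y) ^+ 2); last by ring.
by rewrite !addr_ge0// sqr_ge0.
Qed.

Lemma cauchy_schwarz u v : `|dotv u v| <= enorm u * enorm v.
Proof.
rewrite -(@ler_pXn2r _ 2) ?nnegrE// ?mulr_ge0 ?enorm_ge0//.
by rewrite exprMn !sqr_enorm real_normK ?num_real// cauchy_schwarz_sqr.
Qed.

Lemma enormD u v : enorm (u + v) <= enorm u + enorm v.
Proof.
rewrite -(@ler_pXn2r _ 2) ?nnegrE ?addr_ge0 ?enorm_ge0//.
rewrite sqr_enorm dotvDl !dotvDr (dotvC v u) sqrrD !sqr_enorm.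
have := le_trans (ler_norm _) (cauchy_schwarz u v); lra.
Qed.

Lemma enormZ c u : enorm (c *: u) = `|c| * enorm u.
Proof.
rewrite /enorm dotvZl dotvZr mulrA -expr2 sqrtrM ?sqr_ge0//.
by rewrite sqrtr_sqr.
Qed.

Lemma enormN u : enorm (- u) = enorm u.
Proof. by rewrite -scaleN1r enormZ normrN normr1 mul1r. Qed.

Lemma enorm_distC u v : enorm (u - v) = enorm (v - u).
Proof. by rewrite -enormN opprB. Qed.

Lemma enorm0 : enorm (0 : 'rV[R]_3) = 0.
Proof. by rewrite -(scale0r (0 : 'rV[R]_3)) enormZ normr0 mul0r. Qed.

Lemma ler_enormB u v : enorm u - enorm v <= enorm (u - v).
Proof. by rewrite lerBlDr -{1}(subrK v u) enormD. Qed.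

Lemma ler_dist_enorm u v : `|enorm u - enorm v| <= enorm (u - v).
Proof.
rewrite ler_norml ler_enormB andbT lerNl opprB.
by rewrite (le_trans (ler_enormB _ _))// enorm_distC.
Qed.

Lemma enorm_eq0 u : enorm u = 0 -> u = 0.
Proof.
move=> u0; have : dotv u u = 0 by rewrite -sqr_enorm u0 expr0n.
move=> /eqP; rewrite psumr_eq0; last by move=> i _; rewrite -expr2 sqr_ge0.
move=> /allP u00; apply/rowP => i; rewrite mxE; apply/eqP.
by have := u00 i (mem_index_enum _); rewrite mulf_eq0 orbb.
Qed.

Lemma enorm_gt0 u : (0 < enorm u) = (u != 0).
Proof.
rewrite lt_neqAle enorm_ge0 andbT eq_sym; apply/idP/idP.
  by apply: contra => /eqP ->; rewrite enorm0.
by apply: contra => /eqP /enorm_eq0 ->.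
Qed.

Lemma coord_le_enorm u i : `|u ord0 i| <= enorm u.
Proof.
rewrite -(@ler_pXn2r _ 2) ?nnegrE ?enorm_ge0// sqr_enorm real_normK ?num_real//.
rewrite /dotv (bigD1 i)//= -expr2 lerDl.
by apply: sumr_ge0 => j _; rewrite -expr2 sqr_ge0.
Qed.

Lemma coord_le_norm u i : `|u ord0 i| <= `|u|.
Proof.
rewrite [leRHS]/Num.norm/= mx_normrE.
exact: (@le_bigmax _ _ _ _ (fun ij : 'I_1 * 'I_3 => `|u ij.1 ij.2|) (ord0, i)).
Qed.

Lemma norm_leP u c : 0 <= c -> (forall i, `|u ord0 i| <= c) -> `|u| <= c.
Proof.
move=> c0 uc; rewrite [leLHS]/Num.norm/= mx_normrE.
by apply: bigmax_le => // -[i j] _ /=; rewrite (ord1 i).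
Qed.

(** The norm of a row vector is the sup norm, so the sharp constant is sqrt 3; the rational bound 2
    is the source of the constant [1 / 4] in [same_knot_type_near]. *)
Lemma enorm_le_norm u : enorm u <= 2 * `|u|.
Proof.
rewrite -(@ler_pXn2r _ 2) ?nnegrE ?enorm_ge0 ?mulr_ge0// sqr_enorm.
have H i : u ord0 i * u ord0 i <= `|u| ^+ 2.
  by rewrite -expr2 -real_normK ?num_real// ler_pXn2r ?nnegrE// coord_le_norm.
apply: (@le_trans _ _ (\sum_(i < 3) `|u| ^+ 2)); first exact: ler_sum.
rewrite sumr_const card_ord exprMn.
by rewrite -(mulr_natl (`|u| ^+ 2)) ler_wpM2r ?sqr_ge0//; lra.
Qed.

Lemma sqr_enorm_perpv u w : dotv u u != 0 ->
  enorm (perpv u w) ^+ 2 = dotv w w - dotv w u ^+ 2 / dotv u u.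
Proof.
move=> u0; rewrite sqr_enorm /perpv dotvBl !dotvBr !dotvZl !dotvZr (dotvC u w).
by field.
Qed.

Lemma perpvZl c u w : c != 0 -> perpv (c *: u) w = perpv u w.
Proof.
move=> c0; rewrite /perpv dotvZl !dotvZr scalerA; congr (_ - _ *: _).
have [->|u0] := eqVneq (dotv u u) 0; first by rewrite !mulr0 invr0 !mulr0 mul0r.
by field; rewrite c0 u0.
Qed.

Lemma perpvZr c u w : perpv u (c *: w) = c *: perpv u w.
Proof. by rewrite /perpv dotvZl scalerBr scalerA mulrA. Qed.

Lemma inv_rtp_ge0 u v w : 0 <= inv_rtp u v w.
Proof. by rewrite divr_ge0 ?sqr_ge0// mulr_ge0 ?enorm_ge0. Qed.

(** The tangent enters only through the line it spans, so a nonzero multiple gives the same radius,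
    and radii scale like lengths. Coincident points are covered because the inverse of 0 is 0. *)
Lemma inv_rtpZ (c l : R) u v w : c != 0 -> 0 < l ->
  inv_rtp (c *: u) (l *: v) (l *: w) = l^-1 * inv_rtp u v w.
Proof.
move=> c0 l0; rewrite /inv_rtp -scalerBr perpvZl// perpvZr !enormZ gtr0_norm//.
have [->|u0] := eqVneq (enorm (w - v)) 0.
  by rewrite !(mulr0, expr0n, invr0).
by field; rewrite u0 gt_eqF.
Qed.

End vectors.

(** * Integrals over intervals and a weighted Cauchy-Schwarz inequality *)

Section interval_integrals.
Variable R : realType.
Notation mu := (@lebesgue_measure R).
Implicit Types (f h w : R -> R) (a b c : R).

Lemma integrable_itvS f a b c d : a <= c -> d <= b ->
  mu.-integrable `[a, b] (EFin \o f) -> mu.-integrable `[c, d] (EFin \o f).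
Proof.
move=> ac db; apply: integrableS => //.
by apply: subset_itv; rewrite bnd_simp.
Qed.

Lemma integrable_itvZ f a b c : mu.-integrable `[a, b] (EFin \o f) ->
  mu.-integrable `[a, b] (EFin \o (fun t => c * f t)).
Proof. by move=> fi; apply: (integrableZl _ c fi). Qed.

Lemma integrable_itvB f h a b : mu.-integrable `[a, b] (EFin \o f) ->
  mu.-integrable `[a, b] (EFin \o h) ->
  mu.-integrable `[a, b] (EFin \o (fun t => f t - h t)).
Proof. by move=> fi hi; apply: (integrableB _ fi hi). Qed.

Lemma Rintegral_cat f a b c : a <= b -> b <= c ->
  mu.-integrable `[a, c] (EFin \o f) ->
  \int[mu]_(t in `[a, c]) f t
  = \int[mu]_(t in `[a, b]) f t + \int[mu]_(t in `[b, c]) f t.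
Proof.
move=> ab bc fi; apply/eqP; rewrite addrC -subr_eq; apply/eqP.
rewrite (@Rintegral_itvB _ _ (BLeft a) (BRight c) b)//.
rewrite Rintegral_itv_obnd_cbnd//; apply: integrableS fi => //.
by apply: subset_itv; rewrite bnd_simp.
Qed.

Lemma Rintegral_itv_sub f a b c : a <= b -> b <= c ->
  mu.-integrable `[a, c] (EFin \o f) ->
  \int[mu]_(t in `[b, c]) f t
  = \int[mu]_(t in `[a, c]) f t - \int[mu]_(t in `[a, b]) f t.
Proof. by move=> ab bc fi; rewrite (Rintegral_cat ab bc fi) addrAC subrr add0r. Qed.

Lemma Rintegral_itv_cst a b c : a <= b -> \int[mu]_(t in `[a, b]) c = c * (b - a).
Proof.
move=> ab; rewrite Rintegral_cst//= lebesgue_measure_itv/= lte_fin.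
by case: ltP => // ba; rewrite (@le_anti _ _ a b) ?ab ?ba// subrr.
Qed.

Lemma integrable_itv_continuous f a b : continuous f ->
  mu.-integrable `[a, b] (EFin \o f).
Proof.
move=> cf; apply: continuous_compact_integrable; first exact: segment_compact.
exact: continuous_subspaceT.
Qed.

Lemma integrable_itv_cst a b c : mu.-integrable `[a, b] (EFin \o cst c).
Proof. by apply: integrable_itv_continuous; exact: cst_continuous. Qed.

Lemma integrable_itv_bounded f a b M : measurable_fun setT f ->
  (forall t, a <= t <= b -> `|f t| <= M) ->
  mu.-integrable `[a, b] (EFin \o f).
Proof.
move=> mf fM; apply: (le_integrable _ _ _ (integrable_itv_cst a b M)) => //.
  apply/measurable_EFinP; exact: measurable_funTS.
move=> t; rewrite /= in_itv/= => tab; rewrite lee_fin.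
by rewrite (le_trans (fM _ tab))// ler_norm.
Qed.

Lemma Rintegral_partition f (p : nat -> R) n : {homo p : i j / (i <= j)%N >-> i <= j} ->
  mu.-integrable `[p 0%N, p n] (EFin \o f) ->
  \int[mu]_(t in `[p 0%N, p n]) f t
  = \sum_(j < n) \int[mu]_(t in `[p j, p j.+1]) f t.
Proof.
move=> pmon; elim: n => [_|n ih fi].
  rewrite big_ord0 (_ : `[p 0%N, p 0%N]%classic = [set p 0%N]).
    exact: Rintegral_set1.
  by rewrite set_itv1.
rewrite big_ord_recr/= (@Rintegral_cat _ _ (p n))//; last 2 first.
  exact: pmon.
  exact: pmon.
by rewrite ih//; apply: integrable_itvS fi => //; exact: pmon.
Qed.

(* Integrate [2 x h - x^2 w <= h^2 / w] and optimize over [x]. *)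
Lemma weighted_cauchy_schwarz h w a b : a <= b ->
  (forall t, a <= t <= b -> 0 < w t) ->
  mu.-integrable `[a, b] (EFin \o h) -> mu.-integrable `[a, b] (EFin \o w) ->
  mu.-integrable `[a, b] (EFin \o (fun t => h t ^+ 2 / w t)) ->
  (\int[mu]_(t in `[a, b]) h t) ^+ 2
  <= (\int[mu]_(t in `[a, b]) w t) * \int[mu]_(t in `[a, b]) (h t ^+ 2 / w t).
Proof.
move=> ab w0 ih iw ihw.
set H := \int[mu]_(t in _) h t; set W := \int[mu]_(t in _) w t.
set Q := \int[mu]_(t in _) (_ / _).
have key x : 2 * x * H - x ^+ 2 * W <= Q.
  have i1 := integrable_itvZ (2 * x) ih.
  have i2 := integrable_itvZ (x ^+ 2) iw.
  rewrite -!RintegralZl// -RintegralB//.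
  apply: le_Rintegral => //; first exact: (integrable_itvB i1 i2).
  move=> t; rewrite /= in_itv/= => /w0 wt.
  rewrite ler_pdivlMr// -subr_ge0.
  rewrite (_ : _ - _ = (h t - x * w t) ^+ 2); last by ring.
  exact: sqr_ge0.
have W0 : 0 <= W.
  by apply: Rintegral_ge0 => t; rewrite /= in_itv/= => /w0/ltW.
have [W0'|W0'] := eqVneq W 0.
  (* [W] vanishes for [a = b]; the bound is then linear in [x], and for [H != 0] this [x] would give
     [Q + 1 <= Q]. *)
  have := key ((Q + 1) / 2 / H); rewrite W0' !mulr0 mul0r.
  have [->|H0] := eqVneq H 0; first by rewrite expr0n.
  rewrite (_ : 2 * _ * H = Q + 1); last by field.
  by lra.
have {W0 W0'}W0 : 0 < W by rewrite lt_neqAle eq_sym W0' W0.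
have := key (H / W); rewrite (_ : 2 * (H / W) * H - (H / W) ^+ 2 * W = H ^+ 2 / W).
  by rewrite ler_pdivrMr// mulrC.
by field; rewrite gt_eqF.
Qed.

Lemma ae_imp (P Q : R -> Prop) : (forall x, P x -> Q x) ->
  {ae mu, forall x, P x} -> {ae mu, forall x, Q x}.
Proof.
move=> PQ; apply: filterS; first exact: (ae_filter_ringOfSetsType mu).
by move=> x; exact: PQ.
Qed.

Lemma ae_and (P Q : R -> Prop) : {ae mu, forall x, P x} ->
  {ae mu, forall x, Q x} -> {ae mu, forall x, P x /\ Q x}.
Proof. exact: (@filterI _ _ (ae_filter_ringOfSetsType mu)). Qed.

End interval_integrals.

(** * Dyadic step functions, slopes and energies *)

Section dyadic.
Variable R : realType.
Notation mu := (@lebesgue_measure R).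
Implicit Types (f : R -> R) (U : nat -> R).

Let pow2_gt0 k : 0 < 2 ^+ k :> R.
Proof. by rewrite exprn_gt0. Qed.

(** Takes the value [U j] on [[j / 2^k, (j + 1) / 2^k)]. Truncation sends negative arguments to the
    index 0, which is harmless because only [t >= 0] is integrated. *)
Definition dyadic_step k U (t : R) : R := U (Num.truncn (2 ^+ k * t)).

Lemma measurable_dyadic_step k U : measurable_fun setT (dyadic_step k U).
Proof.
pose tr (t : R) : R := (Num.truncn (2 ^+ k * t))%:R.
have mtr : measurable_fun setT tr.
  apply: nondecreasing_measurable => // x y xy.
  by rewrite ler_nat le_truncn// ler_wpM2l// ltW.
move=> _ Y mY; rewrite setTI.
rewrite (_ : _ @^-1` Y = \bigcup_(n in [set n | Y (U n)]) tr @^-1` [set n%:R]).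
  by apply: bigcup_measurable => n _; rewrite -[X in measurable X]setTI; exact: mtr.
apply/seteqP; split => t.
  by move=> Yt; exists (Num.truncn (2 ^+ k * t)).
by move=> [n Yn] /= /eqP; rewrite eqr_nat => /eqP tn; rewrite /dyadic_step tn.
Qed.

Lemma dyadic_stepE k U n t : n%:R / 2 ^+ k <= t < n.+1%:R / 2 ^+ k ->
  dyadic_step k U t = U n.
Proof.
rewrite ler_pdivrMr// ltr_pdivlMr// mulrC => tn.
by rewrite /dyadic_step (truncn_def tn).
Qed.

Lemma integrable_dyadic_step k U b : mu.-integrable `[0, b] (EFin \o dyadic_step k U).
Proof.
pose N := (Num.truncn (2 ^+ k * b)).+1.
apply: (@integrable_itv_bounded _ _ _ _ (\sum_(j < N) `|U j|)).
  exact: measurable_dyadic_step.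
move=> t /andP[t0 tb].
have tN : (Num.truncn (2 ^+ k * t) < N)%N by rewrite ltnS le_truncn// ler_wpM2l// ltW.
by rewrite (bigD1 (Ordinal tN))//= lerDl sumr_ge0.
Qed.

Lemma Rintegral_dyadic_step k U n :
  \int[mu]_(t in `[0, n%:R / 2 ^+ k]) dyadic_step k U t = (\sum_(j < n) U j) / 2 ^+ k.
Proof.
pose p j : R := j%:R / 2 ^+ k.
have p0 : p 0%N = 0 by rewrite /p mul0r.
rewrite -[X in `[X, _]%classic]p0 (@Rintegral_partition _ _ p n)//; last 2 first.
  by move=> i j ij; rewrite ler_pM2r ?invr_gt0// ler_nat.
  by rewrite p0; exact: integrable_dyadic_step.
rewrite big_distrl/=; apply: eq_bigr => j _.
transitivity (\int[mu]_(t in `[p j, p j.+1]) U j); last first.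
  rewrite Rintegral_itv_cst; last by rewrite ler_pM2r ?invr_gt0// ler_nat.
  by rewrite /p -mulrBl -natr1 addrAC subrr add0r mul1r.
rewrite /Rintegral (@eq_integral_itv_bounded _ _ _ (fun=> U j))//.
  by apply: measurable_funTS; exact: measurable_dyadic_step.
move=> t; rewrite in_itv/= => /andP[pt tp]; apply: dyadic_stepE.
by rewrite tp ltW.
Qed.

Lemma dyadic_step_refine k p U t : 0 <= t ->
  dyadic_step k U t = dyadic_step (k + p) (fun j => U (j %/ 2 ^ p)%N) t.
Proof.
move=> t0; rewrite /dyadic_step; congr U.
set n := Num.truncn (2 ^+ (k + p) * t).
have /andP[n1 n2] : n%:R <= 2 ^+ (k + p) * t < n.+1%:R.
  by apply: truncn_itv; rewrite mulr_ge0// ltW.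
have E : 2 ^+ (k + p) * t = 2 ^+ p * (2 ^+ k * t) by rewrite exprD; ring.
apply: truncn_def; rewrite -(ler_pM2l (pow2_gt0 p)) -(ltr_pM2l (pow2_gt0 p)) -E.
rewrite -natrX -!natrM.
have q0 : (0 < 2 ^ p)%N by rewrite expn_gt0.
rewrite (le_trans _ n1) ?ler_nat; last by rewrite mulnC leq_divM.
by rewrite (lt_le_trans n2)// ler_nat mulnC -[(n < _)%N]/(n < _)%N ltn_ceil.
Qed.

(** The slope, on the dyadic interval of index [j], of the piecewise linear interpolation of [f] at
    level [k]. *)
Definition dyadic_slope f k j : R :=
  2 ^+ k * (f (j.+1%:R / 2 ^+ k) - f (j%:R / 2 ^+ k)).

(** The integral over [[0, 1]] of the squared derivative of that interpolation. *)
Definition dyadic_energy f k : R :=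
  (\sum_(j < 2 ^ k) dyadic_slope f k j ^+ 2) / 2 ^+ k.

Lemma dyadic_slopeS f k j :
  dyadic_slope f k.+1 j.*2 + dyadic_slope f k.+1 j.*2.+1 = 2 * dyadic_slope f k j.
Proof.
rewrite /dyadic_slope.
have half i : (i.*2)%:R / 2 ^+ k.+1 = i%:R / 2 ^+ k :> R.
  by rewrite -muln2 natrM exprS; field; rewrite gt_eqF.
rewrite half -doubleS half exprS.
set a := f _; set b := f _; set c := f _; ring.
Qed.

Lemma sum_pow2S (F : nat -> R) k :
  \sum_(j < 2 ^ k.+1) F j = \sum_(j < 2 ^ k) (F j.*2 + F j.*2.+1).
Proof.
rewrite expnS; elim: (2 ^ k)%N => [|n ih]; first by rewrite muln0 !big_ord0.
by rewrite mulnS !addSn add0n !big_ord_recr/= ih addrA -mul2n.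
Qed.

(** Pythagoras for the martingale of slopes: each coarse slope is the average of the finer ones
    below it, so the increments between levels are orthogonal. *)
Lemma dyadic_energy_diff f k p :
  (\sum_(j < 2 ^ (k + p))
     (dyadic_slope f (k + p) j - dyadic_slope f k (j %/ 2 ^ p)%N) ^+ 2) / 2 ^+ (k + p)
  = dyadic_energy f (k + p) - dyadic_energy f k.
Proof.
elim: p => [|p ih].
  rewrite addn0 subrr big1 ?mul0r// => j _.
  by rewrite expn0 divn1 subrr expr0n.
rewrite addnS (sum_pow2S (fun j => (dyadic_slope f (k + p).+1 j -
  dyadic_slope f k (j %/ 2 ^ p.+1)%N) ^+ 2)).
rewrite /dyadic_energy (sum_pow2S (fun j => dyadic_slope f (k + p).+1 j ^+ 2)).
move: ih; rewrite -/(dyadic_energy f k) {1}/dyadic_energy exprS.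
set S2 := \sum_(j < _) _; set T2 := \sum_(j < _) _ ^+ 2.
set S1 := \sum_(j < _) _; set T1 := \sum_(j < _) (_ + _) => ih.
(* With [z = (x + y) / 2] this is [(x-c)^2 + (y-c)^2 = 2 (z-c)^2 + x^2 + y^2 - 2 z^2], summed over
   the dyadic intervals of level [k + p]. *)
suff S1E : S1 = 2 * S2 + T1 - 2 * T2.
  have -> : S1 / (2 * 2 ^+ (k + p)) = S2 / 2 ^+ (k + p)
      + T1 / (2 * 2 ^+ (k + p)) - T2 / 2 ^+ (k + p).
    by rewrite S1E; field; rewrite gt_eqF.
  by rewrite ih; ring.
rewrite /S1 /S2 /T1 /T2 !big_distrr/= -big_split/= -sumrB; apply: eq_bigr => j _.
have -> : (j.*2 %/ 2 ^ p.+1 = j %/ 2 ^ p)%N.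
  by rewrite expnS -muln2 mulnC divnMl.
have -> : (j.*2.+1 %/ 2 ^ p.+1 = j %/ 2 ^ p)%N.
  by rewrite expnS divnMA divn2 /= uphalf_double.
have := dyadic_slopeS f (k + p) j.
set x := dyadic_slope _ _ j.*2; set y := dyadic_slope _ _ j.*2.+1.
set z := dyadic_slope f (k + p) j; set c := dyadic_slope f k _ => xyz.
have -> : z = (x + y) / 2 by rewrite xyz; field.
by field.
Qed.

(** The increments telescope, so at a dyadic point of level [k] the integral is the same for all
    finer levels; this identifies the primitive of the limit in [riesz]. *)
Lemma Rintegral_dyadic_slope f k p n :
  \int[mu]_(t in `[0, n%:R / 2 ^+ k]) dyadic_step (k + p) (dyadic_slope f (k + p)) t
  = f (n%:R / 2 ^+ k) - f 0.
Proof.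
have -> : n%:R / 2 ^+ k = (n * 2 ^ p)%:R / 2 ^+ (k + p) :> R.
  by rewrite natrM natrX exprD; field; rewrite !gt_eqF.
rewrite Rintegral_dyadic_step; set N := (n * _)%N; set m := (k + p)%N.
elim: N => [|N ih]; first by rewrite big_ord0 !mul0r subrr.
rewrite big_ord_recr/= mulrDl ih /dyadic_slope.
set a := f _; set b := f _; set c := f _; field.
by rewrite gt_eqF.
Qed.

End dyadic.

(** * Limits of rapidly Cauchy sequences of integrable functions *)

Section L1_limit.
Variable R : realType.
Notation mu := (@lebesgue_measure R).

Lemma series_abs_cvg (v : R^nat) (M : R) :
  (forall n, \sum_(0 <= i < n) `|v i.+1 - v i| <= M) -> cvgn v.
Proof.
move=> vM.
have -> : v = (fun n => v 0%N + series (telescope v) n).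
  by apply/funext => n; exact: eq_sum_telescope.
apply: is_cvgD; first exact: is_cvg_cst.
apply: normed_cvg; apply: nondecreasing_is_cvgn.
  by apply: nondecreasing_series => i _ _; exact: normr_ge0.
by exists M => _ [n _ <-]; exact: vM.
Qed.

Lemma limn_einf_le (v : (\bar R)^nat) (M : \bar R) :
  (forall n, (v n <= M)%E) -> (limn_einf v <= M)%E.
Proof.
move=> vM; rewrite limn_einf_lim; apply: lime_le; first exact: is_cvg_einfs.
apply: nearW => n; apply: (le_trans _ (vM n)).
by apply: ereal_inf_lbound; exists n => //=.
Qed.

(** Riesz-Fischer: the L^1 distances are summable, so the sequence converges almost everywhere and
    stays below the integrable sum of [u 0] and all increments in absolute value. Dominated
    convergence gives the integrals, Fatou the L^2 bound. *)
Lemma fast_cauchy_limit (u : nat -> R -> R) (C : R) :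
  (forall i, measurable_fun setT (u i)) ->
  mu.-integrable `[0, 1] (EFin \o u 0%N) ->
  (forall i, (\int[mu]_(t in `[0%R, 1%R]) `|u i.+1 t - u i t|%:E
              <= (2 / (2 ^ i.+1)%:R)%:E)%E) ->
  (forall i, (\int[mu]_(t in `[0%R, 1%R]) (u i t ^+ 2)%:E <= C%:E)%E) ->
  exists h : R -> R, [/\ measurable_fun setT h,
    mu.-integrable `[0, 1] (EFin \o h),
    (\int[mu]_(t in `[0%R, 1%R]) (h t ^+ 2)%:E <= C%:E)%E &
    forall b, 0 <= b <= 1 ->
      \int[mu]_(t in `[0, b]) u n t @[n --> \oo] --> \int[mu]_(t in `[0, b]) h t].
Proof.
move=> mu_ iu0 du uC.
pose D : set R := `[0, 1]%classic.
have mD : measurable D by exact: measurable_itv.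
pose d i (t : R) := (`|u i.+1 t - u i t|)%:E.
have md i : measurable_fun D (d i).
  apply: measurable_funTS; apply/measurable_EFinP.
  by apply: measurableT_comp => //; exact: measurable_funB.
pose S t := (\sum_(0 <= i <oo) d i t)%E.
have S0 t : (0 <= S t)%E by apply: nneseries_ge0 => *; rewrite lee_fin.
have mS : measurable_fun D S.
  by apply: (@ge0_emeasurable_sum _ _ _ D d predT) => // *; rewrite lee_fin.
have iS : mu.-integrable D S.
  apply/integrableP; split => //.
  under eq_integral do rewrite gee0_abs//.
  rewrite integral_nneseries//; last by move=> *; rewrite lee_fin.
  apply: (@le_lt_trans _ _ 2%:E); last by rewrite ltry.
  have := @epsilon_trick R (fun=> 0%E) 2 predT (fun=> lexx _) (ler0n _ _).
  rewrite [X in (_ <= X + _)%E]eseries0// add0e; apply: le_trans; apply: lee_nneseries => //.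
    by move=> *; apply: integral_ge0 => *; rewrite lee_fin.
  by move=> n _; rewrite add0e; exact: du.
pose g t := (`|u 0%N t|%:E + S t)%E.
have ig : mu.-integrable D g.
  by apply: integrableD => //; exact: (integrable_norm iu0).
have partial n t : (S t \is a fin_num) ->
    \sum_(0 <= i < n) `|u i.+1 t - u i t| <= fine (S t).
  move=> St; rewrite -lee_fin fineK// -sumEFin.
  by apply: (@nneseries_lim_ge _ (d ^~ t) predT) => *; rewrite lee_fin.
have cvgu t : (S t \is a fin_num) -> cvgn (u ^~ t).
  by move=> /partial St; apply: (@series_abs_cvg _ (fine (S t))) => n; exact: St.
(* The limsup is measurable on the whole line, including the points where the sequence diverges. *)
pose h t := fine (limn_esup (fun n => (u n t)%:E)).
have mh : measurable_fun setT h.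
  apply: measurableT_comp => //; apply: measurable_fun_limn_esup => n.
  exact/measurable_EFinP.
have uh t : (S t \is a fin_num) -> u n t @[n --> \oo] --> h t.
  move=> /cvgu/cvg_ex[l ul]; rewrite /h.
  by have -> : limn_esup (fun n => (u n t)%:E) = l%:E
    by apply: (cvg_limn_einf_sup _).2; apply: cvg_EFin ul => //; exact: nearW.
have aeS : {ae mu, forall t, D t -> S t \is a fin_num} by exact: integrable_ae.
have aeuh : {ae mu, forall t, D t -> (u n t)%:E @[n --> \oo] --> (h t)%:E}.
  apply: ae_imp aeS => t St Dt; apply: cvg_EFin; first exact: nearW.
  exact: uh (St Dt).
have ubnd n t : (`|(u n t)%:E| <= g t)%E.
  rewrite /g abse_EFin (eq_sum_telescope (u^~ t) n)/=.
  apply: (@le_trans _ _ (`|u 0%N t| + \sum_(0 <= i < n) `|u i.+1 t - u i t|)%:E).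
    rewrite lee_fin (le_trans (ler_normD _ _))// lerD2l /series/=.
    exact: ler_norm_sum.
  rewrite EFinD leeD2l// -sumEFin.
  by apply: (@nneseries_lim_ge _ (d ^~ t) predT) => *; rewrite lee_fin.
have sub1 (b : R) : b <= 1 -> `[0, b] `<=` D.
  by move=> b1 t; rewrite /D/= !in_itv/= => /andP[-> /le_trans]; exact.
have DC (b : R) : b <= 1 -> mu.-integrable `[0, b] (EFin \o h) /\
    \int[mu]_(t in `[0, b]) u n t @[n --> \oo] --> \int[mu]_(t in `[0, b]) h t.
  move=> b1.
  have sub := sub1 b b1.
  have [] := @dominated_convergence _ _ _ mu `[0, b] _ (fun n t => (u n t)%:E)
     (EFin \o h) g.
  - by [].
  - move=> n; apply/measurable_EFinP; apply: measurable_funTS; exact: mu_.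
  - by apply/measurable_EFinP; apply: measurable_funTS; exact: mh.
  - by apply: ae_imp aeuh => t H /sub /H.
  - exact: integrableS ig.
  - by apply: aeW => t n _; exact: ubnd.
  move=> ih _ cvgI; split => //.
  apply: fine_cvg.
  by rewrite fineK//; exact: integrable_fin_num.
have [ih _] := DC 1 (lexx 1).
exists h; split => //; last by move=> b /andP[_ b1]; have [] := DC b b1.
have mu2 n : measurable_fun D (fun t => (u n t ^+ 2)%:E).
  by apply: measurable_funTS; apply/measurable_EFinP; exact: measurable_funX.
apply: (@le_trans _ _ (\int[mu]_(t in D) limn_einf (fun n => (u n t ^+ 2)%:E))%E).
  rewrite le_eqVlt; apply/orP; left; apply/eqP; apply: ae_eq_integral => //.
  - by apply: measurable_funTS; apply/measurable_EFinP; exact: measurable_funX.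
  - under [X in measurable_fun _ X]eq_fun do rewrite -[limn_einf _]oppeK -limn_esupN.
    apply: measurableT_comp => //; apply: measurable_fun_limn_esup => n.
    by apply: measurableT_comp => //; exact: mu2.
  apply: ae_imp aeS => t St Dt; apply/esym; apply: (cvg_limn_einf_sup _).1.
  apply: cvg_EFin; first exact: nearW.
  by under eq_fun do rewrite expr2; rewrite expr2; apply: cvgM; exact: uh (St Dt).
apply: (le_trans (@fatou _ _ _ mu D _ _ mu2 _)) => //.
  by move=> n x _; rewrite lee_fin sqr_ge0.
exact: limn_einf_le.
Qed.
End L1_limit.

(** * Bounded dyadic energy and square integrable derivatives *)

Section riesz.
Variable R : realType.
Notation mu := (@lebesgue_measure R).
Implicit Types (f h : R -> R).

Lemma integrable_sqr_le h C : measurable_fun setT h ->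
  (\int[mu]_(t in `[0%R, 1%R]) (h t ^+ 2)%:E <= C%:E)%E ->
  mu.-integrable `[0, 1] (EFin \o (fun t => h t ^+ 2)) /\
  \int[mu]_(t in `[0, 1]) (h t ^+ 2) <= C.
Proof.
move=> mh hC.
have ih : mu.-integrable `[0, 1] (EFin \o (fun t => h t ^+ 2)).
  apply/integrableP; split.
    by apply: measurable_funTS; apply/measurable_EFinP; exact: measurable_funX.
  under eq_integral do rewrite /= ger0_norm ?sqr_ge0//.
  by apply: (le_lt_trans hC); rewrite ltry.
split => //; rewrite -lee_fin /Rintegral fineK//.
exact: integrable_fin_num.
Qed.

Lemma Rintegral_sqr_itv h (a b : R) : 0 <= a -> a <= b -> b <= 1 ->
  mu.-integrable `[0, 1] (EFin \o h) ->
  mu.-integrable `[0, 1] (EFin \o (fun t => h t ^+ 2)) ->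
  (\int[mu]_(t in `[a, b]) h t) ^+ 2
  <= (b - a) * \int[mu]_(t in `[0, 1]) (h t ^+ 2).
Proof.
move=> a0 ab b1 ih ih2.
have ih' : mu.-integrable `[a, b] (EFin \o h) by exact: integrable_itvS ih.
have ih2' : mu.-integrable `[a, b] (EFin \o (fun t => h t ^+ 2)).
  exact: integrable_itvS ih2.
have h1 : (fun t => h t ^+ 2 / cst 1 t) = (fun t => h t ^+ 2).
  by apply/funext => t; rewrite divr1.
have := @weighted_cauchy_schwarz R h (cst 1) a b ab.
rewrite Rintegral_itv_cst// mul1r h1 => CS.
apply: (le_trans (CS _ _ _ _)) => //; first exact: integrable_itv_cst.
rewrite ler_wpM2l ?subr_ge0//.
have sq c d : 0 <= \int[mu]_(t in `[c, d]) (h t ^+ 2).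
  by apply: Rintegral_ge0 => t _; exact: sqr_ge0.
rewrite (@Rintegral_cat _ _ 0 a 1)//; last exact: le_trans b1.
rewrite (@Rintegral_cat _ _ a b 1)//; last exact: integrable_itvS ih2.
by rewrite addrCA lerDl addr_ge0.
Qed.

Lemma dyadic_energy_nd f : nondecreasing_seq (dyadic_energy f).
Proof.
apply/nondecreasing_seqP => k; rewrite -subr_ge0 -addn1 -dyadic_energy_diff.
by rewrite divr_ge0 ?exprn_ge0// sumr_ge0// => j _; exact: sqr_ge0.
Qed.

Lemma dyadic_energy_cvg f C : (forall k, dyadic_energy f k <= C) ->
  cvgn (dyadic_energy f).
Proof.
move=> fC; apply: nondecreasing_is_cvgn; first exact: dyadic_energy_nd.
by exists C => _ [k _ <-].
Qed.

Let slope f k := dyadic_step k (dyadic_slope f k).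

Lemma L2_dist_slope f k p :
  \int[mu]_(t in `[0, 1]) ((slope f (k + p) t - slope f k t) ^+ 2)
  = dyadic_energy f (k + p) - dyadic_energy f k.
Proof.
rewrite -dyadic_energy_diff -(@Rintegral_dyadic_step _ (k + p) (fun j =>
  (dyadic_slope f (k + p) j - dyadic_slope f k (j %/ 2 ^ p)%N) ^+ 2)).
rewrite natrX divff ?expf_neq0//; apply: eq_Rintegral => t.
rewrite inE/= in_itv/= => /andP[t0 _].
by rewrite /slope (@dyadic_step_refine _ k p).
Qed.

Lemma L2_slope f k :
  \int[mu]_(t in `[0, 1]) (slope f k t ^+ 2) = dyadic_energy f k.
Proof.
rewrite /dyadic_energy -(@Rintegral_dyadic_step _ k (fun j => dyadic_slope f k j ^+ 2)).
by rewrite natrX divff ?expf_neq0.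
Qed.

Lemma integrable_L2_dist_slope f k p :
  mu.-integrable `[0, 1] (EFin \o (fun t => (slope f (k + p) t - slope f k t) ^+ 2)).
Proof.
apply: (@eq_integrable _ _ _ mu _ _ (EFin \o dyadic_step (k + p) (fun j =>
  (dyadic_slope f (k + p) j - dyadic_slope f k (j %/ 2 ^ p)%N) ^+ 2))) => //.
  move=> t; rewrite inE/= in_itv/= => /andP[t0 _].
  by rewrite /slope (@dyadic_step_refine _ k p).
exact: integrable_dyadic_step.
Qed.

(** By [L2_dist_slope] the slopes are Cauchy in L^2 once the energies converge. Their limit [h] has
    the right integral up to every dyadic point, and both sides of the formula are continuous in
    [t]. *)
Lemma riesz f : continuous f -> cvgn (dyadic_energy f) ->
  exists h : R -> R, [/\ measurable_fun setT h,
    mu.-integrable `[0, 1] (EFin \o h),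
    mu.-integrable `[0, 1] (EFin \o (fun t => h t ^+ 2)),
    \int[mu]_(t in `[0, 1]) (h t ^+ 2) <= limn (dyadic_energy f) &
    forall t, 0 <= t <= 1 -> f t = f 0 + \int[mu]_(s in `[0, t]) h s].
Proof.
move=> cf cE; set E := limn _.
have leE k : dyadic_energy f k <= E.
  by apply: nondecreasing_cvgn_le => //; exact: dyadic_energy_nd.
(* From level [K i] on the energy gap is at most [4^-i]. The gap is a squared L^2 distance, so
   Cauchy-Schwarz on [[0, 1]] bounds the L^1 distance by [2^-i]. *)
have /choice[K HK] : forall i : nat, exists K, forall k, (K <= k)%N ->
    E - dyadic_energy f k <= (1 / 2 ^+ i) ^+ 2.
  move=> i; have /cvgrPdist_le : dyadic_energy f @ \oo --> E by [].
  move=> /(_ ((1 / 2 ^+ i) ^+ 2)) []; first by rewrite exprn_gt0// divr_gt0.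
  by move=> K _ HK; exists K => k /HK; apply: le_trans; exact: ler_norm.
(* Partial sums make the chosen levels increase, so that consecutive slopes are related by
   refinement. *)
pose k_ i := (\sum_(j < i.+1) (K j).+1)%N.
have k_S i : k_ i.+1 = (k_ i + (K i.+1).+1)%N by rewrite /k_ big_ord_recr.
have k_K i : (K i <= k_ i)%N.
  by rewrite /k_ big_ord_recr/= (leq_trans (leqnSn _))// leq_addl.
have k_i i : (i <= k_ i)%N.
  elim: i => // i ih; rewrite k_S addnS ltnS.
  by rewrite (leq_trans ih)// leq_addr.
pose u i := slope f (k_ i).
have mu_ i : measurable_fun setT (u i) by exact: measurable_dyadic_step.
have iu i : mu.-integrable `[0, 1] (EFin \o u i) by exact: integrable_dyadic_step.
have [||||h [mh ih h2 uh]] := @fast_cauchy_limit R u E.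
- exact: mu_.
- exact: iu.
- move=> i; pose d t := u i.+1 t - u i t.
  have id : mu.-integrable `[0, 1] (EFin \o d) by exact: integrable_itvB.
  have ind : mu.-integrable `[0, 1] (EFin \o (fun t => `|d t|)).
    exact: (integrable_norm id).
  have id2 : mu.-integrable `[0, 1] (EFin \o (fun t => `|d t| ^+ 2)).
    rewrite (_ : (fun t => _) = (fun t => d t ^+ 2)).
      by rewrite /d /u k_S; exact: integrable_L2_dist_slope.
    by apply/funext => t; rewrite real_normK ?num_real.
  have := @Rintegral_sqr_itv _ 0 1 (lexx _) ler01 (lexx _) ind id2.
  rewrite subr0 mul1r.
  under [X in _ <= X -> _]eq_Rintegral do rewrite real_normK ?num_real//.
  rewrite /d /u k_S L2_dist_slope -k_S => H.
  have -> : (2 / (2 ^ i.+1)%:R : R) = 1 / 2 ^+ i.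
    by rewrite natrX exprS; field; rewrite expf_neq0.
  rewrite -[X in (X <= _)%E]fineK; last exact: integrable_fin_num ind.
  rewrite lee_fin -(@ler_pXn2r _ 2) ?nnegrE//; last first.
  + by apply: fine_ge0; apply: integral_ge0 => t _; rewrite lee_fin.
  apply: (le_trans H); apply: le_trans (HK i (k_ i) (k_K i)).
  by rewrite lerD2r leE.
- move=> i; rewrite -[X in (X <= _)%E]fineK ?lee_fin.
    by rewrite -[X in X <= _]/(\int[mu]_(t in `[0, 1]) (u i t ^+ 2)) L2_slope leE.
  have := integrable_dyadic_step (k_ i) (fun j => dyadic_slope f (k_ i) j ^+ 2) 1.
  exact: integrable_fin_num.
have [ih2 h2E] := integrable_sqr_le mh h2.
exists h; split => // t /andP[t0 t1].
have dyad k n : n%:R / 2 ^+ k <= 1 :> R ->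
    \int[mu]_(s in `[0, n%:R / 2 ^+ k]) h s = f (n%:R / 2 ^+ k) - f 0.
  move=> nk1; have nk0 : 0 <= n%:R / 2 ^+ k :> R by rewrite divr_ge0 ?exprn_ge0.
  have L1 : \int[mu]_(t in `[0, n%:R / 2 ^+ k]) u i t @[i --> \oo]
      --> \int[mu]_(s in `[0, n%:R / 2 ^+ k]) h s by apply: uh; rewrite nk0.
  have L2 : \int[mu]_(t in `[0, n%:R / 2 ^+ k]) u i t @[i --> \oo]
      --> f (n%:R / 2 ^+ k) - f 0.
    apply: cvg_near_cst; exists k => // i /= ki.
    have kE : k_ i = (k + (k_ i - k))%N by rewrite subnKC// (leq_trans ki).
    by rewrite /u kE Rintegral_dyadic_slope.
  exact: (cvg_unique (@Rhausdorff R) L1 L2).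
(* The largest dyadic point of level [k] not exceeding [t]; the identity is carried to [t] along
   these points. *)
pose T k : R := (Num.truncn (2 ^+ k * t))%:R / 2 ^+ k.
have T1 k : T k <= t < T k + 1 / 2 ^+ k.
  have /truncn_itv : 0 <= 2 ^+ k * t by rewrite mulr_ge0 ?exprn_ge0.
  rewrite /T -mulrDl natr1 ler_pdivrMr ?exprn_gt0// ltr_pdivlMr ?exprn_gt0//.
  by rewrite mulrC.
have T0 k : 0 <= T k by rewrite divr_ge0 ?exprn_ge0.
have half0 : 1 / 2 ^+ k @[k --> \oo] --> (0 : R).
  have h1 : `|1 / 2| < 1 :> R by rewrite ger0_norm ?divr_ge0//; lra.
  apply: cvg_trans (cvg_geometric 1 h1); apply: near_eq_cvg; apply: nearW => k /=.
  by rewrite /geometric/= !mul1r exprVn.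
have Tt : T k @[k --> \oo] --> t.
  apply/cvgrPdist_lt => e e0; move/cvgrPdist_lt : half0 => /(_ _ e0).
  apply: filterS => k; rewrite sub0r normrN => H.
  have /andP[Tk kT] := T1 k.
  rewrite ger0_norm ?subr_ge0//; apply: lt_le_trans (ltW H).
  by apply: lt_le_trans (ler_norm _); lra.
have lim1 : f (T k) - f 0 @[k --> \oo] --> f t - f 0.
  by apply: cvgB; [exact: (cvg_comp _ _ Tt (cf t))|exact: cvg_cst].
have lim2 : f (T k) - f 0 @[k --> \oo] --> \int[mu]_(s in `[0, t]) h s.
  apply/cvgrPdist_le => e e0.
  (* [E + 1] is the divisor below, since [E] itself may be 0. *)
  have E1 : 0 < E + 1.
    rewrite ltr_wpDl//; apply: le_trans (leE 0%N).
    by rewrite -L2_slope; apply: Rintegral_ge0 => s _; exact: sqr_ge0.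
  move/cvgrPdist_le : half0 => /(_ (e ^+ 2 / (E + 1))) []; first by rewrite divr_gt0 ?exprn_gt0.
  move=> N _ HN; exists N => // k /HN; rewrite /= sub0r normrN => Hk.
  have /andP[Tk kT] := T1 k.
  rewrite -(dyad k (Num.truncn (2 ^+ k * t))) -/(T k); last exact: le_trans t1.
  rewrite (@Rintegral_cat _ _ 0 (T k) t)//; last exact: integrable_itvS ih.
  rewrite addrAC subrr add0r -(@ler_pXn2r _ 2) ?nnegrE ?(ltW e0)//.
  rewrite real_normK ?num_real//.
  apply: (le_trans (Rintegral_sqr_itv _ _ _ ih ih2)) => //.
  apply: (@le_trans _ _ (1 / 2 ^+ k * (E + 1))).
    apply: ler_pM; rewrite ?subr_ge0//; last by rewrite (le_trans h2E)// lerDl.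
      by apply: Rintegral_ge0 => s _; exact: sqr_ge0.
    by rewrite lerBlDl ltW.
  by rewrite -ler_pdivlMr// (le_trans (ler_norm _)).
by rewrite -(cvg_unique (@Rhausdorff R) lim1 lim2) addrC subrK.
Qed.

End riesz.

(** * Integrals of nonnegative functions without measurability *)

Section nonmeasurable_integrands.
Local Open Scope ereal_scope.
Context d (T : measurableType d) (R : realType).
Variable mu : {measure set T -> \bar R}.
Implicit Types (D : set T) (f k : T -> \bar R).

(* The integral of a nonnegative function is a supremum over the simple
   functions below it, hence monotone even without measurability. *)
Lemma ge0_le_integral_nm D f k : (forall x, D x -> 0 <= f x) ->
  (forall x, D x -> f x <= k x) ->
  \int[mu]_(x in D) f x <= \int[mu]_(x in D) k x.
Proof.
move=> f0 fk; have k0 x : D x -> 0 <= k x.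
  by move=> Dx; exact: le_trans (f0 _ Dx) (fk _ Dx).
rewrite !ge0_integralE//; apply: le_ereal_sup => _ [h /= hf <-].
exists h => //= x; apply: le_trans (hf x) _.
by rewrite /patch; case: ifPn => // /set_mem; exact: fk.
Qed.

(** [f] is squeezed between [k] set to 0 on the null set and [k] raised to [+oo] there. Both are
    measurable with the integral of [k], so [f] itself may be nonmeasurable, as the curvature
    integrand might be. *)
Lemma ge0_ae_eq_integral_nm D f k : measurable D ->
  (forall x, D x -> 0 <= f x) -> (forall x, D x -> 0 <= k x) ->
  measurable_fun D k -> {ae mu, forall x, D x -> f x = k x} ->
  \int[mu]_(x in D) f x = \int[mu]_(x in D) k x.
Proof.
move=> mD f0 k0 mk [N [mN N0 fkN]].
have fk x : D x -> ~ N x -> f x = k x.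
  by move=> Dx Nx; apply: contrapT => fkx; apply: Nx; apply: fkN => /(_ Dx).
pose ky x := k x + (cst +oo \_ N) x.
pose k0' := k \_ (~` N).
have mky : measurable_fun D ky.
  apply: emeasurable_funD => //; apply: measurable_funTS.
  by apply/(measurable_restrictT _ _).1.
have mk0' : measurable_fun D k0'.
  apply/(measurable_restrict _ _ _) => //; first exact: measurableC.
  by apply: measurable_funS mk => //; exact: subIsetl.
apply/eqP; rewrite eq_le; apply/andP; split.
  apply: (@le_trans _ _ (\int[mu]_(x in D) ky x)).
    apply: ge0_le_integral_nm => // x Dx; rewrite /ky /patch.
    case: ifPn => [/set_mem Nx|/negP Nx]; last by rewrite adde0 fk// => /mem_set.
    by rewrite addey ?leey// gt_eqF// (lt_le_trans _ (k0 _ Dx)).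
  rewrite le_eqVlt; apply/orP; left; apply/eqP; apply: ae_eq_integral => //.
  exists N; split => // x /= H; apply: contrapT => Nx; apply: H => Dx.
  by rewrite /ky /patch memNset// adde0.
apply: (@le_trans _ _ (\int[mu]_(x in D) k0' x)).
  rewrite le_eqVlt; apply/orP; left; apply/eqP; apply: ae_eq_integral => //.
  exists N; split => // x /= H; apply: contrapT => Nx; apply: H => Dx.
  by rewrite /k0' /patch mem_set.
apply: ge0_le_integral_nm => x Dx; rewrite /k0' /patch.
  by case: ifPn => // _; exact: k0.
by case: ifPn => [/set_mem Nx|_]; [rewrite fk|exact: f0].
Qed.

End nonmeasurable_integrands.

(** * Almost everywhere differentiation of primitives *)

Section primitives.
Variable R : realType.
Notation mu := (@lebesgue_measure R).
Implicit Types (h F : R -> R).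

(** Lebesgue differentiation, for [h] extended by 0 to the line. The endpoints are left out because
    a two-sided derivative there would see values of [F] that the formula does not give. *)
Lemma ae_derive_primitive F h : mu.-integrable `[0, 1] (EFin \o h) ->
  (forall t, 0 <= t <= 1 -> F t = F 0 + \int[mu]_(s in `[0, t]) h s) ->
  {ae mu, forall t : R, 0 < t < 1 -> is_derive t (1 : R) F (h t)}.
Proof.
move=> ih FE.
pose h1 := h \_ `[0, 1].
have lh1 : locally_integrable [set: R] h1 by exact: integrable_locally.
have ih1 y : mu.-integrable `[0, y] (EFin \o h1).
  rewrite -restrict_EFin; apply/integrable_restrict => //=.
  by apply: integrableS ih => //; exact: measurableI.
have := @FTC1 R h1 (BLeft 0) ih1 lh1; apply: ae_imp => t H /andP[t0 t1].
have /H[dF F'] : (BLeft 0%R < BRight t)%E by rewrite /= lte_fin.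
have h1t : h1 t = h t by rewrite /h1 patchE mem_set//= in_itv/= !ltW.
have FF : is_derive t 1 (cst (F 0) + (fun x : R => \int[mu]_(s in `[0, x]) h1 s)) (0 + h t).
  apply: is_deriveD; apply: DeriveDef => //.
  by rewrite -derive1E F'.
rewrite -[h t]add0r; apply: near_eq_is_derive FF.
have : \forall x \near t, x \in `]0, 1[.
  by apply: near_in_itvoo; rewrite in_itv/= t0 t1.
apply: filterS => x; rewrite in_itv/= => /andP[x0 x1].
rewrite [RHS]FE ?ltW//=; congr (F 0 + _); apply: eq_Rintegral => s.
rewrite inE/= in_itv/= => /andP[s0 sx]; rewrite /h1 patchE mem_set//=.
by rewrite in_itv/= s0 (le_trans sx)// ltW.
Qed.

End primitives.

(** * Antiderivatives of continuous functions on the whole line *)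

Section antiderivative.
Variable R : realType.
Notation mu := (@lebesgue_measure R).
Implicit Types (v : R -> R).

Definition antiderivative v (t : R) : R :=
  if 0 <= t then \int[mu]_(s in `[0, t]) v s else - \int[mu]_(s in `[t, 0]) v s.

Lemma antiderivative0 v : antiderivative v 0 = 0.
Proof. by rewrite /antiderivative lexx set_itv1 Rintegral_set1. Qed.

Lemma antiderivativeB v (a b : R) : continuous v -> a <= b ->
  antiderivative v b - antiderivative v a = \int[mu]_(s in `[a, b]) v s.
Proof.
move=> cv ab; rewrite /antiderivative.
have iv c d : mu.-integrable `[c, d] (EFin \o v) by exact: integrable_itv_continuous.
case: leP => [b0|b0]; case: leP => [a0|a0].
- by rewrite -Rintegral_itv_sub.
- by rewrite opprK addrC -Rintegral_cat// ltW.
- by have := lt_le_trans b0 (le_trans a0 ab); rewrite ltxx.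
- by rewrite opprK (Rintegral_cat ab (ltW b0))// addrCA addNr addr0.
Qed.

Lemma is_derive_antiderivative v (t : R) : continuous v ->
  is_derive t (1 : R) (antiderivative v) (v t).
Proof.
move=> cv.
have iv c d : mu.-integrable `[c, d] (EFin \o v) by exact: integrable_itv_continuous.
have [||||dF F'] := @continuous_FTC1_closed R v (t - 1) t (t + 1).
- by rewrite ltrDl.
- exact: iv.
- by rewrite ltrBlDr ltrDl.
- exact: cv.
have FF : is_derive t (1 : R) (cst (antiderivative v (t - 1))
    + (fun x : R => \int[mu]_(s in `[t - 1, x]) v s)) (0 + v t).
  apply: is_deriveD; apply: DeriveDef; first exact: dF.
  by rewrite -derive1E; exact: F'.
rewrite -[v t]add0r; apply: near_eq_is_derive FF.
have : \forall x \near t, x \in `]t - 1, t + 1[.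
  by apply: near_in_itvoo; rewrite in_itv/= ltrBlDr ltrDl ltr01.
apply: filterS => x; rewrite in_itv/= => /andP[x0 x1].
have := antiderivativeB cv (ltW x0) => /eqP; rewrite subr_eq => /eqP ->.
by rewrite addrC.
Qed.

End antiderivative.

(** * Mean value theorem and inverses of increasing functions *)

Section real_calculus.
Variable R : realType.
Implicit Types (v F : R -> R).

Lemma is_derive_continuous F v : (forall t : R, is_derive t (1 : R) F (v t)) -> continuous F.
Proof.
move=> dF t; apply: differentiable_continuous; apply/derivable1_diffP.
exact: ex_derive.
Qed.

Lemma mean_value F v (a b : R) : (forall t : R, is_derive t (1 : R) F (v t)) ->
  exists2 c, (Num.min a b <= c <= Num.max a b) & F b - F a = v c * (b - a).
Proof.
move=> dF; wlog ab : a b / a <= b.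
  move=> H; have /orP[ab|ba] := le_total a b; first exact: (H _ _ ab).
  have [c cab e] := H _ _ ba; exists c; first by rewrite minC maxC.
  by rewrite -opprB e -mulrN opprB.
rewrite (min_idPl ab) (max_idPr ab).
have [c cab ->] := @MVT_segment R F v a b ab (fun x _ => dF x)
  (continuous_subspaceT (is_derive_continuous dF)).
by exists c => //; rewrite in_itv/= in cab.
Qed.

Lemma derive_eq_cst F v v' (F' : R -> R) (t : R) :
  (forall t : R, is_derive t (1 : R) F (v t)) ->
  (forall t : R, is_derive t (1 : R) F' (v' t)) ->
  (forall t, v t = v' t) -> F t - F 0 = F' t - F' 0.
Proof.
move=> dF dF' vv'.
have dB x : is_derive (x : R) (1 : R) (F - F') 0.
  by rewrite -(subrr (v x)) {2}vv'; exact: is_deriveB.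
have := @is_derive_0_is_cst R (F - F') t 0 dB.
by rewrite !fctE; lra.
Qed.

(** [F (t + 1) = F t + 1] together with [F 0 = 0] fixes [F] at the integers, so the intermediate
    value theorem makes it surjective; the inverse is differentiable because [v] does not vanish. *)
Lemma increasing_inverse F v : (forall t : R, is_derive t (1 : R) F (v t)) ->
  (forall t, 0 < v t) -> (forall t, F (t + 1) = F t + 1) -> F 0 = 0 ->
  exists G : R -> R, [/\ cancel F G, cancel G F, {mono F : x y / x < y} &
    forall s : R, is_derive s (1 : R) G (v (G s))^-1].
Proof.
move=> dF v0 FS F0.
have cF := is_derive_continuous dF.
have Flt x y : x < y -> F x < F y.
  move=> xy; rewrite -subr_gt0; have [c _ ->] := mean_value x y dF.
  by rewrite mulr_gt0// subr_gt0.
have Fmono : {mono F : x y / x < y}.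
  move=> x y; apply/idP/idP => [|/Flt//].
  by move=> Fxy; rewrite ltNge; apply/negP; rewrite le_eqVlt => /orP[/eqP yx|/Flt];
    [move: Fxy; rewrite yx ltxx|move=> /(lt_trans Fxy); rewrite ltxx].
have Fn n : F n%:R = n%:R by elim: n => [|n ih]; rewrite ?F0// -natr1 FS ih.
have FNn n : F (- n%:R) = - n%:R.
  elim: n => [|n ih]; first by rewrite oppr0 F0.
  have := FS (- n.+1%:R); rewrite -natr1 opprD subrK ih => e.
  by lra.
have sur y : exists x, F x = y.
  pose n := (Num.truncn `|y|).+1.
  have yn : `|y| <= n%:R by exact/ltW/truncnS_gt.
  move: yn; rewrite ler_norml => /andP[yn1 yn2].
  have ab : - n%:R <= n%:R :> R by have := ler0n R n; lra.
  have [||c _ <-] := @IVT R F (- n%:R) n%:R y ab.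
  - exact: continuous_subspaceT.
  - by rewrite FNn Fn min_l ?max_r ?yn1.
  by exists c.
have [G FG] := choice sur.
have GF : cancel F G.
  move=> x; have := FG (F x); case: (ltgtP (G (F x)) x) => // /Flt + e;
  by rewrite e ltxx.
exists G; split => // s.
rewrite -{1}(FG s); apply: is_derive_inverse.
- by apply: (@filterE _ (nbhs (G s))) => x; exact: GF.
- by apply: (@filterE _ (nbhs (G s))) => x; exact: cF.
- by rewrite gt_eqF.
Qed.

End real_calculus.

(** * Change of variables for measurable integrands *)

Section change_of_variables.
Variable R : realType.
Notation mu := (@lebesgue_measure R).
Variables (F w G : R -> R).
Hypothesis dF : forall t : R, is_derive t (1 : R) F (w t).
Hypothesis w_gt0 : forall t, 0 < w t.
Hypothesis cw : continuous w.
Hypothesis FK : cancel F G.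
Hypothesis GK : cancel G F.

Let cF : continuous F := is_derive_continuous dF.
Let mF : measurable_fun setT F.
Proof. exact: continuous_measurable_fun. Qed.
Let mw : measurable_fun setT w.
Proof. exact: continuous_measurable_fun. Qed.

Let Flt x y : (F x < F y) = (x < y).
Proof.
have lt a b : a < b -> F a < F b.
  move=> ab; rewrite -subr_gt0; have [c _ ->] := mean_value a b dF.
  by rewrite mulr_gt0// subr_gt0.
by case: (ltgtP x y) => [/lt ->//|/lt/ltW|->]; rewrite ?ltxx// leNgt => /negbTE.
Qed.

Let Fle x y : (F x <= F y) = (x <= y).
Proof. by rewrite leNgt Flt -leNgt. Qed.

(** A second description of Lebesgue measure: by the fundamental theorem of calculus it gives []a,
    b]] the mass [b - a], and uniqueness of measures does the rest. This reaches integrands that are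
    only measurable, such as the inner integral of the tangent-point energy. *)
Definition pullback_measure (A : set (measurableTypeR R)) : \bar R :=
  (\int[mu]_(x in F @^-1` A) (w x)%:E)%E.

Let mpre (A : set R) : measurable A -> measurable (F @^-1` A).
Proof. by move=> mA; rewrite -[X in measurable X]setTI; exact: mF. Qed.

Let pullback0 : pullback_measure set0 = 0%E.
Proof. by rewrite /pullback_measure preimage_set0 integral_set0. Qed.

Let pullback_ge0 A : (0 <= pullback_measure A)%E.
Proof. by apply: integral_ge0 => x _; rewrite lee_fin ltW. Qed.

Let pullback_additive : semi_sigma_additive pullback_measure.
Proof.
move=> /= A mA tA mUA; rewrite /pullback_measure; apply: cvg_toP.
  apply: ereal_nondecreasing_is_cvgn => m n mn.
  apply: lee_sum_nneg_natr => // k _ _; exact: pullback_ge0.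
rewrite preimage_bigcup ge0_integral_bigcup//=.
- by move=> k; exact: (mpre (mA k)).
- by apply: measurable_funTS; exact/measurable_EFinP.
- by move=> x _; rewrite lee_fin ltW.
- move=> i j _ _ [x [/= Ai Aj]]; apply: (tA i j) => //; by exists (F x).
Qed.

HB.instance Definition _ := isMeasure.Build _ _ _ pullback_measure
  pullback0 pullback_ge0 pullback_additive.

Lemma pullback_measureE A : measurable A -> mu A = pullback_measure A.
Proof.
move=> mA; apply: lebesgue_measure_unique => // _ [[a b]] _ <-/=.
rewrite /pullback_measure lebesgue_measure_itv/= lte_fin.
have [ab|ba] := ltP a b; last first.
  rewrite (_ : _ @^-1` _ = set0) ?integral_set0//.
  apply/seteqP; split => // x /=; rewrite in_itv/= => /andP[ax xb].
  by have := lt_le_trans ax (le_trans xb ba); rewrite ltxx.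
rewrite (_ : _ @^-1` _ = `]G a, G b]%classic); last first.
  by apply/seteqP; split => x /=; rewrite !in_itv/= -(Flt (G a) x) -(Fle x (G b)) !GK.
rewrite integral_itv_obnd_cbnd; last first.
  by apply: measurable_funTS; exact/measurable_EFinP.
rewrite (@continuous_FTC2 R w F)// ?GK//.
- by rewrite -Flt !GK.
- exact: continuous_subspaceT.
- split; first by move=> x _; exact: ex_derive.
  + by apply: cvg_at_right_filter; exact: cF.
  + by apply: cvg_at_left_filter; exact: cF.
- by move=> x _; rewrite derive1E derive_val.
Qed.

Import HBNNSimple.

Let cov_indic (A : set R) : measurable A ->
  (\int[mu]_y (\1_A y)%:E = \int[mu]_x ((\1_A (F x))%:E * (w x)%:E))%E.
Proof.
move=> mA; rewrite integral_indic// setIT [LHS]pullback_measureE//.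
rewrite /pullback_measure integral_mkcond; apply: eq_integral => x _.
rewrite /patch indicE; have -> : (x \in F @^-1` A) = (F x \in A).
  by apply/idP/idP => /set_mem H; apply/mem_set.
by case: ifPn => xA; rewrite ?mul1e ?mul0e.
Qed.

Let cov_nnsfun (f : {nnsfun _ >-> R}) :
  (\int[mu]_y (f y)%:E = \int[mu]_x ((f (F x))%:E * (w x)%:E))%E.
Proof.
under [LHS]eq_integral do rewrite fimfunE -fsumEFin//.
rewrite [LHS]ge0_integral_fsum//; last 2 first.
  - by move=> r; exact/measurable_EFinP/measurableT_comp.
  - by move=> n x _; rewrite EFinM nnfun_muleindic_ge0.
under [RHS]eq_integral.
  move=> x xD; rewrite fimfunE -fsumEFin// ge0_mule_fsuml; last first.
    by move=> r; rewrite EFinM nnfun_muleindic_ge0.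
  over.
have mf1 (r : R) : measurable (f @^-1` [set r]).
  by have := @measurable_funPTI _ _ _ _ f [set r] (measurable_set1 r).
have mi (r : R) : measurable_fun setT (fun x : R => \1_(f @^-1` [set r]) (F x) : R).
  by apply: measurableT_comp mF; apply: measurable_indic; exact: mf1.
rewrite [RHS]ge0_integral_fsum//; last 2 first.
  - move=> r; apply: emeasurable_funM; last exact/measurable_EFinP.
    by apply/measurable_EFinP; apply: measurable_funM => //; exact: mi.
  - move=> n x _; rewrite EFinM mule_ge0//; first by rewrite nnfun_muleindic_ge0.
    by rewrite lee_fin ltW.
apply: eq_fsbigr => r /set_mem[z _ <-].
rewrite integralZl_indic_nnsfun//= cov_indic//.
rewrite -ge0_integralZl//.
- by apply: eq_integral => x _; rewrite EFinM muleA.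
- apply: emeasurable_funM; last exact/measurable_EFinP.
  by apply/measurable_EFinP; exact: mi.
- by move=> x _; rewrite -EFinM lee_fin mulr_ge0// ltW.
- by rewrite lee_fin.
- exact: mf1.
Qed.

(** Indicators are handled by [pullback_measureE], simple functions by linearity, and the general
    case by monotone convergence. *)
Lemma ge0_change_of_variablesT (f : measurableTypeR R -> \bar R) :
  measurable_fun setT f -> (forall x, (0 <= f x)%E) ->
  (\int[mu]_y f y = \int[mu]_x (f (F x) * (w x)%:E))%E.
Proof.
move=> mf f0.
pose f_ := nnsfun_approx measurableT mf.
transitivity (limn (fun n => \int[mu]_x (f_ n x)%:E)%E).
  rewrite -monotone_convergence//=.
  - apply: eq_integral => x _; apply/esym/cvg_lim => //=.
    exact: cvg_nnsfun_approx.
  - by move=> n; apply/measurable_EFinP; have := @measurable_funPT _ _ _ _ (f_ n).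
  - by move=> n x _; rewrite lee_fin.
  - by move=> x _ a b ab; rewrite lee_fin; exact/lefP/nd_nnsfun_approx.
under eq_fun do rewrite cov_nnsfun.
rewrite -monotone_convergence//=.
- apply: eq_integral => x _; apply/cvg_lim => //=; apply: cvgeZr => //.
  exact: cvg_nnsfun_approx.
- move=> n; apply: emeasurable_funM; last exact/measurable_EFinP.
  by apply/measurable_EFinP; apply: measurableT_comp mF; have := @measurable_funPT _ _ _ _ (f_ n).
- by move=> n x _; rewrite mule_ge0// lee_fin// ltW.
- move=> x _ a b ab; rewrite lee_wpmul2r ?lee_fin ?(ltW (w_gt0 _))//.
  by have /lefP := nd_nnsfun_approx measurableT mf ab; exact.
Qed.

Lemma ge0_change_of_variables (f : R -> \bar R) a b :
  measurable_fun `[F a, F b] f -> (forall x, F a <= x <= F b -> (0 <= f x)%E) ->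
  (\int[mu]_(y in `[F a, F b]) f y
   = \int[mu]_(x in `[a, b]) (f (F x) * (w x)%:E))%E.
Proof.
move=> mf f0; rewrite integral_mkcond ge0_change_of_variablesT; first last.
- move=> x; rewrite /patch; case: ifPn => // /set_mem/=.
  by rewrite in_itv/=; exact: f0.
- exact/(measurable_restrictT _ _).1.
rewrite [RHS]integral_mkcond; apply: eq_integral => x _; rewrite /patch.
have -> : (F x \in `[F a, F b]%classic) = (x \in `[a, b]%classic).
  by apply/idP/idP => /set_mem/= H; apply/mem_set => /=; move: H;
    rewrite !in_itv/= !Fle.
by case: ifPn => //; rewrite mul0e.
Qed.

End change_of_variables.

(** * Derivatives, continuity and periodicity of curves *)

Section curves.
Variable R : realType.
Implicit Types (g v : R -> 'rV[R]_3) (F : R -> R).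

(** Coordinatewise, so that scalar calculus applies. The derivative is a separate argument because
    the limit tangent is constructed before the limit curve. *)
Definition curve_deriv g v := forall (t : R) i,
  is_derive t (1 : R) (fun s => g s ord0 i) (v t ord0 i).

Lemma derivable_curve_deriv g : (forall t : R, derivable g t 1) ->
  curve_deriv g (derive1 g).
Proof.
move=> dg t i; apply: DeriveDef; first by have /derivable_mxP := dg t; exact.
by rewrite derive1E derive_mx// mxE.
Qed.

Lemma curve_deriv_derivable g v : curve_deriv g v -> forall t : R, derivable g t 1.
Proof. by move=> dg t; apply/derivable_mxP => i j; rewrite (ord1 i); case: (dg t j). Qed.

Lemma curve_deriv_derive1 g v : curve_deriv g v -> derive1 g = v.
Proof.
move=> dg; apply/funext => t; rewrite derive1E derive_mx; last exact: curve_deriv_derivable dg t.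
by apply/rowP => i; rewrite mxE; case: (dg t i).
Qed.

Lemma continuous_coordP g :
  (forall i, continuous (fun s => g s ord0 i)) -> continuous g.
Proof.
move=> cg t; apply/cvgrPdist_le => e e0.
have H i : \forall x \near t, `|g t ord0 i - g x ord0 i| <= e.
  by have /cvgrPdist_le := cg i t; exact.
have : \forall x \near t, forall i : 'I_3, `|g t ord0 i - g x ord0 i| <= e.
  exact: (@filter_forall R 'I_3 (fun i x => `|g t ord0 i - g x ord0 i| <= e) (nbhs t) _ H).
apply: filterS => x Hx; apply: norm_leP => [|i]; first exact: ltW.
by rewrite !mxE.
Qed.

Lemma continuous_coord g i : continuous g -> continuous (fun s => g s ord0 i).
Proof.
move=> cg t; apply: (@continuous_comp _ _ _ g (fun M : 'rV[R]_3 => M ord0 i)).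
  exact: cg.
exact: coord_continuous.
Qed.

Lemma curve_deriv_continuous g v : curve_deriv g v -> continuous g.
Proof.
move=> dg; apply: continuous_coordP => i.
by apply: is_derive_continuous => t; exact: dg.
Qed.

Lemma continuous_dotv g v : continuous g -> continuous v ->
  continuous (fun s => dotv (g s) (v s)).
Proof.
move=> cg cv; under [X in continuous X]eq_fun do rewrite dotvE; move=> t.
by apply: cvgD; [apply: cvgD|]; apply: cvgM; exact: continuous_coord.
Qed.

Lemma continuous_enorm g : continuous g -> continuous (fun s => enorm (g s)).
Proof.
move=> cg t; apply: (@continuous_comp _ _ _ (fun s => dotv (g s) (g s)) (@Num.sqrt R)).
  exact: continuous_dotv.
exact: sqrt_continuous.
Qed.

Lemma continuous_enormT : continuous (@enorm R).
Proof.
move=> x; apply/(@cvgrPdist_le _ _ _ (nbhs x) (nbhs_filter x)) => e e0.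
apply/nbhs_ballP; exists (e / 2) => [|y]; first by rewrite /= divr_gt0.
rewrite -ball_normE /= => xy; apply: (le_trans (ler_dist_enorm _ _)).
by apply: (le_trans (enorm_le_norm _)); move: xy; lra.
Qed.

Lemma is_derive_dotv g v u (t : R) : curve_deriv g v ->
  is_derive t (1 : R) (fun s => dotv (g s) u) (dotv (v t) u).
Proof.
move=> dg; rewrite dotvE.
rewrite (_ : (fun s => dotv (g s) u) =
 (fun s => (u ord0 ord0 *: g s ord0 ord0
  + u ord0 (lift ord0 ord0) *: g s ord0 (lift ord0 ord0)
  + u ord0 (lift ord0 (lift ord0 ord0)) *: g s ord0 (lift ord0 (lift ord0 ord0))) : R)); last first.
  by apply/funext => s; rewrite dotvE /GRing.scale/=; ring.
have e x y : x * y = y *: x :> R by rewrite mulrC.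
rewrite !e.
by apply: is_deriveD; [apply: is_deriveD|]; apply: is_deriveZ.
Qed.

Lemma periodic_nat F n t : (forall t, F (t + 1) = F t) -> F (t + n%:R) = F t.
Proof. by move=> pF; elim: n => [|n ih]; rewrite ?addr0// -natr1 addrA pF. Qed.

Lemma periodic_int F (z : int) t : (forall t, F (t + 1) = F t) -> F (t + z%:~R) = F t.
Proof.
move=> pF; case: z => n; first exact: periodic_nat.
by rewrite NegzE -[LHS](periodic_nat n.+1 _ pF) mulrNz subrK.
Qed.

(** After an integer shift, an interval shorter than 1 crosses at most one integer; splitting there
    and [(a + b)^2 <= 2 a^2 + 2 b^2] cost the factor 2. Parameters at least 1 apart are moved into
    [[0, 1)], where their distance is at most 1. *)
Lemma holder_periodic F C : (forall t, F (t + 1) = F t) -> 0 <= C ->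
  (forall s t, 0 <= s <= 1 -> 0 <= t <= 1 -> (F s - F t) ^+ 2 <= C * `|s - t|) ->
  forall s t, (F s - F t) ^+ 2 <= 2 * C * `|s - t|.
Proof.
move=> pF C0 HF s t; wlog st : s t / s <= t.
  move=> H; have /orP[st|ts] := le_total s t; first exact: H.
  by rewrite -sqrrN opprB distrC; exact: H.
have shift x : exists2 y, 0 <= y < 1 & F y = F x /\ exists z : int, y = x + z%:~R.
  exists (x - (Num.floor x)%:~R).
    have /andP[x1 x2] := floor_itv x; rewrite intrD in x2.
    by rewrite subr_ge0 x1/= ltrBlDl.
  rewrite -mulrNz periodic_int//; split => //.
  by exists (- Num.floor x).
have [ts1|ts1] := leP 1 (t - s).
  have [s' s'1 [<- _]] := shift s; have [t' t'1 [<- _]] := shift t.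
  apply: le_trans (HF _ _ _ _) _; [lra|lra|].
  rewrite (ler0_norm (_ : s - t <= 0)); last by rewrite subr_le0.
  have : `|s' - t'| <= 1 by rewrite ler_norml; lra.
  by move=> H; nra.
have [s' s'1 [<- [z s'E]]] := shift s.
have -> : F t = F (t + z%:~R) by rewrite periodic_int.
have -> : s - t = s' - (t + z%:~R) by rewrite s'E; ring.
set t' := t + z%:~R.
have st' : s' <= t' by rewrite s'E /t' lerD2r.
have ts1' : t' - s' < 1 by rewrite s'E /t'; lra.
have [t1|t1] := leP t' 1.
  apply: le_trans (HF _ _ _ _) _; [lra|lra|].
  by have := normr_ge0 (s' - t'); nra.
have h1 := HF s' 1; have h2 := HF 0 (t' - 1).
have e1 : F t' = F (t' - 1) by rewrite -[RHS]pF subrK.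
have e2 : F 1 = F 0 by rewrite -[in LHS](add0r 1) pF.
rewrite e1; move: h1 h2; rewrite e2 sub0r normrN => h1 h2.
have {}h1 : (F s' - F 0) ^+ 2 <= C * (1 - s').
  by apply: le_trans (h1 _ _) _; rewrite ?ler0_norm; lra.
have {}h2 : (F 0 - F (t' - 1)) ^+ 2 <= C * (t' - 1).
  by apply: le_trans (h2 _ _) _; rewrite ?ger0_norm; lra.
rewrite ler0_norm; last lra.
have := sqr_ge0 ((F s' - F 0) - (F 0 - F (t' - 1))).
by move: h1 h2; set a := F s'; set b := F 0; set c := F _; nra.
Qed.

Lemma holder_continuous F C :
  (forall s t, (F s - F t) ^+ 2 <= C * `|s - t|) -> continuous F.
Proof.
move=> HF t; apply/cvgrPdist_le => e e0.
have C1 : 0 < `|C| + 1 by rewrite ltr_wpDl.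
near=> x; rewrite -(@ler_pXn2r _ 2) ?nnegrE ?(ltW e0)// real_normK ?num_real//.
apply: (le_trans (HF _ _)).
apply: (@le_trans _ _ ((`|C| + 1) * `|t - x|)).
  by rewrite ler_wpM2r// (le_trans (ler_norm _))// lerDl.
rewrite mulrC -ler_pdivlMr//; near: x.
apply/nbhs_ballP; exists (e ^+ 2 / (`|C| + 1)) => [|y]/=.
  by rewrite divr_gt0// exprn_gt0.
exact: ltW.
Unshelve. all: by end_near. Qed.

End curves.

(** * Dyadic energies and the bending energy *)

Section energy.
Variable R : realType.
Notation mu := (@lebesgue_measure R).
Implicit Types (g v : R -> 'rV[R]_3) (F h w : R -> R).

Lemma ae_itv01 (P : R -> Prop) : {ae mu, forall t, 0 < t < 1 -> P t} ->
  {ae mu, forall t, `[0, 1]%classic t -> P t}.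
Proof.
move=> aeP.
have ne (a : R) : {ae mu, forall t, t <> a}.
  by exists [set a]; split => // [|t /= /contrapT]; rewrite ?lebesgue_measure_set1.
apply: ae_imp (ae_and aeP (ae_and (ne 0) (ne 1))) => t [H [/eqP t0 /eqP t1]] /=.
by rewrite in_itv/= => /andP[t0' t1']; apply: H; rewrite !lt_neqAle eq_sym t0 t0' t1.
Qed.

(** The composite is never differentiated. [tau] maps each dyadic interval to one of [w]-mass
    [2^-k], and the weighted Cauchy-Schwarz inequality bounds the squared increment by this mass
    times the integral of [h^2 / w]. *)
Lemma dyadic_energy_comp_le F h w (tau : R -> R) k :
  mu.-integrable `[0, 1] (EFin \o h) -> continuous w -> (forall t, 0 < w t) ->
  mu.-integrable `[0, 1] (EFin \o (fun t => h t ^+ 2 / w t)) ->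
  (forall t, 0 <= t <= 1 -> F t = F 0 + \int[mu]_(s in `[0, t]) h s) ->
  {homo tau : x y / x <= y} -> tau 0 = 0 -> tau 1 = 1 ->
  (forall a b, a <= b -> \int[mu]_(s in `[tau a, tau b]) w s = b - a) ->
  dyadic_energy (F \o tau) k <= \int[mu]_(s in `[0, 1]) (h s ^+ 2 / w s).
Proof.
move=> ih cw w0 ihw FE tau_le tau0 tau1 tauw.
pose p j := tau (j%:R / 2 ^+ k).
have k0 : 0 < 2 ^+ k :> R by rewrite exprn_gt0.
have p0 : p 0%N = 0 by rewrite /p mul0r.
have p1 : p (2 ^ k)%N = 1 by rewrite /p natrX divff ?expf_neq0.
have pmono : {homo p : i j / (i <= j)%N >-> i <= j}.
  by move=> i j ij; apply: tau_le; rewrite ler_pM2r ?invr_gt0// ler_nat.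
have := @Rintegral_partition R (fun s => h s ^+ 2 / w s) p (2 ^ k) pmono.
rewrite p0 p1 => ->//.
rewrite /dyadic_energy big_distrl/=; apply: ler_sum => j _.
have pj0 : 0 <= p j by rewrite -p0; exact: pmono.
have pj1 : p j.+1 <= 1 by rewrite -p1; exact: pmono.
have pj : p j <= p j.+1 by exact: pmono.
have := @weighted_cauchy_schwarz R h w (p j) (p j.+1) pj (fun t _ => w0 t).
rewrite tauw; last by rewrite ler_pM2r ?invr_gt0// ler_nat.
rewrite (_ : _ - _ = (2 ^+ k)^-1); last first.
  by rewrite -mulrBl -natr1 addrAC subrr add0r mul1r.
move=> CS; have {}CS := CS (integrable_itvS pj0 pj1 ih)
   (integrable_itv_continuous _ _ cw) (integrable_itvS pj0 pj1 ihw).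
rewrite /dyadic_slope/= -/(p j) -/(p j.+1).
rewrite (FE (p j.+1)) ?(le_trans pj0)// (FE (p j)) ?pj0 ?(le_trans pj)//.
rewrite opprD addrACA subrr add0r -Rintegral_itv_sub//; last first.
  exact: (integrable_itvS (lexx _) pj1 ih).
set I := \int[mu]_(s in _) h s in CS *.
rewrite (_ : _ / _ = 2 ^+ k * I ^+ 2); last by field; rewrite gt_eqF.
by rewrite -ler_pdivlMl.
Qed.

Lemma dyadic_energy_le F h k :
  mu.-integrable `[0, 1] (EFin \o h) ->
  mu.-integrable `[0, 1] (EFin \o (fun t => h t ^+ 2)) ->
  (forall t, 0 <= t <= 1 -> F t = F 0 + \int[mu]_(s in `[0, t]) h s) ->
  dyadic_energy F k <= \int[mu]_(s in `[0, 1]) (h s ^+ 2).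
Proof.
move=> ih ih2 FE.
have h1 : (fun t => h t ^+ 2 / cst 1 t) = (fun t => h t ^+ 2).
  by apply/funext => t; rewrite divr1.
have := @dyadic_energy_comp_le F h (cst 1) id k ih.
rewrite h1; apply => //; first exact: cst_continuous.
by move=> a b ab; rewrite Rintegral_itv_cst// mul1r.
Qed.

Lemma riesz_vec v (C : R) : continuous v ->
  (forall k, \sum_(i < 3) dyadic_energy (fun s => v s ord0 i) k <= C) ->
  exists h : 'I_3 -> R -> R,
    (forall i, [/\ measurable_fun setT (h i),
      mu.-integrable `[0, 1] (EFin \o h i),
      mu.-integrable `[0, 1] (EFin \o (fun t => h i t ^+ 2)) &
      forall t, 0 <= t <= 1 ->
        v t ord0 i = v 0 ord0 i + \int[mu]_(s in `[0, t]) h i s]) /\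
    \sum_(i < 3) \int[mu]_(t in `[0, 1]) (h i t ^+ 2) <= C.
Proof.
move=> cv vC.
have E0 i k : 0 <= dyadic_energy (fun s => v s ord0 i) k.
  by rewrite divr_ge0 ?exprn_ge0// sumr_ge0// => j _; exact: sqr_ge0.
have cE i : cvgn (dyadic_energy (fun s => v s ord0 i)).
  apply: (@dyadic_energy_cvg _ _ C) => k; apply: le_trans (vC k).
  by rewrite (bigD1 i)//= lerDl sumr_ge0.
have /choice[h Hh] i := riesz (@continuous_coord _ v i cv) (cE i).
exists h; split; first by move=> i; have [] := Hh i.
apply: (@le_trans _ _ (\sum_(i < 3) limn (dyadic_energy (fun s => v s ord0 i)))).
  by apply: ler_sum => i _; have [] := Hh i.
have L : \sum_(i < 3) dyadic_energy (fun s => v s ord0 i) k @[k --> \oo]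
    --> \sum_(i < 3) limn (dyadic_energy (fun s => v s ord0 i)).
  under eq_fun do rewrite !big_ord_recl big_ord0; rewrite !big_ord_recl big_ord0.
  by do 3 (apply: cvgD; first exact: cE); exact: cvg_cst.
rewrite -(cvg_lim _ L)//; apply: limr_le; first by apply/cvg_ex; eexists; exact: L.
exact: nearW.
Qed.

Lemma derive1_row v (w : 'rV[R]_3) (t : R) :
  (forall i, is_derive t (1 : R) (fun s => v s ord0 i) (w ord0 i)) ->
  derive1 v t = w.
Proof.
move=> dv; rewrite derive1E derive_mx.
  by apply/rowP => i; rewrite mxE; case: (dv i).
by apply/derivable_mxP => i j; rewrite (ord1 i); case: (dv j).
Qed.

Lemma ae_derive_row v (h : 'I_3 -> R -> R) :
  (forall i, mu.-integrable `[0, 1] (EFin \o h i)) ->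
  (forall i t, 0 <= t <= 1 ->
     v t ord0 i = v 0 ord0 i + \int[mu]_(s in `[0, t]) h i s) ->
  {ae mu, forall t : R, `[0, 1]%classic t ->
     forall i, is_derive t (1 : R) (fun s => v s ord0 i) (h i t)}.
Proof.
move=> ih vE; apply: ae_itv01.
have H i := ae_derive_primitive (ih i) (vE i).
have := ae_and (H ord0) (ae_and (H (lift ord0 ord0)) (H (lift ord0 (lift ord0 ord0)))).
apply: ae_imp => t [H0 [H1 H2]] t01 i.
case: (unliftP ord0 i) => [j ->|->]; last exact: H0.
case: (unliftP ord0 j) => [l ->|->]; last exact: H1.
by rewrite (ord1 l); exact: H2.
Qed.

Lemma integral_sum_sqr (h : 'I_3 -> R -> R) :
  (forall i, mu.-integrable `[0, 1] (EFin \o (fun t => h i t ^+ 2))) ->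
  (\int[mu]_(t in `[0%R, 1%R]) (\sum_(i < 3) h i t ^+ 2)%:E
   = (\sum_(i < 3) \int[mu]_(t in `[0, 1]) (h i t ^+ 2))%:E)%E.
Proof.
move=> ih; under eq_integral do rewrite -sumEFin.
rewrite integral_sum//= -sumEFin; apply: eq_bigr => i _.
by rewrite /Rintegral fineK//; apply: integrable_fin_num => //; exact: ih.
Qed.

(* [G' = v] has unit length, so the curvature is at most [|G''|]. *)
Lemma arclength_Ebend_le g v (h : 'I_3 -> R -> R) :
  curve_deriv g v -> (forall t, enorm (v t) = 1) ->
  (forall i, [/\ measurable_fun setT (h i),
      mu.-integrable `[0, 1] (EFin \o h i),
      mu.-integrable `[0, 1] (EFin \o (fun t => h i t ^+ 2)) &
      forall t, 0 <= t <= 1 ->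
        v t ord0 i = v 0 ord0 i + \int[mu]_(s in `[0, t]) h i s]) ->
  (Ebend g <= (\sum_(i < 3) \int[mu]_(t in `[0, 1]) (h i t ^+ 2))%:E)%E.
Proof.
move=> dg v1 Hh; rewrite /Ebend.
have gv := curve_deriv_derive1 dg.
rewrite -integral_sum_sqr; last by move=> i; have [] := Hh i.
set f := (fun t => _%:E); set k := (fun t => (\sum_(_ < 3) _)%:E).
(* [f <= k] is known only almost everywhere; the maximum [m] dominates [f] everywhere and agrees
   almost everywhere with the measurable [k]. *)
pose m t := if (f t <= k t)%E then k t else f t.
have f0 t : (0 <= f t)%E by rewrite lee_fin mulr_ge0 ?sqr_ge0 ?enorm_ge0.
have k0 t : (0 <= k t)%E by rewrite lee_fin sumr_ge0// => i _; exact: sqr_ge0.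
apply: (@le_trans _ _ (\int[mu]_(t in `[0%R, 1%R]) m t)%E).
  by apply: ge0_le_integral_nm => t _; [exact: f0|rewrite /m; case: ifPn].
rewrite le_eqVlt; apply/orP; left; apply/eqP; apply: ge0_ae_eq_integral_nm => //.
- by move=> t _; rewrite /m; case: ifPn => _; [exact: k0|exact: f0].
- by move=> t _; exact: k0.
- apply: measurable_funTS; apply/measurable_EFinP.
  apply: measurable_sum => i; apply: measurable_funX.
  by have [] := Hh i.
have ih i : mu.-integrable `[0, 1] (EFin \o h i) by have [] := Hh i.
have vE i : forall t, 0 <= t <= 1 ->
    v t ord0 i = v 0 ord0 i + \int[mu]_(s in `[0, t]) h i s by have [] := Hh i.
apply: ae_imp (ae_derive_row ih vE).
move=> t H /H dv; rewrite /m ifT// /f /k lee_fin /d2 gv v1.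
have -> : derive1 v t = \row_i h i t.
  by apply: derive1_row => i; rewrite mxE; exact: dv.
rewrite expr1n divr1 mulr1 sqr_enorm_perpv -?sqr_enorm ?v1 ?expr1n ?oner_neq0//.
rewrite divr1 sqr_enorm lerBlDr [X in _ <= X + _](_ : _ = dotv (\row_i h i t) (\row_i h i t)).
  by rewrite lerDl sqr_ge0.
by apply: eq_bigr => i _; rewrite mxE expr2.
Qed.

End energy.

(** * The unit tangent and the curvature of a regular curve *)

Section unit_tangent.
Variable R : realType.
Notation mu := (@lebesgue_measure R).
Implicit Types (g v T : R -> 'rV[R]_3) (F f h w : R -> R).

Lemma is_derive_inj f (t a b : R) :
  is_derive t (1 : R) f a -> is_derive t (1 : R) f b -> a = b.
Proof. by move=> [_ <-] [_ <-]. Qed.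

Lemma is_derive_affine F w (c d t : R) : (forall t : R, is_derive t (1 : R) F (w t)) ->
  is_derive t (1 : R) (fun s => F (c * s + d)) (c * w (c * t + d)).
Proof.
move=> dF; rewrite mulrC.
have da : is_derive t (1 : R) (fun s => c * s + d) c.
  have : is_derive t (1 : R) (c *: (id : R -> R) + cst d) (c *: 1 + 0) by exact: is_deriveD.
  by rewrite addr0 [X in is_derive _ _ _ X]mulr1.
have dFt := dF (c * t + d).
exact: (@is_derive1_comp _ F (fun s => c * s + d)).
Qed.

Lemma is_derive_dotv2 (a b : R -> 'rV[R]_3) (a' b' : 'rV[R]_3) (t : R) :
  (forall i, is_derive t (1 : R) (fun s => a s ord0 i) (a' ord0 i)) ->
  (forall i, is_derive t (1 : R) (fun s => b s ord0 i) (b' ord0 i)) ->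
  is_derive t (1 : R) (fun s => dotv (a s) (b s)) (dotv a' (b t) + dotv (a t) b').
Proof.
move=> da db.
have H i : is_derive t (1 : R) (fun s => a s ord0 i * b s ord0 i)
    (a' ord0 i * b t ord0 i + a t ord0 i * b' ord0 i).
  rewrite addrC [X in _ + X]mulrC.
  exact: (@is_deriveM _ _ (fun s => a s ord0 i) (fun s => b s ord0 i)).
rewrite (_ : (fun s => _) = (fun s => a s ord0 ord0 * b s ord0 ord0
  + a s ord0 (lift ord0 ord0) * b s ord0 (lift ord0 ord0)
  + a s ord0 (lift ord0 (lift ord0 ord0)) * b s ord0 (lift ord0 (lift ord0 ord0)))); last first.
  by apply/funext => s; rewrite dotvE.
rewrite !dotvE.
set X := (X in is_derive _ _ _ X).
have -> : X = (a' ord0 ord0 * b t ord0 ord0 + a t ord0 ord0 * b' ord0 ord0)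
  + (a' ord0 (lift ord0 ord0) * b t ord0 (lift ord0 ord0)
    + a t ord0 (lift ord0 ord0) * b' ord0 (lift ord0 ord0))
  + (a' ord0 (lift ord0 (lift ord0 ord0)) * b t ord0 (lift ord0 (lift ord0 ord0))
    + a t ord0 (lift ord0 (lift ord0 ord0)) * b' ord0 (lift ord0 (lift ord0 ord0))).
  by rewrite /X; ring.
exact: is_deriveD.
Qed.

Lemma derive1_periodic g : periodic1 g -> (forall t : R, derivable g t 1) ->
  periodic1 (derive1 g).
Proof.
move=> pg dg t; have dg' := derivable_curve_deriv dg.
apply/rowP => i; apply: (@is_derive_inj (fun s => g s ord0 i) t); last exact: dg'.
have := @is_derive_affine (fun s => g s ord0 i) (fun s => derive1 g s ord0 i) 1 1 t
  (fun s => dg' s i).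
rewrite !mul1r (_ : (fun s : R => _) = (fun s => g s ord0 i))//.
by apply/funext => s; rewrite mul1r pg.
Qed.

Lemma primitive_holder F h : (forall t, F (t + 1) = F t) ->
  mu.-integrable `[0, 1] (EFin \o h) ->
  mu.-integrable `[0, 1] (EFin \o (fun t => h t ^+ 2)) ->
  (forall t, 0 <= t <= 1 -> F t = F 0 + \int[mu]_(s in `[0, t]) h s) ->
  forall s t, (F s - F t) ^+ 2 <= 2 * \int[mu]_(t in `[0, 1]) (h t ^+ 2) * `|s - t|.
Proof.
move=> pF ih ih2 FE; apply: holder_periodic => //.
  by apply: Rintegral_ge0 => t _; exact: sqr_ge0.
have H s t : 0 <= s -> s <= t -> t <= 1 ->
    (F s - F t) ^+ 2 <= \int[mu]_(t in `[0, 1]) (h t ^+ 2) * `|s - t|.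
  move=> s0 st t1; rewrite FE ?s0 ?(le_trans st)// (FE t) ?t1 ?(le_trans s0)//.
  rewrite opprD addrACA subrr add0r -sqrrN opprB -Rintegral_itv_sub//; last first.
    exact: (integrable_itvS (lexx _) t1 ih).
  by rewrite mulrC distrC ger0_norm ?subr_ge0//; exact: Rintegral_sqr_itv.
move=> s t /andP[s0 s1] /andP[t0 t1].
have /orP[st|ts] := le_total s t; first exact: H.
by rewrite -sqrrN opprB distrC; exact: H.
Qed.

Lemma W22_deriv_continuous g : W22 g -> continuous (derive1 g).
Proof.
move=> [pg [dg [h Hh]]]; apply: continuous_coordP => i.
have [ih [ih2 vE]] := Hh i.
apply: (@holder_continuous _ _ (2 * \int[mu]_(t in `[0, 1]) (h i t ^+ 2))).
by apply: primitive_holder ih ih2 vE => x; rewrite (derive1_periodic pg dg).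
Qed.

Lemma sum_dyadic_energy v k :
  \sum_(i < 3) dyadic_energy (fun s => v s ord0 i) k
  = \sum_(j < 2 ^ k) 2 ^+ k * enorm (v (j.+1%:R / 2 ^+ k) - v (j%:R / 2 ^+ k)) ^+ 2.
Proof.
rewrite -big_distrl/= exchange_big/= big_distrl/=; apply: eq_bigr => j _.
rewrite sqr_enorm /dotv big_distrr/= big_distrl/=; apply: eq_bigr => i _.
rewrite /dyadic_slope !mxE; set a := v _ _ _; set b := v _ _ _.
by field; rewrite expf_neq0.
Qed.

Definition unit_tangent g t : 'rV[R]_3 := (enorm (derive1 g t))^-1 *: derive1 g t.

Lemma enorm_unit_tangent g t : regular g -> enorm (unit_tangent g t) = 1.
Proof.
by move=> rg; rewrite enormZ ger0_norm ?invr_ge0 ?enorm_ge0// mulVf// gt_eqF.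
Qed.

(** Of the two summands behind the factor 2, one accounts for the difference of the vectors and the
    other for the difference of their norms. *)
Lemma unit_vector_dist (a b : 'rV[R]_3) (m : R) : 0 < m -> m <= enorm a -> m <= enorm b ->
  enorm ((enorm a)^-1 *: a - (enorm b)^-1 *: b) <= 2 / m * enorm (a - b).
Proof.
move=> m0 ma mb; have a0 := lt_le_trans m0 ma; have b0 := lt_le_trans m0 mb.
rewrite (_ : _ - _ = (enorm a)^-1 *: (a - b)
   + ((enorm b - enorm a) / (enorm a * enorm b)) *: b); last first.
  rewrite scalerBr -addrA; congr (_ + _); rewrite -!scaleNr -scalerDl.
  by congr (_ *: _); field; rewrite !gt_eqF.
apply: (le_trans (enormD _ _)); rewrite !enormZ.
have -> : `|(enorm b - enorm a) / (enorm a * enorm b)| * enorm b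
    = `|enorm b - enorm a| / enorm a.
  rewrite normrM normfV (gtr0_norm (mulr_gt0 a0 b0)).
  by field; rewrite !gt_eqF.
rewrite gtr0_norm ?invr_gt0//.
have ia : (enorm a)^-1 <= m^-1 by rewrite lef_pV2.
have := ler_dist_enorm b a; rewrite enorm_distC => H.
rewrite (_ : 2 / m * _ = m^-1 * enorm (a - b) + enorm (a - b) * m^-1); last by ring.
apply: lerD; first by rewrite ler_wpM2r// enorm_ge0.
by apply: ler_pM => //; rewrite invr_ge0 ltW.
Qed.

(** Curvature is the rate of turning of the unit tangent [T]. From [v = n T] one gets
    [v' = n' T + n k], and [k] is orthogonal to [T] because [T] has constant norm; so the normal
    part of [v'] is [n k] and the bending density is [|k|^2 / n]. *)
Lemma unit_tangent_energy g : W22 g -> regular g ->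
  exists k : 'I_3 -> R -> R, [/\ (forall i, [/\ measurable_fun setT (k i),
      mu.-integrable `[0, 1] (EFin \o k i),
      mu.-integrable `[0, 1] (EFin \o (fun t => k i t ^+ 2 / enorm (derive1 g t))) &
      forall t, 0 <= t <= 1 -> unit_tangent g t ord0 i
        = unit_tangent g 0 ord0 i + \int[mu]_(s in `[0, t]) k i s]) &
    Ebend g = (\sum_(i < 3)
      \int[mu]_(t in `[0, 1]) (k i t ^+ 2 / enorm (derive1 g t)))%:E].
Proof.
move=> Wg rg; have cv := W22_deriv_continuous Wg.
have [pg [dg [h Hh]]] := Wg.
have [v gv] : exists v, v = derive1 g by eexists.
have [n nE] : exists n : R -> R, forall t, n t = enorm (v t) by eexists.
have [T gT] : exists T, T = unit_tangent g by eexists.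
rewrite -gv in cv; rewrite -gv.
have cn : continuous n by rewrite (_ : n = fun t => enorm (v t)); [exact: continuous_enorm|exact/funext].
have n0 t : 0 < n t by rewrite nE gv; exact: rg.
have TvE t : T t = (n t)^-1 *: v t by rewrite gT nE gv.
have cni : continuous (fun t => (n t)^-1).
  by move=> t; apply: cvgV; [rewrite gt_eqF|exact: cn].
have cT : continuous T.
  apply: continuous_coordP => i.
  under [X in continuous X]eq_fun do rewrite TvE mxE; move=> t.
  by apply: cvgM; [exact: cni|exact: (@continuous_coord _ v i cv)].
have [c c01 cmin] := @EVT_min R n 0 1 ler01 (continuous_subspaceT cn).
have [m mE] : exists m, m = n c by eexists.
have m0 : 0 < m by rewrite mE.
rewrite -mE in cmin.
have ih i : mu.-integrable `[0, 1] (EFin \o h i) by have [] := Hh i.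
have ih2 i : mu.-integrable `[0, 1] (EFin \o (fun t => h i t ^+ 2)).
  by have [_ []] := Hh i.
have vE i t : 0 <= t <= 1 ->
    v t ord0 i = v 0 ord0 i + \int[mu]_(s in `[0, t]) h i s.
  by rewrite gv; have [_ [_]] := Hh i; exact.
have [k0 [Hk _]] : exists k : 'I_3 -> R -> R,
    (forall i, [/\ measurable_fun setT (k i),
      mu.-integrable `[0, 1] (EFin \o k i),
      mu.-integrable `[0, 1] (EFin \o (fun t => k i t ^+ 2)) &
      forall t, 0 <= t <= 1 ->
        T t ord0 i = T 0 ord0 i + \int[mu]_(s in `[0, t]) k i s]) /\
    \sum_(i < 3) \int[mu]_(t in `[0, 1]) (k i t ^+ 2)
      <= (2 / m) ^+ 2 * \sum_(i < 3) \int[mu]_(t in `[0, 1]) (h i t ^+ 2).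
  (* Normalization is Lipschitz where the speed is at least [m], so the dyadic energies of [T] are
     controlled by those of [v]. This takes the place of a quotient rule for absolutely continuous
     functions. *)
  apply: riesz_vec => // k.
  apply: (@le_trans _ _ ((2 / m) ^+ 2 *
     \sum_(i < 3) dyadic_energy (fun s => v s ord0 i) k)); last first.
    rewrite ler_wpM2l ?sqr_ge0// ler_sum// => i _.
    by apply: dyadic_energy_le => // t; exact: vE.
  rewrite !sum_dyadic_energy big_distrr/=; apply: ler_sum => j _.
  rewrite [leRHS]mulrCA -exprMn ler_wpM2l ?exprn_ge0//.
  rewrite ler_pXn2r ?nnegrE ?mulr_ge0 ?enorm_ge0 ?invr_ge0 ?(ltW m0)//.
  have k0 : 0 < 2 ^+ k :> R by rewrite exprn_gt0.
  have dy (i : nat) : (i <= 2 ^ k)%N -> m <= n (i%:R / 2 ^+ k).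
    move=> ik; apply: cmin; rewrite in_itv/= divr_ge0 ?(ltW k0)//=.
    by rewrite ler_pdivrMr// mul1r -natrX ler_nat.
  rewrite !TvE !nE; apply: (unit_vector_dist m0); rewrite -nE; apply: dy => //.
  exact: ltnW.
have ik i : mu.-integrable `[0, 1] (EFin \o k0 i) by have [] := Hk i.
have TE i t : 0 <= t <= 1 ->
    T t ord0 i = T 0 ord0 i + \int[mu]_(s in `[0, t]) k0 i s.
  by have [_ _ _] := Hk i; exact.
have mk i : measurable_fun setT (k0 i) by have [] := Hk i.
have mkn i : measurable_fun setT (fun t => k0 i t ^+ 2 / n t).
  apply: measurable_funM; first exact: measurable_funX.
  exact: continuous_measurable_fun.
have ikn i : mu.-integrable `[0, 1] (EFin \o (fun t => k0 i t ^+ 2 / n t)).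
  have [_ _ ik2 _] := Hk i.
  apply: (le_integrable _ _ _ (integrable_itvZ m^-1 ik2)) => //.
    by apply: measurable_funTS; apply/measurable_EFinP; exact: mkn.
  move=> t /=; rewrite in_itv/= => t01; rewrite lee_fin.
  have A : 0 <= k0 i t ^+ 2 / n t by rewrite divr_ge0 ?sqr_ge0 ?(ltW (n0 t)).
  have B : 0 <= m^-1 * k0 i t ^+ 2 by rewrite mulr_ge0 ?sqr_ge0// invr_ge0 ltW.
  rewrite (ger0_norm A) (ger0_norm B) mulrC ler_wpM2r ?sqr_ge0//.
  have mn : m <= n t by apply: cmin; rewrite in_itv.
  by rewrite lef_pV2 ?posrE.
exists k0; split.
  move=> i; rewrite -gT; have [? ? _ ?] := Hk i; split => //.
  rewrite (_ : (fun t => _) = (fun t => k0 i t ^+ 2 / n t)); first exact: ikn.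
  by apply/funext => t; rewrite nE.
have -> : \sum_(i < 3) \int[mu]_(t in `[0, 1]) (k0 i t ^+ 2 / enorm (v t))
    = \sum_(i < 3) \int[mu]_(t in `[0, 1]) (k0 i t ^+ 2 / n t).
  by apply: eq_bigr => i _; apply: eq_Rintegral => t _; rewrite nE.
rewrite -sumEFin.
have -> : (\sum_(i < 3) (\int[mu]_(t in `[0, 1]) (k0 i t ^+ 2 / n t))%:E
   = \int[mu]_(t in `[0%R, 1%R]) (\sum_(i < 3) (k0 i t ^+ 2 / n t))%:E)%E.
  under [RHS]eq_integral do rewrite -sumEFin.
  rewrite [RHS]integral_sum//; apply: eq_bigr => i _.
  by rewrite /Rintegral fineK//; apply: integrable_fin_num => //; exact: ikn.
apply: ge0_ae_eq_integral_nm => //.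
- by move=> t _; rewrite lee_fin mulr_ge0 ?sqr_ge0 ?enorm_ge0.
- by move=> t _; rewrite lee_fin sumr_ge0// => i _; rewrite divr_ge0 ?sqr_ge0 ?(ltW (n0 t)).
- apply: measurable_funTS; apply/measurable_EFinP; apply: measurable_sum => i.
  exact: mkn.
(* Outside a null set both [v] and [T] are differentiable, and the rest is a pointwise
   computation. *)
apply: ae_imp (ae_and (ae_derive_row ih vE) (ae_derive_row ik TE)).
move=> t [Hv HT] t01; have {Hv}Hv := Hv t01; have {HT}HT := HT t01.
pose hh : 'rV[R]_3 := \row_i h i t; pose kk : 'rV[R]_3 := \row_i k0 i t.
have dv i : is_derive t (1 : R) (fun s => v s ord0 i) (hh ord0 i) by rewrite mxE; exact: Hv.
have dT i : is_derive t (1 : R) (fun s => T s ord0 i) (kk ord0 i) by rewrite mxE; exact: HT.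
have vT s : v s = n s *: T s by rewrite TvE scalerA mulfV ?scale1r// gt_eqF.
have TT s : dotv (T s) (T s) = 1.
  by rewrite -sqr_enorm gT enorm_unit_tangent// expr1n.
have nTE s : dotv (v s) (T s) = n s by rewrite {1}vT dotvZl TT mulr1.
have dn := is_derive_dotv2 dv dT.
set n' := (_ + _) in dn.
rewrite (_ : (fun s => _) = n) in dn; last by apply/funext => s; rewrite nTE.
have Tk : dotv (T t) kk = 0.
  have := is_derive_dotv2 dT dT; rewrite (dotvC kk) (_ : (fun s => _) = cst 1).
    move=> /is_derive_inj/(_ (is_derive_cst _ _ _)) => e; lra.
  by apply/funext => s; rewrite TT.
have hE : hh = n' *: T t + n t *: kk.
  apply/rowP => i; rewrite !mxE; apply: (is_derive_inj (Hv i)).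
  have dTi := dT i.
  have := @is_deriveM _ _ n (fun s => T s ord0 i) t 1 n' (kk ord0 i) dn dTi.
  rewrite (_ : n * _ = (fun s => v s ord0 i)).
    by rewrite [X in _ + X]mulrC addrC mxE.
  by apply/funext => s; rewrite (vT s) !mxE.
have -> : d2 g t = hh by rewrite /d2 -gv; apply: derive1_row => i; exact: dv.
rewrite -gv -nE.
have nt0 : n t != 0 by rewrite gt_eqF.
have -> : perpv (v t) hh = n t *: kk.
  rewrite /perpv (vT t) hE !(dotvDl, dotvZl, dotvZr) TT (dotvC kk) Tk.
  rewrite scalerA (_ : _ / _ * n t = n'); last by field; rewrite nt0.
  by rewrite addrAC subrr add0r.
rewrite enormZ gtr0_norm// expr_div_n exprMn sqr_enorm; congr (_%:E).
rewrite (_ : \sum_(i < 3) _ = dotv kk kk / n t); first by field; rewrite nt0.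
by rewrite /dotv big_distrl/=; apply: eq_bigr => i _; rewrite mxE expr2.
Qed.

End unit_tangent.

(** * Measurability of the tangent-point integrand *)

Section tangent_point_kernel.
Variable R : realType.
Notation mu := (@lebesgue_measure R).
Implicit Types (g v : R -> 'rV[R]_3).

(** The integrand of [TP] with the tangent field as a separate argument, so that points and tangents
    can be transformed, or pass to the limit, independently. *)
Definition tp_kernel (q : R) v g (s t : R) : R :=
  (if s == t then 0 else (inv_rtp (v s) (g s) (g t)) `^ q)
    * enorm (v s) * enorm (v t).

Lemma tp_kernel_ge0 q v g s t : 0 <= tp_kernel q v g s t.
Proof.
rewrite !mulr_ge0 ?enorm_ge0//; case: ifPn => // _; exact: powR_ge0.
Qed.

Lemma measurable_tp_kernel q v g : continuous v -> continuous g ->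
  measurable_fun [set: (measurableTypeR R * measurableTypeR R)%type]
    (fun p => tp_kernel q v g p.1 p.2).
Proof.
move=> cv cg.
pose P := (measurableTypeR R * measurableTypeR R)%type.
have mc (f : R -> R) : continuous f -> measurable_fun setT f.
  exact: continuous_measurable_fun.
have m1 (f : R -> R) : continuous f -> measurable_fun [set: P] (fun p => f p.1).
  by move=> cf; apply: (measurableT_comp (mc _ cf)); exact: measurable_fst.
have m2 (f : R -> R) : continuous f -> measurable_fun [set: P] (fun p => f p.2).
  by move=> cf; apply: (measurableT_comp (mc _ cf)); exact: measurable_snd.
have mdot (a b : P -> 'rV[R]_3) :
    (forall i, measurable_fun setT (fun p => a p ord0 i)) ->
    (forall i, measurable_fun setT (fun p => b p ord0 i)) ->
    measurable_fun setT (fun p => dotv (a p) (b p)).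
  by move=> ma mb; apply: measurable_sum => i; exact: measurable_funM.
have mnorm (a : P -> 'rV[R]_3) :
    (forall i, measurable_fun setT (fun p => a p ord0 i)) ->
    measurable_fun setT (fun p => enorm (a p)).
  move=> ma; apply: (measurableT_comp (mc (@Num.sqrt R) _)); last exact: mdot.
  exact: sqrt_continuous.
have minv (f : P -> R) : (forall p, 0 <= f p) -> measurable_fun setT f ->
    measurable_fun setT (fun p => (f p)^-1).
  (* Inversion becomes the power with exponent -1, which agrees with it on nonnegative numbers, 0
     included. *)
  move=> f0 mf; under eq_fun do rewrite -powR_inv1//.
  by apply: (measurableT_comp (measurable_powR _)).
have cvi i := @continuous_coord _ v i cv.
have cgi i := @continuous_coord _ g i cg.
pose w (p : P) := g p.2 - g p.1.
have mw i : measurable_fun setT (fun p => w p ord0 i).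
  under eq_fun do rewrite !mxE.
  by apply: measurable_funB; [exact: (m2 _ (cgi i))|exact: (m1 _ (cgi i))].
have mv i : measurable_fun [set: P] (fun p => v p.1 ord0 i) by exact: (m1 _ (cvi i)).
apply: measurable_funM; last exact: (m2 _ (continuous_enorm cv)).
apply: measurable_funM; last exact: (m1 _ (continuous_enorm cv)).
apply: measurable_fun_ifT.
- by apply: measurable_fun_eqr; [exact: measurable_fst|exact: measurable_snd].
- exact: measurable_cst.
apply: (measurableT_comp (measurable_powR _)).
apply: measurable_funM; last first.
  apply: minv; first by move=> p; exact: sqr_ge0.
  by apply: measurable_funX; exact: (mnorm w mw).
apply: measurable_funM; first exact: measurable_cst.
apply: (mnorm (fun p => perpv (v p.1) (w p))) => i.
rewrite (_ : (fun p => _) = (fun p => w p ord0 i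
    - dotv (w p) (v p.1) / dotv (v p.1) (v p.1) * v p.1 ord0 i)); last first.
  by apply/funext => p; rewrite !mxE.
apply: measurable_funB; first exact: mw.
apply: measurable_funM; last exact: mv.
apply: measurable_funM; first exact: (@mdot w (fun p => v p.1) mw mv).
by apply: minv; [move=> p; exact: dotv_ge0|exact: (@mdot (fun p => v p.1) _ mv mv)].
Qed.

Lemma measurable_tp_kernel_section q v g s : continuous v -> continuous g ->
  measurable_fun setT (tp_kernel q v g s).
Proof.
move=> cv cg.
have mp : measurable_fun [set: measurableTypeR R]
    (fun t => (s, t) : (measurableTypeR R * measurableTypeR R)%type).
  by apply: measurable_fun_pair.
exact: (measurableT_comp (measurable_tp_kernel q cv cg) mp).
Qed.

(** Tonelli on the product space, after moving the domain of the inner variable into the integrand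
    as an indicator. *)
Lemma measurable_tp_potential q v g : continuous v -> continuous g ->
  measurable_fun [set: measurableTypeR R]
    (fun s => \int[mu]_(t in `[0%R, 1%R]) (tp_kernel q v g s t)%:E)%E.
Proof.
move=> cv cg.
pose f (p : measurableTypeR R * measurableTypeR R) : \bar R :=
  ((tp_kernel q v g p.1 p.2)%:E * (\1_(`[0%R, 1%R]%classic : set R) p.2)%:E)%E.
have mf : measurable_fun setT f.
  apply: emeasurable_funM; first by apply/measurable_EFinP; exact: measurable_tp_kernel.
  have mi : measurable_fun [set: measurableTypeR R] (\1_(`[0%R, 1%R]%classic : set R) : R -> R).
    exact: measurable_indic.
  by apply/measurable_EFinP; exact: (measurableT_comp mi measurable_snd).
have -> : (fun s => \int[mu]_(t in `[0%R, 1%R]) (tp_kernel q v g s t)%:E)%E = fubini_F mu f.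
  apply/funext => s; rewrite /fubini_F [LHS]integral_mkcond; apply: eq_integral => t _.
  by rewrite /f/= /patch indicE; case: ifPn => _; rewrite ?mule1 ?mule0.
apply: measurable_fun_fubini_tonelli_F => // p.
by rewrite mule_ge0// lee_fin//; exact: tp_kernel_ge0.
Qed.

Lemma TP_kernelE q g : TP q g = (\int[mu]_(s in `[0%R, 1%R])
  \int[mu]_(t in `[0%R, 1%R]) (tp_kernel q (derive1 g) g s t)%:E)%E.
Proof. by []. Qed.

End tangent_point_kernel.

(** * Ambient isotopies from dilations and small Lipschitz perturbations *)

Section isotopies.
Variable R : realType.
Notation vec := 'rV[R]_3.
Implicit Types (g : R -> vec) (V : vec -> vec).

HB.instance Definition _ := Complete.on vec.

Let cfst (p : R * vec) : q.1 @[q --> p] --> p.1.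
Proof. by case: p => a b; exact: cvg_fst. Qed.

Let csnd (p : R * vec) : q.2 @[q --> p] --> p.2.
Proof. by case: p => a b; exact: cvg_snd. Qed.

(* Composing the two isotopies at equal times avoids any gluing. *)
Lemma same_knot_type_comp (K : R -> vec -> vec) g1 g2 g0 :
  continuous (fun p : R * vec => K p.1 p.2) ->
  (forall t, 0 <= t <= 1 -> exists Ki : vec -> vec,
     [/\ continuous Ki, cancel (K t) Ki & cancel Ki (K t)]) ->
  (forall x, K 0 x = x) -> K 1 @` range g1 = range g2 ->
  same_knot_type g2 g0 -> same_knot_type g1 g0.
Proof.
move=> cK Kinv K0 K1 [H [cH [Hinv [H0 H1]]]].
exists (fun t x => H t (K t x)); split; [|split; [|split]].
- apply/subspace_continuousP => p Ap.
  pose Phi (p : R * vec) := (p.1, K p.1 p.2).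
  have cPhi : continuous Phi.
    move=> [a b]; apply: (@cvg_pair _ _ _ _ (nbhs a) (nbhs (K a b))); first exact: cvg_fst.
    exact: (cK (a, b)).
  (* [H] is continuous only on the strip over [[0, 1]]; [Phi] keeps the time coordinate, hence
     preserves this strip. *)
  have APhi x : (`[0, 1] `*` setT) x -> (`[0, 1] `*` setT) (Phi x) by case.
  have /subspace_continuousP/(_ (Phi p) (APhi _ Ap)) HPhi := cH.
  have cPhi' : Phi @ within (`[0, 1] `*` setT) (nbhs p) -->
      within (`[0, 1] `*` setT) (nbhs (Phi p)).
    move=> B HB; have HB' : nbhs p (Phi @^-1` [set y | (`[0, 1] `*` setT) y -> B y]).
      exact: (cPhi p _ HB).
    apply: (@filterS _ (nbhs p) _ _ _ _ HB') => x /= Hx Ax.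
    by apply: Hx; exact: (APhi x).
  exact: (cvg_comp _ _ cPhi' HPhi).
- move=> t t01; have [Hi [cHt [cHi [HK HiK]]]] := Hinv t t01.
  have [Ki [cKi KK KiK]] := Kinv t t01.
  have cKt : continuous (K t).
    by move=> x; exact: (cvg_comp2 (cvg_cst t) cvg_id (cK (t, x))).
  exists (Ki \o Hi); split; [|split; [|split]].
  + by move=> x; apply: (@continuous_comp _ _ _ (K t) (H t)); [exact: cKt|exact: cHt].
  + by move=> x; apply: continuous_comp; [exact: cHi|exact: cKi].
  + by move=> x /=; rewrite HK KK.
  + by move=> x /=; rewrite KiK HiK.
- by move=> x; rewrite K0 H0.
- by rewrite -H1 -K1 -image_comp.
Qed.

Lemma same_knot_type_scale (L : R) g1 g2 g0 : 0 < L ->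
  (fun x => L *: x) @` range g1 = range g2 ->
  same_knot_type g2 g0 -> same_knot_type g1 g0.
Proof.
move=> L0 rg; pose c (t : R) := 1 - t + t * L.
have c0 t : 0 <= t <= 1 -> 0 < c t by rewrite /c; nra.
apply: (@same_knot_type_comp (fun t x => c t *: x)).
- move=> p; apply: cvgZ; last exact: csnd.
  apply: cvgD; first by apply: cvgB; [exact: cvg_cst|exact: cfst].
  by apply: cvgM; [exact: cfst|exact: cvg_cst].
- move=> t /c0 ct; exists (fun x => (c t)^-1 *: x); split.
  + exact: scaler_continuous.
  + by move=> x; rewrite scalerA mulVf ?scale1r// gt_eqF.
  + by move=> x; rewrite scalerA mulfV ?scale1r// gt_eqF.
- by move=> x; rewrite /c subr0 mul0r addr0 scale1r.
- by rewrite -rg /c subrr add0r mul1r.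
Qed.

Lemma norm_lipschitz_continuous V (l : R) : 0 < l ->
  (forall x y, `|V x - V y| <= l * `|x - y|) -> continuous V.
Proof.
move=> l0 HV x; apply/(@cvgrPdist_le _ _ _ (nbhs x) (nbhs_filter x)) => e e0.
apply/nbhs_ballP; exists (l^-1 * e); first by rewrite /= mulr_gt0// invr_gt0.
move=> y; rewrite -ball_normE /= => xy.
by apply: (le_trans (HV _ _)); rewrite -ler_pdivlMl// ltW.
Qed.

(** Solving [x + t V x = y] is a fixed point problem for the contraction [x -> y - t V x]. Distances
    shrink by at most a factor 2 under the map, which gives injectivity and a Lipschitz inverse. *)
Lemma lipschitz_perturbation_inverse V (t : R) : 0 <= t <= 1 ->
  (forall x y, `|V x - V y| <= 1 / 2 * `|x - y|) ->
  exists Ki : vec -> vec,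
    [/\ continuous Ki, cancel (fun x => x + t *: V x) Ki &
        cancel Ki (fun x => x + t *: V x)].
Proof.
move=> /andP[t0 t1] HV; pose K (x : vec) : vec := x + t *: V x.
have lipK (x y : vec) : `|x - y| <= 2 * `|K x - K y|.
  have : `|t *: (V x - V y)| <= 1 / 2 * `|x - y|.
    rewrite normrZ (ger0_norm t0); apply: le_trans (HV x y).
    by rewrite -[leRHS]mul1r ler_wpM2r.
  have : `|x - y| <= `|K x - K y| + `|t *: (V x - V y)|.
    rewrite [in leLHS](_ : x - y = (K x - K y) - t *: (V x - V y)).
      exact: ler_normB.
    by apply/rowP => i; rewrite !mxE; ring.
  lra.
have sur (y : vec) : exists x : vec, K x = y.
  pose f : vec -> vec := fun x => y - t *: V x.
  have funf : isFun vec vec setT setT f by split.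
  pose F : {fun [set: vec] >-> [set: vec]} := HB.pack f funf.
  have half0 : 0 <= 1 / 2 :> R by lra.
  have ctr : is_contraction F.
    exists (NngNum half0); split; first by rewrite /=; lra.
    move=> [a b] _ /=; rewrite /f opprD addrACA subrr add0r opprK addrC -scalerBr.
    rewrite normrZ (ger0_norm t0) distrC; apply: le_trans (HV _ _).
    by rewrite distrC -[leRHS]mul1r ler_wpM2r.
  have [p _ pE] := @banach_fixed_point R vec setT F ctr closedT (ex_intro _ (0 : vec) I).
  by exists p; rewrite /K {1}pE subrK.
have [Ki KiK] := choice sur.
have KK : cancel K Ki.
  move=> x; apply/eqP; rewrite -subr_eq0 -normr_eq0 eq_le normr_ge0 andbT.
  by have := lipK (Ki (K x)) x; rewrite KiK subrr normr0 mulr0.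
exists Ki; split; [|exact: KK|exact: KiK].
apply: (@norm_lipschitz_continuous _ 2) => // x y.
by apply: (le_trans (lipK _ _)); rewrite !KiK.
Qed.

Lemma same_knot_type_perturbation V g1 g2 g0 :
  (forall x y, `|V x - V y| <= 1 / 2 * `|x - y|) ->
  (forall s, V (g1 s) = g2 s - g1 s) ->
  same_knot_type g2 g0 -> same_knot_type g1 g0.
Proof.
move=> HV Vg; have cV : continuous V.
  by apply: norm_lipschitz_continuous HV.
apply: (@same_knot_type_comp (fun t x => x + t *: V x)).
- move=> p; apply: cvgD; first exact: csnd.
  apply: cvgZ; first exact: cfst.
  by apply: (@continuous_comp _ _ _ snd V); [exact: csnd|exact: cV].
- by move=> t t01; exact: lipschitz_perturbation_inverse.
- by move=> x; rewrite scale0r addr0.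
- apply/seteqP; split => [_ [_ [s _ <-] <-]|_ [s _ <-]].
    by exists s => //; rewrite scale1r Vg addrC subrK.
  by exists (g1 s); [exists s|rewrite scale1r Vg addrC subrK].
Qed.

(** The extension is the infimum over [s] of [u s + l |x - g s|]. Since [u] is compared with chords
    rather than parameters, it depends on the point [g s] alone. *)
Lemma mcshane_extension g (u : R -> R) (l : R) : 0 <= l ->
  (forall s t, `|u s - u t| <= l * enorm (g s - g t)) ->
  exists V : vec -> R, (forall s, V (g s) = u s) /\
    forall x y, `|V x - V y| <= l * enorm (x - y).
Proof.
move=> l0 Hu.
pose S x := range (fun s => u s + l * enorm (x - g s)).
have lbS x : lbound (S x) (u 0 - l * enorm (x - g 0)).
  move=> _ [s _ <-]; have := Hu 0 s; rewrite ler_norml => /andP[_ H].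
  have : enorm (g 0 - g s) <= enorm (x - g 0) + enorm (x - g s).
    rewrite (_ : g 0 - g s = (g 0 - x) + (x - g s)); last by rewrite addrA subrK.
    by rewrite (le_trans (enormD _ _))// enorm_distC.
  move=> /(ler_wpM2l l0); rewrite mulrDr; lra.
have Sinf x : has_inf (S x).
  by split; [exists (u 0 + l * enorm (x - g 0)); exists 0|exists (u 0 - l * enorm (x - g 0))].
have infle x s : inf (S x) <= u s + l * enorm (x - g s).
  by apply: ge_inf; [case: (Sinf x)|exists s].
have lip x y : inf (S x) - inf (S y) <= l * enorm (x - y).
  rewrite lerBlDr -lerBlDl; apply: lb_le_inf; first by case: (Sinf y).
  move=> _ [s _ <-]; rewrite lerBlDl; apply: (le_trans (infle x s)).
  rewrite addrCA lerD2l -mulrDr ler_wpM2l//.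
  rewrite [in leLHS](_ : x - g s = (x - y) + (y - g s)); last by rewrite addrA subrK.
  exact: enormD.
exists (fun x => inf (S x)); split => [s|x y]; last first.
  by rewrite ler_norml lip andbT lerNl opprB enorm_distC lip.
apply/eqP; rewrite eq_le; apply/andP; split.
  by have := infle (g s) s; rewrite subrr enorm0 mulr0 addr0.
apply: lb_le_inf; first by case: (Sinf (g s)).
by move=> _ [t _ <-]; have := Hu s t; rewrite ler_norml => /andP[_]; rewrite lerBlDl.
Qed.

(** The coordinates of [g2 - g1] are extended one by one with respect to the Euclidean norm, while
    the inverse is built in the sup norm. Passing between the norms costs a factor 2, which turns
    [1 / 4] into the required [1 / 2]. *)
Lemma same_knot_type_near g1 g2 g0 (l : R) : 0 <= l -> l <= 1 / 4 ->
  (forall i s t, `|(g2 s - g1 s) ord0 i - (g2 t - g1 t) ord0 i|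
     <= l * enorm (g1 s - g1 t)) ->
  same_knot_type g2 g0 -> same_knot_type g1 g0.
Proof.
move=> l0 l4 Hl.
have /choice[V HV] i := mcshane_extension l0 (Hl i).
apply: (@same_knot_type_perturbation (fun x => \row_i V i x)).
  move=> x y; apply: norm_leP => [|i]; first by rewrite mulr_ge0// divr_ge0.
  have [_ H] := HV i; rewrite !mxE; apply: (le_trans (H x y)).
  apply: (le_trans (ler_wpM2l l0 (enorm_le_norm _))).
  by have := normr_ge0 (x - y); nra.
by move=> s; apply/rowP => i; rewrite mxE; have [-> _] := HV i.
Qed.

End isotopies.

(** * Symmetric reparametrization by arclength *)

Section arclength_reparametrization.
Variable R : realType.
Notation mu := (@lebesgue_measure R).
Notation vec := 'rV[R]_3.
Implicit Types (g G v : R -> vec).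

(* Arclength parametrized candidates, before any second derivative is known. *)
Definition admissible (g0 G v : R -> vec) : Prop :=
  [/\ curve_deriv G v, continuous v, (forall t, enorm (v t) = 1) &
   [/\ periodic1 G, injective_closed G, D2sym G & same_knot_type G g0]].

Lemma coord_sym_deriv (f w : R -> R) (c e d : R) (t : R) :
  (forall t : R, is_derive t (1 : R) f (w t)) ->
  (forall t, c * f (e * t + d) = f t) -> w t = c * e * w (e * t + d).
Proof.
move=> df fE; apply: (is_derive_inj (df t)).
have H := is_derive_affine e d t df.
have := is_deriveZ c H; rewrite (_ : c \*: _ = f).
  by rewrite /GRing.scale/= mulrA.
by apply/funext => s; rewrite -[RHS]fE.
Qed.

(** Differentiating the symmetry changes each velocity coordinate by a sign only, so the speed is
    invariant under the parameter map. *)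
Lemma enorm_refl_deriv g v (s : vec) (e d t : R) : curve_deriv g v ->
  (forall i, s ord0 i ^+ 2 = 1) -> e ^+ 2 = 1 ->
  (forall t, refl s (g (e * t + d)) = g t) ->
  enorm (v (e * t + d)) = enorm (v t).
Proof.
move=> dg s1 e1 gE; rewrite /enorm; congr Num.sqrt; rewrite /dotv.
apply: eq_bigr => i _; rewrite -!expr2.
have -> : v t ord0 i = s ord0 i * e * v (e * t + d) ord0 i.
  apply: (@coord_sym_deriv (fun s => g s ord0 i) (fun s => v s ord0 i)) => x.
    exact: dg.
  by rewrite -[RHS](congr1 (fun u : vec => u ord0 i) (gE x)) mxE.
by rewrite !exprMn s1 e1 !mul1r.
Qed.

Lemma reflZ (s x : vec) (c : R) : refl s (c *: x) = c *: refl s x.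
Proof. by apply/rowP => i; rewrite !mxE mulrCA. Qed.

Lemma sqr_sign (b : bool) : (if b then 1 else -1) ^+ 2 = 1 :> R.
Proof. by case: b; rewrite ?sqrrN expr1n. Qed.

Lemma is_derive_translate (f w : R -> R) (d t : R) :
  (forall t : R, is_derive t (1 : R) f (w t)) ->
  is_derive t (1 : R) (fun s => f (s + d)) (w (t + d)).
Proof.
move=> df; have := is_derive_affine 1 d t df; rewrite !mul1r.
rewrite (_ : (fun s => _) = (fun s => f (s + d)))//.
by apply/funext => s; rewrite mul1r.
Qed.

(** The derivative of arclength in units of the total length, hence the Jacobian of the
    reparametrization. *)
Definition arc_density g t : R := enorm (derive1 g t) / Len g.

(** The speed is invariant under [t -> -t] and [t -> t - 1/2], so arclength measured from 0 commutes
    with both maps, and so does its inverse. The third parameter map is a composition of these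
    two. *)
Lemma arclength_change g : W22 g -> regular g -> D2sym g -> 0 < Len g ->
  exists F tau : R -> R,
  [/\ (forall t : R, is_derive t (1 : R) F (arc_density g t)), cancel F tau, cancel tau F,
   (forall s : R, is_derive s (1 : R) tau (arc_density g (tau s))^-1) &
   [/\ F 0 = 0, F 1 = 1 &
   [/\ (forall s, tau (s + 1) = tau s + 1), (forall s, tau (- s) = - tau s) &
       (forall s, tau (s - 1 / 2) = tau s - 1 / 2)]]].
Proof.
move=> Wg rg [S1 [S2 S3]].
have cv := W22_deriv_continuous Wg; have [pg [dg _]] := Wg.
have dg' := derivable_curve_deriv dg.
have pv := derive1_periodic pg dg.
have [v gv] : exists v, v = derive1 g by eexists.
have [n nE] : exists n : R -> R, n = fun t => enorm (v t) by eexists.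
have cn : continuous n by rewrite nE gv; exact: (continuous_enorm cv).
have n0 t : 0 < n t by rewrite nE gv; exact: rg.
have nN t : n (- t) = n t.
  have s1 i : (@Rm3 R) ord0 i ^+ 2 = 1 by rewrite mxE; exact: sqr_sign.
  have e1 : (-1) ^+ 2 = 1 :> R by rewrite sqrrN expr1n.
  have e2 x : - x = -1 * x + 0 :> R by rewrite mulN1r addr0.
  rewrite nE gv (e2 t); apply: (enorm_refl_deriv t dg' s1 e1) => x.
  by rewrite -(e2 x) S3.
have n2 t : n (t - 1 / 2) = n t.
  have s1 i : (@Rm2 R) ord0 i ^+ 2 = 1 by rewrite mxE; exact: sqr_sign.
  have e1 : 1 ^+ 2 = 1 :> R by rewrite expr1n.
  have e2 x : x - 1 / 2 = 1 * x + - (1 / 2) :> R by rewrite (mul1r x).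
  rewrite nE gv (e2 t); apply: (enorm_refl_deriv t dg' s1 e1) => x.
  by rewrite -(e2 x) S2.
have nP t : n (t + 1) = n t by rewrite nE gv pv.
have [L LE] : exists L, L = Len g by eexists.
rewrite -LE => L0.
have [w wE] : exists w, w = arc_density g by eexists.
rewrite -wE; have {}wE t : w t = n t / L by rewrite wE /arc_density nE gv LE.
have {}LE : L = \int[mu]_(t in `[0, 1]) n t by rewrite LE nE gv.
have w0 t : 0 < w t by rewrite wE divr_gt0.
pose phi := antiderivative n.
pose F t := L^-1 * phi t.
have dF (t : R) : is_derive t (1 : R) F (w t).
  have d1 : is_derive t (1 : R) phi (n t) := is_derive_antiderivative t cn.
  by rewrite wE mulrC; exact: (@is_deriveZ _ _ _ phi L^-1 t 1 _ d1).
have F0 : F 0 = 0 by rewrite /F /phi antiderivative0 mulr0.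
have F1 : F 1 = 1.
  rewrite /F -[phi 1]subr0 -(antiderivative0 n) /phi.
  by rewrite (antiderivativeB cn ler01) -LE mulVf// gt_eqF.
have FS t : F (t + 1) = F t + 1.
  have := @derive_eq_cst R _ _ w F t (fun x => is_derive_translate 1 x dF) dF (fun x => _).
  rewrite add0r F0 F1 subr0 => <-; first by rewrite subrK.
  by move=> x; rewrite !wE nP.
have FN t : F (- t) = - F t.
  have dF' x : is_derive (x : R) (1 : R) (fun s => F (- s)) (- w (- x)).
    have := is_derive_affine (-1) 0 x dF; rewrite mulN1r addr0 mulN1r.
    rewrite (_ : (fun s => _) = (fun s => F (- s)))//.
    by apply/funext => s; rewrite mulN1r addr0.
  have dF'' (x : R) : is_derive x (1 : R) (- F) (- w x) := is_deriveN (dF x).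
  have := @derive_eq_cst R _ _ _ _ t dF' dF'' (fun x => _).
  rewrite oppr0 F0 subr0 => ->; first by rewrite !fctE F0 oppr0 subr0.
  by move=> x; rewrite !wE nN.
have F2 t : F (t - 1 / 2) = F t - 1 / 2.
  have H x : F (x - 1 / 2) - F (- (1 / 2)) = F x.
    have := @derive_eq_cst R _ _ w F x (fun x => is_derive_translate (- (1 / 2)) x dF) dF (fun x => _).
    rewrite add0r F0 subr0; apply.
    by move=> y; rewrite !wE n2.
  (* Integration leaves the constant [F (- (1/2))] open; the case [t = 1] and oddness give
     [2 F (1/2) = 1]. *)
  have e1 : 1 - 1 / 2 = 1 / 2 :> R by field.
  have := H t; have := H 1; rewrite e1 F1 FN; lra.
have [tau [FK tauK _ dtau]] := increasing_inverse dF w0 FS F0.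
have inj := can_inj FK.
exists F, tau; split => //; split => //; split.
- by move=> s; apply: inj; rewrite tauK FS tauK.
- by move=> s; apply: inj; rewrite tauK FN tauK.
- by move=> s; apply: inj; rewrite tauK F2 tauK.
Qed.

End arclength_reparametrization.

(** * Energies under reparametrization and rescaling *)

Section reparametrized_energies.
Variable R : realType.
Notation mu := (@lebesgue_measure R).
Notation vec := 'rV[R]_3.
Implicit Types (g G v : R -> vec).

(** The inner Jacobian [|u y| / L] restores the speed at [y]. The factor at [x] is constant for the
    inner integral, and the outer Jacobian [|u x| / L] will reduce it to [L^(q - 2)]. *)
Lemma tp_kernel_reparam q g (u : R -> vec) (L : R) (F : R -> R) (G v : R -> vec) x y :
  0 < L -> (forall x, 0 < enorm (u x)) -> injective F ->
  (forall x, G (F x) = L^-1 *: g x) -> (forall x, v (F x) = (enorm (u x))^-1 *: u x) ->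
  tp_kernel q v G (F x) (F y) * (enorm (u y) / L)
  = (L `^ q / L / enorm (u x)) * tp_kernel q u g x y.
Proof.
move=> L0 u0 Finj GF vF; rewrite /tp_kernel (inj_eq Finj).
have v1 z : enorm (v (F z)) = 1.
  by rewrite vF enormZ ger0_norm ?invr_ge0 ?enorm_ge0// mulVf// gt_eqF.
rewrite (v1 x) (v1 y) (GF x) (GF y) (vF x).
move: (u x) (u y) (u0 x) (u0 y) => a b a0 b0.
have a1 : (enorm a)^-1 != 0 by rewrite invr_eq0 gt_eqF.
have L1 : 0 < L^-1 by rewrite invr_gt0.
rewrite (inv_rtpZ _ _ _ a1 L1) invrK.
move: (inv_rtp_ge0 a (g x) (g y)); move: (inv_rtp a (g x) (g y)) => r r0.
have {a0 a1} := lt0r_neq0 a0; have {b0} := lt0r_neq0 b0; have := lt0r_neq0 L0.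
move: (enorm a) (enorm b) => c d L2 d1 c1.
case: ifPn => [_|xy]; first by rewrite !mul0r mulr0.
rewrite powRM ?(ltW L0)//.
by move: (L `^ q) (r `^ q) => A B; field; rewrite c1 L2.
Qed.

Lemma TP_reparam q g (F tau : R -> R) (G v : R -> vec) :
  continuous (derive1 g) -> continuous g -> regular g -> 0 < Len g ->
  (forall t : R, is_derive t (1 : R) F (arc_density g t)) ->
  cancel F tau -> cancel tau F -> F 0 = 0 -> F 1 = 1 ->
  curve_deriv G v -> continuous v ->
  (forall x, G (F x) = (Len g)^-1 *: g x) ->
  (forall x, v (F x) = unit_tangent g x) ->
  TP q G = (((Len g) `^ (q - 2))%:E * TP q g)%E.
Proof.
move=> cv' cg rg L0 dF FK tauK F0 F1 dG cv GF vF.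
have cG := curve_deriv_continuous dG.
rewrite !TP_kernelE (curve_deriv_derive1 dG).
have [L LE] : exists L, L = Len g by eexists.
rewrite -LE in L0 GF *.
have wE t : arc_density g t = enorm (derive1 g t) / L by rewrite /arc_density LE.
have w0 t : 0 < arc_density g t by rewrite wE divr_gt0.
have cw : continuous (arc_density g).
  rewrite (_ : arc_density g = (fun t => enorm (derive1 g t) / L)).
    by move=> t; apply: cvgM; [exact: (continuous_enorm cv')|exact: cvg_cst].
  exact/funext.
have cov := ge0_change_of_variables dF w0 cw tauK.
have Finj := can_inj FK.
have k0 (v1 g1 : R -> vec) s t : (0 <= (tp_kernel q v1 g1 s t)%:E)%E.
  by rewrite lee_fin; exact: tp_kernel_ge0.
have := cov (fun s => \int[mu]_(t in `[0%R, 1%R]) (tp_kernel q v G s t)%:E)%E 0 1.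
rewrite F0 F1 => ->; last 2 first.
- by apply: measurable_funTS; exact: measurable_tp_potential.
- by move=> s _; exact: integral_ge0.
rewrite -ge0_integralZl//; last 3 first.
- by apply: measurable_funTS; exact: measurable_tp_potential.
- by move=> s _; exact: integral_ge0.
- by rewrite lee_fin powR_ge0.
apply: eq_integral => x _.
have := cov (fun t => (tp_kernel q v G (F x) t)%:E) 0 1.
rewrite F0 F1 => ->; last 2 first.
- apply: measurable_funTS; apply/measurable_EFinP.
  exact: measurable_tp_kernel_section.
- by move=> s _; exact: k0.
under eq_integral => y _.
  rewrite -EFinM wE (tp_kernel_reparam q x y L0 rg Finj GF vF) EFinM; over.
rewrite ge0_integralZl//; last 2 first.
- apply: measurable_funTS; apply/measurable_EFinP.
  exact: measurable_tp_kernel_section.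
- by rewrite lee_fin divr_ge0 ?enorm_ge0// divr_ge0 ?powR_ge0// ltW.
rewrite muleAC -EFinM wE; congr (_%:E * _)%E.
have nx := rg x.
have -> : L `^ q = L `^ (q - 2) * L ^+ 2.
  by rewrite -powR_mulrn ?(ltW L0)// -powRD ?subrK// (gt_eqF L0)//= implybT.
by field; rewrite !gt_eqF.
Qed.

(** The bending energy of the normalized curve is recorded as a bound on its dyadic energies, the
    form that survives a limit; [Len g] is the factor by which this energy scales. *)
Lemma arclength_reparam q g0 g : SigmaK g0 g -> exists G v, exists2 e,
  Ebend g = e%:E &
  [/\ admissible g0 G v, 0 <= e,
    forall k, \sum_(i < 3) dyadic_energy (fun s => v s ord0 i) k <= Len g * e &
    TP q G = (((Len g) `^ (q - 2))%:E * TP q g)%E].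
Proof.
move=> [[Wg [rg [ig kg]]] [cg [Sg L0]]].
have cv := W22_deriv_continuous Wg; have [pg [dg _]] := Wg.
have dg' := derivable_curve_deriv dg.
have [k [Hk EE]] := unit_tangent_energy Wg rg.
have [F [tau [dF FK tauK dtau [F0 F1 [tauS tauN tau2]]]]] := arclength_change Wg rg Sg L0.
have [L LE] : exists L, L = Len g by eexists.
rewrite -LE in L0 *.
have wE t : arc_density g t = enorm (derive1 g t) / L by rewrite /arc_density LE.
have w0 t : 0 < arc_density g t by rewrite wE divr_gt0.
have cw : continuous (arc_density g).
  rewrite (_ : arc_density g = (fun t => enorm (derive1 g t) / L)).
    by move=> t; apply: cvgM; [exact: (continuous_enorm cv)|exact: cvg_cst].
  exact/funext.
have ctau := is_derive_continuous dtau.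
have tau_lt x y : x < y -> tau x < tau y.
  move=> xy; rewrite -subr_gt0; have [c _ ->] := mean_value x y dtau.
  by rewrite mulr_gt0 ?invr_gt0 ?subr_gt0.
have tau_le : {homo tau : x y / x <= y}.
  by move=> x y; rewrite le_eqVlt => /orP[/eqP ->//|/tau_lt/ltW].
have tau0 : tau 0 = 0 by rewrite -F0 FK.
have tau1 : tau 1 = 1 by rewrite -F1 FK.
have cT : continuous (unit_tangent g).
  apply: continuous_coordP => i.
  under [X in continuous X]eq_fun do rewrite mxE; move=> t.
  apply: cvgM; last exact: (@continuous_coord _ _ i cv).
  by apply: cvgV; [rewrite gt_eqF|exact: (continuous_enorm cv)].
pose G s := L^-1 *: g (tau s); pose v s := unit_tangent g (tau s).
have cvv : continuous v.
  by move=> s; apply: (@continuous_comp _ _ _ tau (unit_tangent g)); [exact: ctau|exact: cT].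
have dG : curve_deriv G v.
  move=> s i.
  have d1 : is_derive (tau s) (1 : R) (fun x => g x ord0 i) (derive1 g (tau s) ord0 i).
    exact: dg'.
  have d2 := dtau s.
  have d3 := @is_derive1_comp _ (fun x => g x ord0 i) tau s _ _ d1 d2.
  have d4 := is_deriveZ L^-1 d3.
  rewrite (_ : (fun s => G s ord0 i) = L^-1 \*: ((fun x => g x ord0 i) \o tau)); last first.
    by apply/funext => x; rewrite /G mxE.
  rewrite (_ : v s ord0 i = L^-1 *: (derive1 g (tau s) ord0 i * (arc_density g (tau s))^-1))//.
  rewrite /v /unit_tangent mxE wE /GRing.scale/=; have := rg (tau s); set n := enorm _ => n0.
  by field; rewrite !gt_eqF.
have GF x : G (F x) = L^-1 *: g x by rewrite /G FK.
have vF x : v (F x) = unit_tangent g x by rewrite /v FK.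
pose e := \sum_(i < 3) \int[mu]_(t in `[0, 1]) (k i t ^+ 2 / enorm (derive1 g t)).
exists G, v, e; first exact: EE.
split.
- split => //; first by move=> t; exact: enorm_unit_tangent.
  split.
  + by move=> t; rewrite /G tauS pg.
  + move=> s t /andP[s0 s1] /andP[t0 t1] /(congr1 (fun x => L *: x)).
    rewrite /G !scalerA mulfV ?scale1r ?gt_eqF// => /ig.
    have in01 x : 0 <= x -> x < 1 -> 0 <= tau x < 1.
      by move=> x0 x1; rewrite -tau0 tau_le//= -[X in _ < X]tau1 tau_lt.
    by move=> /(_ (in01 _ s0 s1) (in01 _ t0 t1)) H; rewrite -(tauK s) H tauK.
  + have [S1 [S2 S3]] := Sg; split; [|split] => t; rewrite /G reflZ; congr (_ *: _).
    (* Reading [- t + 1/2] as [- (t - 1/2)] makes the two commutation rules of [tau] applicable. *)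
    * by rewrite -[- t + 1 / 2]opprK opprD opprK tauN tau2 opprD opprK S1.
    * by rewrite tau2 S2.
    * by rewrite tauN S3.
  + apply: (@same_knot_type_scale _ L _ g) => //.
    apply/seteqP; split => [_ [_ [s _ <-] <-]|_ [x _ <-]].
      by exists (tau s) => //; rewrite /G scalerA mulfV ?scale1r// gt_eqF.
    by exists (G (F x)); [exists (F x)|rewrite GF scalerA mulfV ?scale1r// gt_eqF].
- apply: sumr_ge0 => i _; apply: Rintegral_ge0 => t _.
  by rewrite divr_ge0 ?sqr_ge0 ?enorm_ge0.
- move=> K; rewrite /e big_distrr/=; apply: ler_sum => i _.
  have [mk ik ikn TE] := Hk i.
  have kwE : (fun t => k i t ^+ 2 / arc_density g t)
      = (fun t => L * (k i t ^+ 2 / enorm (derive1 g t))).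
    apply/funext => t; rewrite wE; have := rg t; set n := enorm _ => n0.
    by field; rewrite !gt_eqF.
  have ikw := integrable_itvZ L ikn; rewrite -kwE in ikw.
  have tauw a b : a <= b ->
      \int[mu]_(s in `[tau a, tau b]) arc_density g s = b - a.
    move=> ab; rewrite -(antiderivativeB cw (tau_le _ _ ab)).
    have H x := derive_eq_cst x (fun t => is_derive_antiderivative t cw) dF (fun t => erefl).
    have := H (tau a); have := H (tau b); rewrite !tauK F0 antiderivative0 !subr0.
    by move=> -> ->.
  have := @dyadic_energy_comp_le R (fun s => unit_tangent g s ord0 i) (k i)
    (arc_density g) tau K ik cw w0 ikw TE tau_le tau0 tau1 tauw.
  by rewrite kwE RintegralZl.
- by rewrite LE; rewrite LE in GF L0; apply: (@TP_reparam q g F tau).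
Qed.

End reparametrized_energies.

(** * Chords of unit speed curves and stability of the tangent-point radius *)

Section bilipschitz.
Variable R : realType.
Notation mu := (@lebesgue_measure R).
Notation vec := 'rV[R]_3.
Implicit Types (g v : R -> vec).

(** The mean value theorem is scalar, so the curve is tested against its own chord [w]: the
    derivative of [dotv (g x) w] is at most [|w|]. *)
Lemma unit_speed_lipschitz g v s t : curve_deriv g v -> (forall t, enorm (v t) = 1) ->
  enorm (g s - g t) <= `|s - t|.
Proof.
move=> dg v1; have [w wE] : exists w, w = g s - g t by eexists.
have [c _ e] := @mean_value R (fun x => dotv (g x) w) (fun x => dotv (v x) w) t s
  (fun x => is_derive_dotv w x dg).
rewrite -wE; have [->|w0] := eqVneq w 0; first by rewrite enorm0.
have {}w0 : 0 < enorm w by rewrite enorm_gt0.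
rewrite -(ler_pM2l w0) -expr2 sqr_enorm {1}wE dotvBl e.
apply: (le_trans (ler_norm _)); rewrite normrM ler_wpM2r//.
by rewrite (le_trans (cauchy_schwarz _ _))// v1 mul1r.
Qed.

Lemma dotv_unit (a b : vec) : enorm a = 1 -> enorm b = 1 ->
  dotv a b = 1 - enorm (a - b) ^+ 2 / 2.
Proof.
move=> a1 b1; rewrite sqr_enorm dotvBl !dotvBr -!sqr_enorm a1 b1 (dotvC b a).
by field.
Qed.

(** Within [d] of [s] the tangents differ by at most 1, so by polarization their product is at least
    [1/2], and the curve advances in direction [v s] by at least half the parameter. *)
Lemma unit_speed_local_lower g v (K d : R) s t : curve_deriv g v ->
  (forall t, enorm (v t) = 1) ->
  (forall s t, enorm (v s - v t) ^+ 2 <= K * `|s - t|) ->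
  0 <= K -> K * d <= 1 -> `|s - t| <= d ->
  1 / 2 * `|s - t| <= enorm (g s - g t).
Proof.
move=> dg v1 HK K0 Kd std.
have [c cst e] := @mean_value R (fun x => dotv (g x) (v s)) (fun x => dotv (v x) (v s)) t s
  (fun x => is_derive_dotv (v s) x dg).
have cs : `|c - s| <= d.
  apply: le_trans std; rewrite distrC; have /orP[ts|st] := le_total t s.
    move: cst; rewrite (min_idPl ts) (max_idPr ts) => /andP[tc cs].
    by rewrite !ger0_norm ?subr_ge0// lerD2l lerN2.
  move: cst; rewrite (min_idPr st) (max_idPl st) => /andP[tc cs].
  by rewrite !ler0_norm ?subr_le0// lerN2 lerD2l lerN2.
have h1 : 1 / 2 <= dotv (v c) (v s).
  have := HK c s; have : K * `|c - s| <= 1 by apply: le_trans Kd; rewrite ler_wpM2l.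
  by rewrite dotv_unit//; lra.
have : `|dotv (g s - g t) (v s)| <= enorm (g s - g t).
  by rewrite (le_trans (cauchy_schwarz _ _))// v1 mulr1.
apply: le_trans; rewrite dotvBl e normrM ler_wpM2r//.
by rewrite (le_trans h1)// ler_norm.
Qed.

Lemma periodic1_int g (z : int) t : periodic1 g -> g (t + z%:~R) = g t.
Proof.
move=> pg; apply/rowP => i.
by apply: (@periodic_int _ (fun s => g s ord0 i)) => x; rewrite pg.
Qed.

Lemma floor_frac (x : R) : 0 <= x - (Num.floor x)%:~R < 1.
Proof.
have /andP[x1 x2] := floor_itv x; rewrite intrD in x2.
by rewrite subr_ge0 x1/= ltrBlDl.
Qed.

Lemma injective_mod1 g s t : periodic1 g -> injective_closed g -> g s = g t ->
  exists z : int, t - s = z%:~R.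
Proof.
move=> pg ig gst.
exists (Num.floor t - Num.floor s).
have : s - (Num.floor s)%:~R = t - (Num.floor t)%:~R.
  by apply: ig; rewrite ?floor_frac// -!mulrNz !periodic1_int.
by rewrite intrB; lra.
Qed.

(** The chord changes by at most [d/4], so its length lies between [3d/4] and [5d/4]. With the turn
    of the tangent its tangential part is at most [d/2], hence its normal part at least [d/2], and
    [2 (d/2) / (5d/4)^2 = 16 / (25 d)] exceeds [1 / (2 d)]. *)
Lemma inv_rtp_lower (x0 y0 x y v0 v1 : vec) (d : R) : 0 < d ->
  enorm (y0 - x0) = d -> dotv (y0 - x0) v0 = 0 ->
  enorm (x - x0) <= d / 8 -> enorm (y - y0) <= d / 8 ->
  enorm (v1 - v0) <= 1 / 4 -> enorm v1 = 1 ->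
  x != y /\ (2 * d)^-1 <= inv_rtp v1 x y.
Proof.
move=> d0 e0 o0 xx yy vv v1u.
have e1 : enorm ((y - x) - (y0 - x0)) <= d / 4.
  rewrite (_ : _ - _ = (y - y0) - (x - x0)); last by apply/rowP => i; rewrite !mxE; ring.
  by apply: (le_trans (enormD _ _)); rewrite enormN; lra.
have h1 : `|dotv (y - x) v1| <= d / 2.
  rewrite (_ : dotv (y - x) v1 = dotv ((y - x) - (y0 - x0)) v1 + dotv (y0 - x0) (v1 - v0)).
    apply: (le_trans (ler_normD _ _)).
    have := cauchy_schwarz ((y - x) - (y0 - x0)) v1.
    have := cauchy_schwarz (y0 - x0) (v1 - v0).
    by rewrite v1u e0 mulr1; nra.
  by rewrite dotvBr o0 subr0 (dotvBl (y - x)) subrK.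
have h2 : 3 / 4 * d <= enorm (y - x).
  have := ler_enormB (y0 - x0) (y - x); rewrite e0 (enorm_distC (y0 - x0)); lra.
have h3 : enorm (y - x) <= 5 / 4 * d.
  have := ler_enormB (y - x) (y0 - x0); rewrite e0; lra.
have n0 : 0 < enorm (y - x) by lra.
split; first by apply: contraTneq n0 => ->; rewrite subrr enorm0 ltxx.
have p2 : d / 2 <= enorm (perpv v1 (y - x)).
  rewrite -(@ler_pXn2r _ 2) ?nnegrE ?enorm_ge0//; last lra.
  have v11 : dotv v1 v1 = 1 by rewrite -sqr_enorm v1u expr1n.
  rewrite sqr_enorm_perpv v11 ?oner_neq0// divr1 -sqr_enorm.
  have : dotv (y - x) v1 ^+ 2 <= (d / 2) ^+ 2.
    by rewrite -real_normK ?num_real// ler_pXn2r ?nnegrE//; lra.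
  have : (3 / 4 * d) ^+ 2 <= enorm (y - x) ^+ 2.
    by rewrite ler_pXn2r ?nnegrE//; lra.
  nra.
rewrite /inv_rtp ler_pdivlMr ?exprn_gt0// ler_pdivrMl; last lra.
have : enorm (y - x) ^+ 2 <= (5 / 4 * d) ^+ 2.
  by rewrite ler_pXn2r ?nnegrE//; lra.
nra.
Qed.

Lemma integral_ge_box (f : R -> \bar R) (a e c : R) : 0 <= c -> 0 <= a -> 0 <= e ->
  a + e <= 1 -> (forall t, `[0%R, 1%R]%classic t -> (0 <= f t)%E) ->
  (forall t, a <= t <= a + e -> (c%:E <= f t)%E) ->
  ((c * e)%:E <= \int[mu]_(t in `[0%R, 1%R]) f t)%E.
Proof.
move=> c0 a0 e0 ae1 f0 fc.
have -> : (c * e)%:E = (\int[mu]_(t in `[0%R, 1%R])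
    ((cst c%:E) \_ (`[a, (a + e)%R]%classic : set R)) t)%E.
  rewrite -integral_mkcondr integral_cst//=; last exact: measurableI.
  rewrite (_ : _ `&` _ = `[a, a + e]%classic); last first.
    apply/seteqP; split => t /=; rewrite !in_itv/=; first by case.
    move=> /andP[ta tb].
    by rewrite ta tb (le_trans a0 ta) (le_trans tb ae1).
  rewrite lebesgue_measure_itv/= lte_fin; have [e1|e1] := ltP a (a + e).
    by rewrite -EFinD -EFinM addrAC subrr add0r.
  have -> : e = 0 by lra.
  by rewrite mulr0 mule0.
apply: ge0_le_integral_nm => t t01; rewrite /patch.
  by case: ifPn => // _; rewrite lee_fin.
by case: ifPn => [/set_mem/=|_]; [rewrite in_itv/=; exact: fc|exact: f0].
Qed.

(** A window on one side of [s] stays inside [[0, 1]] even when [s] is an endpoint. *)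
Lemma near_interval (s e : R) : 0 <= s <= 1 -> 0 <= e -> e <= 1 / 2 ->
  exists a, [/\ 0 <= a, a + e <= 1 & forall x, a <= x <= a + e -> `|x - s| <= e].
Proof.
move=> s01 e0 e1; have [s2|s2] := leP s (1 / 2).
  by exists s; split; [lra|lra|move=> x; rewrite ler_norml; lra].
by exists (s - e); split; [lra|lra|move=> x; rewrite ler_norml; lra].
Qed.

End bilipschitz.

(** * Uniform separation of strands from a tangent-point bound *)

Section tangent_point_separation.
Variable R : realType.
Notation mu := (@lebesgue_measure R).
Notation vec := 'rV[R]_3.
Implicit Types (g v : R -> vec).

(** Describing a pair by a base point and an offset makes the pairs at distance at least [d] on the
    circle a compact product; periodicity then admits every base point. *)
Lemma closest_pair g (d : R) : continuous g -> periodic1 g -> 0 < d -> d <= 1 / 2 ->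
  exists s r, [/\ 0 <= s <= 1, d <= r <= 1 - d &
    forall x y, d <= y <= 1 - d -> enorm (g (s + r) - g s) <= enorm (g (x + y) - g x)].
Proof.
move=> cg pg d0 d2.
pose f (p : R * R) := enorm (g (p.1 + p.2) - g p.1).
have cf : continuous f.
  move=> p; rewrite /f.
  have c1 : (fun q : R * R => g (q.1 + q.2) - g q.1) @ p --> g (p.1 + p.2) - g p.1.
    case: p => a b; apply: cvgB.
      apply: (@continuous_comp _ _ _ (fun q : R * R => q.1 + q.2) g); last exact: cg.
      by apply: cvgD; [exact: cvg_fst|exact: cvg_snd].
    by apply: (@continuous_comp _ _ _ (fun q : R * R => q.1) g); [exact: cvg_fst|exact: cg].
  have c2 : continuous (@enorm R) by apply: (@continuous_enormT R).
  exact: (cvg_comp _ _ c1 (c2 _)).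
have [|||[s r] sr Hmin] := @compact_EVT_min _ R f
    ((`[0, 1]%classic : set R) `*` (`[d, 1 - d]%classic : set R)).
- by exists (0, d); split; rewrite /= in_itv/=; lra.
- by apply: compact_setX; exact: segment_compact.
- exact: continuous_subspaceT.
move: sr; rewrite inE/= => -[]; rewrite /= !in_itv/= => s01 rd.
exists s, r; split => // x y yd.
have -> : enorm (g (x + y) - g x) = f (x - (Num.floor x)%:~R, y).
  by rewrite /f/= addrAC -!mulrNz !periodic1_int.
apply: Hmin; rewrite inE/=; split; rewrite /= in_itv//=.
by have := floor_frac x; lra.
Qed.

Lemma closest_pair_orthogonal g v s t (a b : R) : curve_deriv g v ->
  a < s < b -> (forall x, a < x < b -> enorm (g t - g s) <= enorm (g t - g x)) ->
  dotv (g t - g s) (v s) = 0.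
Proof.
move=> dg sab Hmin.
pose f x := dotv (g t - g x) (g t - g x).
have df (x : R) : is_derive x (1 : R) f (- 2 * dotv (g t - g x) (v x)).
  have H i : is_derive x (1 : R) (fun s => (g t - g s) ord0 i) ((- v x) ord0 i).
    have d1 := dg x i.
    have := is_deriveB (is_derive_cst (g t ord0 i) x (1 : R)) d1.
    rewrite sub0r mxE (_ : cst _ - _ = (fun s => (g t - g s) ord0 i))//.
    by apply/funext => y; rewrite !mxE.
  have eN : dotv (g t - g x) (- v x) = - dotv (g t - g x) (v x).
    by rewrite dotvC dotvNl dotvC.
  have := is_derive_dotv2 H H; rewrite (dotvC (- v x)) eN.
  by rewrite (_ : - _ + _ = - 2 * dotv (g t - g x) (v x)) //; ring.
have /is_derive_inj/(_ (df s)) : is_derive s (1 : R) f 0.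
  apply: (@derive1_at_min _ f a b).
  - by lra.
  - by move=> x _; exact: ex_derive.
  - by rewrite in_itv/=.
  move=> x; rewrite in_itv/= => xab; rewrite /f -!sqr_enorm.
  by rewrite ler_pXn2r ?nnegrE ?enorm_ge0// Hmin.
by lra.
Qed.

(** The kernel is at least [(2d)^-q] on a box of side [d/8], and [(2d)^-2 (d/8)^2 = 1/256] leaves
    the exponent [q - 2 > 0]: a short chord forces a large energy. The hypothesis on [K d] keeps the
    turn of the tangent on the box below [1/4]. *)
Lemma tp_lower_bound q g v s t (K d M : R) : 2 < q -> curve_deriv g v ->
  (forall t, enorm (v t) = 1) -> periodic1 g ->
  (forall s t, enorm (v s - v t) ^+ 2 <= K * `|s - t|) -> 0 <= K ->
  enorm (g t - g s) = d -> 0 < d -> d <= 1 -> K * d <= 1 / 2 ->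
  0 <= s <= 1 -> 0 <= t <= 1 ->
  dotv (g t - g s) (v s) = 0 -> (TP q g <= M%:E)%E ->
  (2 * d)^-1 `^ (q - 2) <= 256 * M.
Proof.
move=> q2 dg v1 pg HK K0 gts d0 d1 Kd s01 t01 o0.
rewrite TP_kernelE (curve_deriv_derive1 dg) => TPM.
have e0 : 0 <= d / 8 by lra.
have e1 : d / 8 <= 1 / 2 by lra.
have [a [a0 a1 Ha]] := near_interval s01 e0 e1.
have [b [b0 b1 Hb]] := near_interval t01 e0 e1.
have c0 : 0 <= (2 * d)^-1 by rewrite invr_ge0; lra.
have C0 : 0 <= (2 * d)^-1 `^ q by exact: powR_ge0.
have k0 x y : (0 <= (tp_kernel q v g x y)%:E)%E by rewrite lee_fin; exact: tp_kernel_ge0.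
have ker x y : a <= x <= a + d / 8 -> b <= y <= b + d / 8 ->
    (2 * d)^-1 `^ q <= tp_kernel q v g x y.
  move=> /Ha xs /Hb yt.
  have [||||gxy H] := @inv_rtp_lower R (g s) (g t) (g x) (g y) (v s) (v x) d d0 gts o0.
  - by rewrite (le_trans (unit_speed_lipschitz _ _ dg v1)).
  - by rewrite (le_trans (unit_speed_lipschitz _ _ dg v1)).
  - rewrite -(@ler_pXn2r _ 2) ?nnegrE ?enorm_ge0//.
    apply: (le_trans (HK _ _)); apply: (@le_trans _ _ (K * (d / 8))).
      by rewrite ler_wpM2l.
    by move: (Kd); nra.
  - exact: v1.
  rewrite /tp_kernel !v1 !mulr1 ifN; last by apply: contra gxy => /eqP ->.
  by apply: ge0_ler_powR => //; rewrite ?nnegrE ?inv_rtp_ge0//; lra.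
have H1 x : a <= x <= a + d / 8 -> (((2 * d)^-1 `^ q * (d / 8))%:E <=
    \int[mu]_(y in `[0%R, 1%R]) (tp_kernel q v g x y)%:E)%E.
  move=> xa; apply: (@integral_ge_box _ _ b) => // y yb.
  by rewrite lee_fin; exact: ker.
have H2 : ((((2 * d)^-1 `^ q * (d / 8)) * (d / 8))%:E <= M%:E)%E.
  apply: le_trans TPM; apply: (@integral_ge_box _ _ a) => //.
    by rewrite mulr_ge0.
  by move=> x _; apply: integral_ge0 => y _; exact: k0.
rewrite lee_fin in H2.
have E : (2 * d)^-1 `^ q = (2 * d)^-1 `^ (q - 2) * (2 * d)^-1 ^+ 2.
  have c1 : (2 * d)^-1 != 0 by rewrite invr_eq0; apply/eqP; lra.
  by rewrite -powR_mulrn// -powRD ?subrK// c1 implybT.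
rewrite E in H2; move: (_ `^ (q - 2)) H2 => A.
rewrite (_ : A * (2 * d)^-1 ^+ 2 * (d / 8) * (d / 8) = A / 256); first lra.
by field; rewrite gt_eqF.
Qed.

(** Suppose the shortest chord among pairs at parameter distance at least [d] is below [c]. It is
    not attained at distance exactly [d], where the Hoelder bound gives length at least [d/2]; so it
    is an interior minimum, orthogonal to the tangent, and its energy would exceed [M]. The choice
    of [c] precedes the curve. *)
Lemma tp_separation q (K M : R) : 2 < q -> 0 <= K -> 0 <= M ->
  exists2 c, 0 < c & forall g v, curve_deriv g v -> (forall t, enorm (v t) = 1) ->
    periodic1 g -> injective_closed g ->
    (forall s t, enorm (v s - v t) ^+ 2 <= K * `|s - t|) -> (TP q g <= M%:E)%E ->
    forall s t, `|s - t| <= 1 / 2 -> c * `|s - t| <= enorm (g s - g t).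
Proof.
move=> q2 K0 M0.
(* Makes [K d] and [d] at most [1/4], also for [K = 0]. *)
pose d : R := (4 * (K + 1))^-1.
have K4 : 0 < 4 * (K + 1) by lra.
have d0 : 0 < d by rewrite invr_gt0.
have dK : d * (4 * (K + 1)) = 1 by rewrite mulVf// gt_eqF.
have d4 : d <= 1 / 4 by nra.
have Kd : K * d <= 1 / 4 by nra.
(* [B^(q - 2) = 256 M + 1] contradicts [tp_lower_bound] for chords shorter than [1 / (2 B)]. *)
pose B : R := (256 * M + 1) `^ (q - 2)^-1.
have B0 : 0 < B by rewrite powR_gt0; lra.
pose c2 : R := (2 * B)^-1.
have c20 : 0 < c2 by rewrite invr_gt0; lra.
pose c : R := Num.min (d / 4) c2.
have c0 : 0 < c by rewrite lt_min c20 divr_gt0.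
have cd : c <= d / 4 by rewrite ge_min lexx.
exists c => // g v dg v1 pg ig HK TPM.
have loc s t : `|s - t| <= d -> 1 / 2 * `|s - t| <= enorm (g s - g t).
  move=> std; apply: (unit_speed_local_lower dg v1 HK K0 _ std); lra.
have cg := curve_deriv_continuous dg.
have [s0 [r0 [s01 rd Hmin]]] : exists s r, [/\ 0 <= s <= 1, d <= r <= 1 - d &
    forall x y, d <= y <= 1 - d -> enorm (g (s + r) - g s) <= enorm (g (x + y) - g x)].
  by apply: closest_pair => //; lra.
have [e eE] : exists e, e = enorm (g (s0 + r0) - g s0) by eexists.
have far x y : d <= y <= 1 - d -> e <= enorm (g (x + y) - g x).
  by move=> yd; rewrite eE; exact: Hmin.
have ce : c <= e.
  rewrite leNgt; apply/negP => ec.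
  have r0d : r0 != d.
    apply/eqP => r0d; have := loc (s0 + r0) s0; rewrite addrAC subrr add0r -eE r0d.
    by rewrite gtr0_norm// => /(_ (lexx _)); lra.
  have r01 : r0 != 1 - d.
    apply/eqP => r01; have := loc (s0 + r0 + (-1)%:~R) s0.
    rewrite periodic1_int// -eE r01 (_ : s0 + _ + _ - s0 = - d); last first.
      by rewrite mulrN1z; ring.
    by rewrite normrN gtr0_norm// => /(_ (lexx _)); lra.
  have rd' : d < r0 < 1 - d.
    by case/andP: rd => h1 h2; rewrite !lt_neqAle (eq_sym d) r0d r01 h1 h2.
  (* Parameters with the same image differ by an integer, and no integer lies strictly between 0 and
     1. *)
  have e0 : 0 < e.
    rewrite lt_neqAle eq_sym {2}eE enorm_ge0 andbT; apply/eqP => e0.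
    have /injective_mod1 : g s0 = g (s0 + r0).
      by apply/esym/eqP; rewrite -subr_eq0; apply/eqP; apply: enorm_eq0; rewrite -eE.
    move=> /(_ pg ig)[z]; rewrite addrAC subrr add0r => r0z.
    have : 0 < (z%:~R : R) < 1 by rewrite -r0z; lra.
    by rewrite ltr0z ltrz1; case: z {r0z} => // -[|n].
  have orth : dotv (g (s0 + r0) - g s0) (v s0) = 0.
    apply: (@closest_pair_orthogonal _ _ _ _ (s0 + r0 - (1 - d)) (s0 + r0 - d) dg).
      by lra.
    move=> x xd; rewrite -eE; have := far x (s0 + r0 - x).
    by rewrite (addrC x) subrK; apply; lra.
  pose z := Num.floor (s0 + r0).
  have gz : g (s0 + r0 - z%:~R) = g (s0 + r0) by rewrite -mulrNz periodic1_int.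
  have z01 := floor_frac (s0 + r0).
  have Ke : K * e <= 1 / 2 by nra.
  have e1 : e <= 1 by lra.
  have := @tp_lower_bound q g v s0 (s0 + r0 - z%:~R) K e M q2 dg v1 pg HK K0.
  rewrite gz -eE => /(_ erefl e0 e1 Ke s01 _ orth TPM) H.
  have {}H : (2 * e)^-1 `^ (q - 2) <= 256 * M by apply: H; lra.
  have ec2 : e < c2 by apply: (lt_le_trans ec); rewrite ge_min lexx orbT.
  have Be : B <= (2 * e)^-1.
    rewrite -[B]invrK lef_pV2 ?posrE ?invr_gt0//; last lra.
    by move: ec2; rewrite /c2 invfM => ec2; lra.
  have : B `^ (q - 2) <= (2 * e)^-1 `^ (q - 2).
    by apply: ge0_ler_powR; rewrite ?nnegrE ?invr_ge0; lra.
  rewrite /B -powRrM mulVf; last by apply/eqP; lra.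
  by rewrite powRr1; lra.
move=> s t st2; have [std|std] := leP `|s - t| d.
  apply: le_trans (loc _ _ std); rewrite ler_wpM2r//; lra.
have key x y : d < x - y -> x - y <= 1 / 2 -> c * (x - y) <= enorm (g x - g y).
  move=> xy1 xy2; have := far y (x - y); rewrite (addrC y) subrK => H.
  have {}H : e <= enorm (g x - g y) by apply: H; lra.
  by apply: (le_trans _ H); apply: (le_trans _ ce); nra.
have /orP[ts|st] := le_total t s.
  by move: std st2; rewrite ger0_norm ?subr_ge0//; exact: key.
move: std st2; rewrite ler0_norm ?subr_le0// opprB enorm_distC; exact: key.
Qed.

End tangent_point_separation.

(** * Regularity and position of admissible curves *)

Section admissible_curves.
Variable R : realType.
Notation mu := (@lebesgue_measure R).
Notation vec := 'rV[R]_3.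
Implicit Types (g v G : R -> vec).

Lemma curve_deriv_periodic g v : curve_deriv g v -> periodic1 g -> periodic1 v.
Proof.
move=> dg pg; rewrite -(curve_deriv_derive1 dg).
by apply: derive1_periodic => //; exact: curve_deriv_derivable dg.
Qed.

(** [riesz_vec] supplies the second derivative that [SigmaK] asks for, and its L^2 norm controls
    both the bending energy and the Hoelder constant. *)
Lemma admissible_regularity g0 G v (C : R) : admissible g0 G v ->
  (forall k, \sum_(i < 3) dyadic_energy (fun s => v s ord0 i) k <= C) ->
  [/\ SigmaK g0 G, arclength G, Len G = 1, (Ebend G <= C%:E)%E &
      forall s t, enorm (v s - v t) ^+ 2 <= 2 * C * `|s - t|].
Proof.
move=> [dG cv v1 [pG iG sG kG]] HC.
have [h [Hh hC]] := riesz_vec cv HC.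
have GE := curve_deriv_derive1 dG.
have L1 : Len G = 1.
  rewrite /Len GE (_ : (fun t => _) = cst 1); last by apply/funext => t; rewrite v1.
  by rewrite Rintegral_itv_cst// subr0 mulr1.
split => //.
- split.
    split; last by split; [move=> t; rewrite GE v1|].
    split => //; split; first exact: curve_deriv_derivable dG.
    by exists h => i; rewrite GE; have [_ H1 H2 H3] := Hh i; split.
  by split; [exact: curve_deriv_continuous dG|split => //; rewrite L1].
- by move=> t; rewrite GE.
- exact: le_trans (arclength_Ebend_le dG v1 Hh) _.
move=> s t; rewrite sqr_enorm /dotv.
apply: (@le_trans _ _ (\sum_(i < 3) (2 * \int[mu]_(t in `[0, 1]) (h i t ^+ 2) * `|s - t|))).
  apply: ler_sum => i _; rewrite !mxE -expr2.
  have [_ H1 H2 H3] := Hh i.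
  apply: (primitive_holder _ H1 H2 H3) => x.
  by rewrite (curve_deriv_periodic dG pG).
by rewrite -mulr_suml -mulr_sumr ler_wpM2r// ler_wpM2l.
Qed.

(** The rotation paired with [t -> -t] puts [g 0] on the third axis. The half-period symmetry makes
    the third coordinates of [g 0] and [g (-1/2)] opposite, while these points are at most [1/2]
    apart. This removes the freedom of translation. *)
Lemma D2sym_base_bound g v i : curve_deriv g v -> (forall t, enorm (v t) = 1) ->
  D2sym g -> `|g 0 ord0 i| <= 1.
Proof.
move=> dg v1 [_ [s2 s3]].
have e3 := congr1 (fun x : vec => x ord0 i) (s3 0).
have e2 := congr1 (fun x : vec => x ord0 i) (s2 0).
have := le_trans (coord_le_enorm _ i) (unit_speed_lipschitz 0 (- (1 / 2)) dg v1).
rewrite !mxE sub0r oppr0 opprK add0r in e3 e2 *.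
rewrite (@ger0_norm _ (1 / 2)) ?divr_ge0//.
have [i2|i2] := eqVneq (i : nat) 2%N.
  by move: e2; rewrite i2/= !ler_norml; lra.
by move: e3; rewrite (negPf i2) => e3 _; rewrite (_ : g 0 ord0 i = 0) ?normr0//; lra.
Qed.

End admissible_curves.

(** * Arzela-Ascoli along an ultrafilter *)

Section ultrafilter_limits.
Variable R : realType.
Variable U : set_system nat.
Hypothesis ultraU : UltraFilter U.

(** A single ultrafilter selects limits of all bounded sequences at once, which replaces diagonal
    extraction. *)
Lemma ultra_limit (x : nat -> R) (M : R) : (forall n, `|x n| <= M) ->
  exists l, forall e, 0 < e -> U [set n | `|x n - l| <= e].
Proof.
move=> xM.
have cI : compact (`[- M, M]%classic : set R) by exact: segment_compact.
have FF : ProperFilter (x @ U) by apply: fmap_proper_filter.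
have [|l [_ cl]] := cI (x @ U) FF.
  apply: (@filterE _ U) => n /=; by rewrite in_itv/= -ler_norml.
exists l => e e0; have [//|H] := in_ultra_setVsetC [set n | `|x n - l| <= e] ultraU.
have [|y [[n nH <-] /= xl]] := cl (x @` (~` [set n | `|x n - l| <= e])) (ball l e) _ (nbhsx_ballx _ _ e0).
  by apply: (@filterS _ U _ _ _ _ H) => n Hn; exists n.
by exfalso; apply: nH; rewrite -ball_normE/= in xl; rewrite /= distrC ltW.
Qed.

Lemma ultra_inf_often (P : set nat) : \oo `<=` U -> U P ->
  forall N, exists2 n, (N <= n)%N & P n.
Proof.
move=> oU UP N; have UN : U [set n | (N <= n)%N] by apply: oU; exact: nbhs_infty_ge.
by have [n [Nn Pn]] := filter_ex (filterI UN UP); exists n.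
Qed.

(** The pointwise limits inherit the Hoelder bound, so closeness on a finite grid of [[0, 1]], a
    finite intersection of sets of [U], spreads to the line. *)
Lemma ultra_uniform_limit (u : nat -> R -> R) (K : R) : 0 <= K ->
  (forall n t, u n (t + 1) = u n t) -> (forall n t, `|u n t| <= 1) ->
  (forall n s t, (u n s - u n t) ^+ 2 <= K * `|s - t|) ->
  exists w, forall e, 0 < e -> U [set n | forall t, `|u n t - w t| <= e].
Proof.
move=> K0 pu u1 uK.
have /choice[w Hw] t := ultra_limit (fun n => u1 n t).
have D n s t : `|u n s - u n t| <= Num.sqrt (K * `|s - t|).
  by rewrite -sqrtr_sqr ler_wsqrtr.
have wD s t : `|w s - w t| <= Num.sqrt (K * `|s - t|).
  apply/ler_addgt0Pr => e e0.
  have e2 : 0 < e / 2 by rewrite divr_gt0.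
  have [n [/= ns nt]] := filter_ex (filterI (Hw s _ e2) (Hw t _ e2)).
  by move: (D n s t) ns nt; rewrite !ler_norml; lra.
have pw t : w (t + 1) = w t.
  apply/eqP; rewrite -subr_eq0 -normr_le0; apply/ler_addgt0Pr => e e0; rewrite add0r.
  have e2 : 0 < e / 2 by rewrite divr_gt0.
  have [n [/= ns nt]] := filter_ex (filterI (Hw (t + 1) _ e2) (Hw t _ e2)).
  by move: ns nt; rewrite pu !ler_norml; lra.
exists w => e e0.
have e3 : 0 < e / 3 by rewrite divr_gt0.
(* Gives [K / N <= (e/3)^2]: one third of [e] each for the oscillation of [u n], the error at the
   grid point and the oscillation of [w]. *)
pose N := (Num.truncn (9 * K / e ^+ 2)).+1.
have N0 : 0 < N%:R :> R by rewrite ltr0n.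
have KN : Num.sqrt (K * N%:R^-1) <= e / 3.
  rewrite -(@ger0_norm _ (e / 3) (ltW e3)) -sqrtr_sqr ler_wsqrtr// ler_pdivrMr//.
  have : 9 * K / e ^+ 2 <= N%:R by rewrite ltW// truncnS_gt.
  by rewrite ler_pdivrMr ?exprn_gt0//; nra.
have UN : U [set n | forall j : 'I_N.+1, `|u n (j%:R / N%:R) - w (j%:R / N%:R)| <= e / 3].
  by apply: filter_forall => j; exact: Hw.
apply: filterS UN => n /= Hn t.
have H01 x : 0 <= x < 1 -> `|u n x - w x| <= e.
  move=> /andP[x0 x1].
  have /andP[j1 j2] : (Num.truncn (x * N%:R))%:R <= x * N%:R < (Num.truncn (x * N%:R)).+1%:R.
    by apply: truncn_itv; rewrite mulr_ge0// ltW.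
  have jN : (Num.truncn (x * N%:R) < N.+1)%N.
    rewrite ltnS -(ler_nat R) (le_trans j1)//.
    by rewrite -[leRHS]mul1r ler_wpM2r// ltW.
  have := Hn (Ordinal jN) => /=; set j := Num.truncn _ in j1 j2 *.
  set y := j%:R / N%:R => uwy.
  have xy : `|x - y| <= N%:R^-1.
    have yN : y * N%:R = j%:R by rewrite /y mulfVK// gt_eqF.
    rewrite -(ler_pM2r N0) mulVf ?gt_eqF// -{1}(ger0_norm (ltW N0)) -normrM mulrBl yN.
    by rewrite -natr1 in j2; rewrite ler_norml; lra.
  have Dxy : Num.sqrt (K * `|x - y|) <= e / 3.
    by apply: (le_trans _ KN); rewrite ler_wsqrtr// ler_wpM2l.
  have := D n x y; have := wD x y; move: uwy Dxy; rewrite !ler_norml; lra.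
have := H01 _ (floor_frac t).
by rewrite -mulrNz (@periodic_int _ (u n)) // (@periodic_int _ w).
Qed.

End ultrafilter_limits.

(** [powR] is [expR (r * ln x)] only for positive [x], so the limit 0 is treated by a direct
    estimate. *)
Lemma cvg_powR (R : realType) (u : nat -> R) (l r : R) : 0 < r ->
  (forall n, 0 <= u n) -> u n @[n --> \oo] --> l -> u n `^ r @[n --> \oo] --> l `^ r.
Proof.
move=> r0 u0 ul.
have l0 : 0 <= l by apply: (ler_cvg_to (cvg_cst 0) ul); exact: nearW.
have [l00|ln0] := eqVneq l 0.
  rewrite l00 powR0 ?gt_eqF//; apply/cvgrPdist_le => e e0.
  have d0 : 0 < e `^ r^-1 by rewrite powR_gt0.
  move/cvgrPdist_le : ul => /(_ _ d0); apply: filterS => n.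
  rewrite l00 !sub0r !normrN !ger0_norm ?powR_ge0// => H.
  have := @ge0_ler_powR _ r (ltW r0) (u n) (e `^ r^-1).
  rewrite -powRrM mulVf ?gt_eqF// powRr1 ?(ltW e0)//.
  by apply; rewrite ?nnegrE// powR_ge0.
have lp : 0 < l by rewrite lt_neqAle eq_sym ln0.
have E x : 0 < x -> x `^ r = expR (r * ln x) by move=> x0; rewrite /powR gt_eqF.
rewrite E//; apply: (@cvg_trans _ (expR (r * ln (u n)) @[n --> \oo])).
  apply: near_eq_cvg; have /cvgrPdist_lt : u n @[n --> \oo] --> l := ul.
  move=> /(_ _ lp); apply: filterS => n; rewrite ltr_norml => H.
  by rewrite E//; lra.
apply: (continuous_cvg _ (@continuous_expR R (r * ln l))).
apply: cvgMl_tmp; exact: (continuous_cvg _ (continuous_ln lp) ul).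
Qed.

(** * Passage to the limit in curves, knot type and energies *)

Section limit_curves.
Variable R : realType.
Notation mu := (@lebesgue_measure R).
Notation vec := 'rV[R]_3.
Implicit Types (g v w : R -> vec) (G V : nat -> R -> vec).

Lemma cvg_harmonic_bound (x : nat -> R) (l M : R) :
  (forall k, `|x k - l| <= M * k.+1%:R^-1) -> x k @[k --> \oo] --> l.
Proof.
move=> H; apply/cvgrPdist_le.
have h : (fun k => M * harmonic k) @ \oo --> (0 : R).
  rewrite -[X in _ --> X](mulr0 M); apply: cvgMl_tmp; exact: cvg_harmonic.
move=> e e0; move/cvgrPdist_le : h => /(_ _ e0); apply: filterS => k.
rewrite sub0r normrN distrC => h; apply: (le_trans (H k)); exact: (le_trans (ler_norm _) h).
Qed.

Lemma cvg_vecP (x : nat -> vec) (l : vec) :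
  (forall i, x k ord0 i @[k --> \oo] --> l ord0 i) -> x k @[k --> \oo] --> l.
Proof.
move=> H; apply/cvgrPdist_le => e e0.
have : \forall k \near \oo, forall i, `|l ord0 i - x k ord0 i| <= e.
  by apply: filter_forall => i; move/cvgrPdist_le : (H i) => /(_ _ e0).
apply: filterS => k Hk; apply: norm_leP => [|i]; first exact: ltW.
by rewrite !mxE.
Qed.

Lemma cvg_vec_coord (x : nat -> vec) (l : vec) i :
  x k @[k --> \oo] --> l -> x k ord0 i @[k --> \oo] --> l ord0 i.
Proof. 
move=> xl; apply: (@cvg_comp _ _ _ x (fun u : vec => u ord0 i) _ _ _ xl).
exact: coord_continuous.
 Qed.

Lemma cvg_dotv (x y : nat -> vec) (l m : vec) :
  x k @[k --> \oo] --> l -> y k @[k --> \oo] --> m ->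
  dotv (x k) (y k) @[k --> \oo] --> dotv l m.
Proof.
move=> xl ym; rewrite dotvE; under eq_fun do rewrite dotvE.
by do ![apply: cvgD]; apply: cvgM; exact: cvg_vec_coord.
Qed.

Lemma cvg_enorm (x : nat -> vec) (l : vec) :
  x k @[k --> \oo] --> l -> enorm (x k) @[k --> \oo] --> enorm l.
Proof. 
move=> xl; apply: (@cvg_comp _ _ _ x (@enorm R) _ _ _ xl).
exact: continuous_enormT.
 Qed.

Lemma curve_deriv_dist g v g' v' (e : R) : curve_deriv g v -> curve_deriv g' v' ->
  (forall t i, `|v t ord0 i - v' t ord0 i| <= e) ->
  forall i s t, `|(g s - g' s) ord0 i - (g t - g' t) ord0 i| <= e * `|s - t|.
Proof.
move=> dg dg' ve i s t.
have [c _] := @mean_value R (fun x => g x ord0 i - g' x ord0 i)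
  (fun x => v x ord0 i - v' x ord0 i) t s
  (fun x => @is_deriveB _ _ _ _ _ x _ _ _ (dg x i) (dg' x i)).
by rewrite !mxE => ->; rewrite normrM ler_wpM2r.
Qed.

Lemma nearest_shift (s t : R) : exists z : int, `|s - (t + z%:~R)| <= 1 / 2.
Proof.
exists (Num.floor (s - t + 1 / 2)).
by have := floor_frac (s - t + 1 / 2); rewrite ler_norml; lra.
Qed.

Lemma separated_injective g (c : R) : 0 < c -> periodic1 g ->
  (forall s t, `|s - t| <= 1 / 2 -> c * `|s - t| <= enorm (g s - g t)) ->
  injective_closed g.
Proof.
move=> c0 pg Hc s t s01 t01 gst.
have [z sz] := nearest_shift s t.
have := Hc _ _ sz; rewrite periodic1_int// gst subrr enorm0.
rewrite pmulr_rle0// normr_le0 subr_eq0 => /eqP sE.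
have : `|z%:~R| < 1 :> R by rewrite ltr_norml; lra.
rewrite -intr_norm -[X in _ < X]/(1%:~R) ltr_int -[X in _ < X]add0r ltzD1 normr_le0 => /eqP z0.
by rewrite sE z0 addr0.
Qed.

(** Close tangents make [g' - g] vary by at most [e |s - t|], and separation bounds [|s - t|] by the
    chord of [g] divided by [c]. Integer shifts bring the parameters within the range [1 / 2] of the
    separation. *)
Lemma same_knot_type_limit g v g' v' g0 (c e : R) : 0 < c -> 0 <= e -> e <= c / 4 ->
  curve_deriv g v -> curve_deriv g' v' -> periodic1 g -> periodic1 g' ->
  (forall s t, `|s - t| <= 1 / 2 -> c * `|s - t| <= enorm (g s - g t)) ->
  (forall t i, `|v' t ord0 i - v t ord0 i| <= e) ->
  same_knot_type g' g0 -> same_knot_type g g0.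
Proof.
move=> c0 e0 ec dg dg' pg pg' Hc He.
apply: (@same_knot_type_near _ _ _ _ (e / c)).
- by rewrite divr_ge0// ltW.
- by rewrite ler_pdivrMr//; lra.
move=> i s t; have [z sz] := nearest_shift s t.
rewrite -(periodic1_int z t pg) -(periodic1_int z t pg').
apply: (le_trans (curve_deriv_dist dg' dg He i s (t + z%:~R))).
by rewrite -mulrA ler_wpM2l// ler_pdivlMl//; exact: Hc.
Qed.

Lemma admissible_limit g0 G V g w (c : R) :
  (forall k, admissible g0 (G k) (V k)) -> curve_deriv g w -> continuous w -> 0 < c ->
  (forall k s t, `|s - t| <= 1 / 2 -> c * `|s - t| <= enorm (G k s - G k t)) ->
  (forall k t i, `|V k t ord0 i - w t ord0 i| <= k.+1%:R^-1) ->
  (forall t, G k t @[k --> \oo] --> g t) ->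
  admissible g0 g w.
Proof.
move=> aG dg cw c0 Hc Vw Gg.
have Vwc t : V k t @[k --> \oo] --> w t.
  apply: cvg_vecP => i; apply: (@cvg_harmonic_bound _ _ 1) => k.
  by rewrite mul1r; exact: Vw.
have pg : periodic1 g.
  move=> t; apply: (@cvg_unique _ _ (G k (t + 1) @[k --> \oo])) => //.
    exact: Gg.
  have -> : (fun k => G k (t + 1)) = (fun k => G k t); last exact: Gg.
  by apply/funext => k; have [_ _ _ [pG _ _ _]] := aG k; rewrite pG.
have sym (d : vec) (f : R -> R) :
    (forall k t, refl d (G k (f t)) = G k t) -> forall t, refl d (g (f t)) = g t.
  move=> H t; apply/rowP => i.
  apply: (@cvg_unique _ _ (G k t ord0 i @[k --> \oo])) => //; last first.
    exact: cvg_vec_coord.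
  have -> : (fun k => G k t ord0 i) = (fun k => d ord0 i * G k (f t) ord0 i).
    by apply/funext => k; rewrite -(H k t) mxE.
  by rewrite mxE; apply: cvgMl_tmp; exact: cvg_vec_coord.
have sep s t : `|s - t| <= 1 / 2 -> c * `|s - t| <= enorm (g s - g t).
  move=> st; apply: (@ler_cvg_to _ \oo _ R (cst (c * `|s - t|)) (fun k => enorm (G k s - G k t))).
  - exact: cvg_cst.
  - by apply: cvg_enorm; apply: cvgB; exact: Gg.
  - by apply: nearW => k; exact: Hc.
split => //.
  move=> t; apply: (@cvg_unique _ _ (enorm (V k t) @[k --> \oo])) => //.
    exact: cvg_enorm.
  have -> : (fun k => enorm (V k t)) = cst 1; last exact: cvg_cst.
  by apply/funext => k; have [_ _ ->] := aG k.
split => //.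
- exact: separated_injective sep.
- split; [|split].
  + by apply: (sym _ (fun t => - t + 1 / 2)) => k; have [_ _ _ [_ _ [H _] _]] := aG k.
  + by apply: (sym _ (fun t => t - 1 / 2)) => k; have [_ _ _ [_ _ [_ [H _]] _]] := aG k.
  + by apply: (sym _ (fun t => - t)) => k; have [_ _ _ [_ _ [_ [_ H]] _]] := aG k.
(* One sufficiently late curve carries the knot type over; this index gives
   [1 / (k + 1) <= c / 4]. *)
pose k := Num.truncn (4 / c).
have [dG _ _ [pG _ _ kG]] := aG k.
apply: (same_knot_type_limit c0 _ _ dg dG pg pG sep (Vw k) kG); first by rewrite invr_ge0.
rewrite -[c / 4]invrK lef_pV2 ?posrE ?invr_gt0 ?divr_gt0// invf_div.
exact/ltW/truncnS_gt.
Qed.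

Lemma energy_limit V w (a : nat -> R) (al : R) m :
  (forall t, V k t @[k --> \oo] --> w t) -> a k @[k --> \oo] --> al ->
  (forall k, \sum_(i < 3) dyadic_energy (fun s => V k s ord0 i) m <= a k) ->
  \sum_(i < 3) dyadic_energy (fun s => w s ord0 i) m <= al.
Proof.
move=> Vw aal H.
apply: (@ler_cvg_to _ \oo _ R
  (fun k => \sum_(i < 3) dyadic_energy (fun s => V k s ord0 i) m) a) => //; last first.
  exact: nearW.
rewrite sum_dyadic_energy.
rewrite (_ : (fun k => _) = (fun k => \sum_(j < 2 ^ m)
  2 ^+ m * enorm (V k (j.+1%:R / 2 ^+ m) - V k (j%:R / 2 ^+ m)) ^+ 2)); last first.
  by apply/funext => k; rewrite sum_dyadic_energy.
apply: cvg_big; [exact: add_continuous|] => j _; apply: cvgMl_tmp; rewrite expr2.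
under eq_fun do rewrite expr2.
by apply: cvgM; apply: cvg_enorm; apply: cvgB; exact: Vw.
Qed.

Lemma tp_kernel_limit q G V g w s t : 0 < q ->
  (forall k, periodic1 (G k)) -> periodic1 g -> injective_closed g ->
  (forall k t, enorm (V k t) = 1) -> (forall t, enorm (w t) = 1) ->
  (forall t, V k t @[k --> \oo] --> w t) -> (forall t, G k t @[k --> \oo] --> g t) ->
  tp_kernel q (V k) (G k) s t @[k --> \oo] --> tp_kernel q w g s t.
Proof.
move=> q0 pG pg ig V1 w1 Vw Gg; rewrite /tp_kernel.
under eq_fun do rewrite !V1 !mulr1.
rewrite !w1 !mulr1; have [st|st] := eqVneq s t; first exact: cvg_cst.
apply: cvg_powR => //; first by move=> k; exact: inv_rtp_ge0.
have i0 (u x : vec) : inv_rtp u x x = 0.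
  by rewrite /inv_rtp subrr enorm0 expr0n invr0 mulr0.
(* Distinct parameters such as 0 and 1 may have the same image. By periodicity the chords are then 0
   along the whole sequence, and the kernels vanish by the default value of division by 0. Otherwise
   the limit chord is nonzero. *)
have [gst|gst] := eqVneq (g s) (g t).
  have [z tE] := injective_mod1 pg ig gst.
  have -> : t = s + z%:~R by rewrite -tE addrC subrK.
  under eq_fun do rewrite periodic1_int// i0.
  by rewrite periodic1_int// i0; exact: cvg_cst.
have cd : G k t - G k s @[k --> \oo] --> g t - g s by apply: cvgB; exact: Gg.
rewrite /inv_rtp; apply: cvgM; last first.
  apply: cvgV; first by rewrite expf_neq0// gt_eqF// enorm_gt0 subr_eq0 eq_sym.
  rewrite expr2; under eq_fun do rewrite expr2.
  by apply: cvgM; exact: cvg_enorm.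
apply: cvgMl_tmp; apply: cvg_enorm; rewrite /perpv; apply: cvgB => //.
apply: cvgZ; last exact: Vw.
rewrite -sqr_enorm w1 expr1n divr1.
under eq_fun do rewrite -(sqr_enorm (V _ s)) V1 expr1n divr1.
exact: cvg_dotv.
Qed.

Lemma TP_limit q G V g w (b : nat -> R) (bl : R) : 0 < q ->
  (forall k, curve_deriv (G k) (V k)) -> (forall k, continuous (V k)) ->
  (forall k, periodic1 (G k)) -> curve_deriv g w -> continuous w ->
  periodic1 g -> injective_closed g ->
  (forall k t, enorm (V k t) = 1) -> (forall t, enorm (w t) = 1) ->
  (forall t, V k t @[k --> \oo] --> w t) -> (forall t, G k t @[k --> \oo] --> g t) ->
  b k @[k --> \oo] --> bl -> (forall k, (TP q (G k) <= (b k)%:E)%E) ->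
  (TP q g <= bl%:E)%E.
Proof.
move=> q0 dG cV pG dg cw pg ig V1 w1 Vw Gg bbl TPb.
have cg := curve_deriv_continuous dg.
have cG k := curve_deriv_continuous (dG k).
have ge0 v' g' s t : (0 <= (tp_kernel q v' g' s t)%:E)%E by rewrite lee_fin tp_kernel_ge0.
pose P k s := (\int[mu]_(t in `[0%R, 1%R]) (tp_kernel q (V k) (G k) s t)%:E)%E.
have inner s : (\int[mu]_(t in `[0%R, 1%R]) (tp_kernel q w g s t)%:E
    <= limn_einf (P ^~ s))%E.
  have -> : (\int[mu]_(t in `[0%R, 1%R]) (tp_kernel q w g s t)%:E
    = \int[mu]_(t in `[0%R, 1%R]) limn_einf (fun k => (tp_kernel q (V k) (G k) s t)%:E))%E.
    apply: eq_integral => t _; apply/esym.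
    have cvk : (tp_kernel q (V k) (G k) s t)%:E @[k --> \oo] --> (tp_kernel q w g s t)%:E.
      by apply: cvg_EFin; [exact: nearW|exact: tp_kernel_limit].
    by have [-> _] := cvg_limn_einf_sup cvk.
  apply: (@fatou _ _ R mu _ _ (fun k t => (tp_kernel q (V k) (G k) s t)%:E)) => //.
  move=> k; apply: measurable_funTS; apply/measurable_EFinP.
  exact: measurable_tp_kernel_section.
rewrite TP_kernelE (curve_deriv_derive1 dg).
apply: (@le_trans _ _ (\int[mu]_(s in `[0%R, 1%R]) limn_einf (P ^~ s))%E).
  apply: ge0_le_integral_nm => s _; last exact: inner.
  exact: integral_ge0.
apply: (@le_trans _ _ (limn_einf (fun k => \int[mu]_(s in `[0%R, 1%R]) P k s))%E).
  apply: fatou => //.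
    move=> k; apply: measurable_funTS; exact: measurable_tp_potential.
  by move=> k s _; exact: integral_ge0.
have bE : (b k)%:E @[k --> \oo] --> bl%:E by apply: cvg_EFin bbl; exact: nearW.
rewrite limn_einf_lim -(cvg_lim (@ereal_hausdorff R) bE).
apply: lee_lim; [exact: is_cvg_einfs|by apply/cvg_ex; exists bl%:E|].
apply: nearW => k; apply: le_trans (TPb k).
rewrite TP_kernelE (curve_deriv_derive1 (dG k)).
by apply: ereal_inf_lbound; exists k => /=.
Qed.

End limit_curves.

(** * Compactness of admissible curves with bounded energy *)

Section compactness.
Variable R : realType.
Notation vec := 'rV[R]_3.
Implicit Types (g v w : R -> vec) (G V : nat -> R -> vec).

Lemma sqr_coord_le (x : vec) i : x ord0 i ^+ 2 <= enorm x ^+ 2.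
Proof.
by rewrite -real_normK ?num_real// ler_pXn2r ?nnegrE ?enorm_ge0// coord_le_enorm.
Qed.

(** Each condition holds on a set of [U], and so does lying beyond [k]; hence one index meets them
    all. [phi] may fail to be monotone: the explicit rates give convergence, and [k <= phi k] lets
    the defect of the minimizing sequence tend to 0. *)
Lemma equiholder_subsequence G V (a b : nat -> R) (C : R) : 0 <= C ->
  (forall n, periodic1 (V n)) -> (forall n t, enorm (V n t) = 1) ->
  (forall n s t, enorm (V n s - V n t) ^+ 2 <= 2 * C * `|s - t|) ->
  (forall n i, `|G n 0 ord0 i| <= 1) ->
  (forall n, `|a n| <= C) -> (forall n, `|b n| <= C) ->
  exists w p al bl (phi : nat -> nat),
  [/\ (forall k, (k <= phi k)%N),
   (forall k t i, `|V (phi k) t ord0 i - w t ord0 i| <= k.+1%:R^-1),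
   (forall k i, `|G (phi k) 0 ord0 i - (p : vec) ord0 i| <= k.+1%:R^-1),
   (forall k, `|a (phi k) - al| <= k.+1%:R^-1) &
   (forall k, `|b (phi k) - bl| <= k.+1%:R^-1)].
Proof.
move=> C0 pV V1 VK G1 aC bC.
have [U [ultraU oU]] := @ultraFilterLemma nat \oo _.
have /choice[w Hw] (i : 'I_3) : exists w : R -> R, forall e : R, 0 < e ->
    U [set n | forall t, `|V n t ord0 i - w t| <= e].
  apply: (@ultra_uniform_limit _ _ _ (fun n t => V n t ord0 i) (2 * C)).
  - by rewrite mulr_ge0.
  - by move=> n t; rewrite pV.
  - by move=> n t; rewrite -(V1 n t) coord_le_enorm.
  - move=> n s t; apply: le_trans (VK n s t).
    by have := sqr_coord_le (V n s - V n t) i; rewrite !mxE.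
have /choice[p Hp] i := ultra_limit ultraU (fun n => G1 n i).
have [al Hal] := ultra_limit ultraU aC.
have [bl Hbl] := ultra_limit ultraU bC.
have H (k : nat) : exists n, [/\ (k <= n)%N,
    (forall i t, `|V n t ord0 i - w i t| <= k.+1%:R^-1),
    (forall i, `|G n 0 ord0 i - p i| <= k.+1%:R^-1),
    `|a n - al| <= k.+1%:R^-1 & `|b n - bl| <= k.+1%:R^-1].
  have k0 : 0 < k.+1%:R^-1 :> R by rewrite invr_gt0 ltr0n.
  have UV : U [set n | forall i t, `|V n t ord0 i - w i t| <= k.+1%:R^-1].
    by apply: (@filter_forall nat 'I_3 (fun i n => forall t, `|V n t ord0 i - w i t| <= _)) => i; exact: Hw.
  have Up : U [set n | forall i, `|G n 0 ord0 i - p i| <= k.+1%:R^-1].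
    by apply: (@filter_forall nat 'I_3 (fun i n => `|G n 0 ord0 i - p i| <= _)) => i; exact: Hp.
  have UU := filterI (filterI UV Up) (filterI (Hal _ k0) (Hbl _ k0)).
  by have [n kn [[h1 h2] [h3 h4]]] := ultra_inf_often ultraU oU (UU _ _ _) k; exists n.
have [phi Hphi] := choice H.
exists (fun t => \row_i w i t), (\row_i p i), al, bl, phi.
split => [k|k t i|k i|k|k]; rewrite ?mxE; by have [] := Hphi k.
Qed.

(** The limit tangent is found first and integrated from the limit of the base points; the curves
    then converge pointwise, with error at most [(1 + |t|) / (k + 1)]. *)
Lemma admissible_compactness q g0 G V (a b : nat -> R) (C : R) : 2 < q ->
  (forall n, admissible g0 (G n) (V n)) ->
  (forall n k, \sum_(i < 3) dyadic_energy (fun s => V n s ord0 i) k <= a n) ->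
  (forall n, (TP q (G n) <= (b n)%:E)%E) ->
  (forall n, 0 <= a n <= C) -> (forall n, 0 <= b n <= C) ->
  exists g w al bl (phi : nat -> nat),
  [/\ admissible g0 g w,
   (forall k, \sum_(i < 3) dyadic_energy (fun s => w s ord0 i) k <= al),
   (TP q g <= bl%:E)%E, (forall k, (k <= phi k)%N) &
   a (phi k) @[k --> \oo] --> al /\ b (phi k) @[k --> \oo] --> bl].
Proof.
move=> q2 aG Va TPb aC bC.
have C0 : 0 <= C by have := aC 0%N; lra.
have VC n k : \sum_(i < 3) dyadic_energy (fun s => V n s ord0 i) k <= C.
  by apply: (le_trans (Va n k)); have := aC n; lra.
have dG n : curve_deriv (G n) (V n) by have [] := aG n.
have cV n : continuous (V n) by have [] := aG n.
have V1 n t : enorm (V n t) = 1 by have [_ _ ->] := aG n.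
have pG n : periodic1 (G n) by have [_ _ _ []] := aG n.
have iG n : injective_closed (G n) by have [_ _ _ []] := aG n.
have VK n s t : enorm (V n s - V n t) ^+ 2 <= 2 * C * `|s - t|.
  by have [] := admissible_regularity (aG n) (VC n).
have TPC n : (TP q (G n) <= C%:E)%E.
  by apply: (le_trans (TPb n)); rewrite lee_fin; have := bC n; lra.
have [c c0 sep] := tp_separation q2 (mulr_ge0 (ler0n _ 2) C0) C0.
have G1 n i : `|G n 0 ord0 i| <= 1.
  by apply: (D2sym_base_bound i (dG n) (V1 n)); have [_ _ _ []] := aG n.
have pV n := curve_deriv_periodic (dG n) (pG n).
have an n : `|a n| <= C by have := aC n; rewrite ler_norml; lra.
have bn n : `|b n| <= C by have := bC n; rewrite ler_norml; lra.
have [w [p [al [bl [phi [phik Vw Gp aal bbl]]]]]] :=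
  equiholder_subsequence C0 pV V1 VK G1 an bn.
have Vwc t : V (phi k) t @[k --> \oo] --> w t.
  apply: cvg_vecP => i; apply: (@cvg_harmonic_bound _ _ _ 1) => k.
  by rewrite mul1r; exact: Vw.
have wK s t : enorm (w s - w t) ^+ 2 <= 2 * C * `|s - t|.
  apply: (@ler_cvg_to _ \oo _ R (fun k => enorm (V (phi k) s - V (phi k) t) ^+ 2)
    (cst (2 * C * `|s - t|))).
  - rewrite expr2; under eq_fun do rewrite expr2.
    by apply: cvgM; apply: cvg_enorm; apply: cvgB; exact: Vwc.
  - exact: cvg_cst.
  - by apply: nearW => k; exact: VK.
have cw : continuous w.
  apply: continuous_coordP => i; apply: (@holder_continuous _ _ (2 * C)) => s t.
  apply: le_trans (wK s t).
  by have := sqr_coord_le (w s - w t) i; rewrite !mxE.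
pose g t : vec := \row_i (p ord0 i + antiderivative (fun s => w s ord0 i) t).
have dg : curve_deriv g w.
  move=> t i; have dA := is_derive_antiderivative t (continuous_coord (i := i) cw).
  rewrite (_ : (fun s => _) = cst (p ord0 i) + antiderivative (fun s => w s ord0 i)).
    by rewrite -[X in is_derive _ _ _ X]add0r; apply: is_deriveD.
  by apply/funext => s; rewrite mxE.
have Gg t : G (phi k) t @[k --> \oo] --> g t.
  apply: cvg_vecP => i; apply: (@cvg_harmonic_bound _ _ _ (1 + `|t|)) => k.
  have := curve_deriv_dist (dG (phi k)) dg (Vw k) i t 0; have := Gp k i.
  have g0E : g 0 ord0 i = p ord0 i by rewrite mxE antiderivative0 addr0.
  have eB (x y : vec) : (x - y) ord0 i = x ord0 i - y ord0 i by rewrite !mxE.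
  rewrite subr0 !eB g0E mulrDl mul1r (mulrC `|t|).
  move=> H1 H2; rewrite -[X in `|X|](subrK (G (phi k) 0 ord0 i - p ord0 i)).
  by rewrite (le_trans (ler_normD _ _))// addrC lerD.
have ag : admissible g0 g w.
  apply: (@admissible_limit _ _ (G \o phi) (V \o phi) _ _ c) => //= k.
  by apply: (sep _ (V (phi k))).
have ca : a (phi k) @[k --> \oo] --> al.
  by apply: (@cvg_harmonic_bound _ _ _ 1) => k; rewrite mul1r.
have cb : b (phi k) @[k --> \oo] --> bl.
  by apply: (@cvg_harmonic_bound _ _ _ 1) => k; rewrite mul1r.
exists g, w, al, bl, phi; split => //.
- by move=> k; apply: (@energy_limit _ (V \o phi) _ (a \o phi)) => //= n; exact: Va.
- have [_ _ w1 [pg ig _ _]] := ag.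
  apply: (@TP_limit _ q (G \o phi) (V \o phi) g w (b \o phi)) => //=.
  by rewrite (lt_trans _ q2).
Qed.

End compactness.

(** * The total energy and its minimizer *)

Lemma TP_ge0 (R : realType) q (g : R -> 'rV[R]_3) : (0 <= TP q g)%E.
Proof.
rewrite TP_kernelE; apply: integral_ge0 => s _; apply: integral_ge0 => t _.
by rewrite lee_fin tp_kernel_ge0.
Qed.

Lemma Stheta_ge0 (R : realType) q theta (g : R -> 'rV[R]_3) : 0 <= theta -> 0 <= Len g ->
  (0 <= Stheta q theta g)%E.
Proof.
move=> t0 L0; rewrite mule_ge0 ?lee_fin// adde_ge0//.
  by apply: integral_ge0 => t _; rewrite lee_fin mulr_ge0 ?sqr_ge0 ?enorm_ge0.
by rewrite mule_ge0 ?lee_fin// poweR_ge0.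
Qed.

(** Normalizing multiplies [TP] by [L^(q - 2)]; the power [1 / (q - 2)] of this is exactly the
    factor [Len g] in [Stheta], so the length disappears from the second term. *)
Lemma Stheta_reparam (R : realType) (q theta : R) (g0 g : R -> 'rV[R]_3) :
  2 < q -> 0 < theta -> SigmaK g0 g -> exists G v a, [/\ admissible g0 G v, 0 <= a,
    (forall k, \sum_(i < 3) dyadic_energy (fun s => v s ord0 i) k <= a) &
    Stheta q theta g = (a%:E + theta%:E * poweR (TP q G) (1 / (q - 2)))%E].
Proof.
move=> q2 t0 Sg; have L0 : 0 < Len g by have [_ [_ []]] := Sg.
have [G [v [e Ee [aG e0 He TPG]]]] := arclength_reparam q Sg.
exists G, v, (Len g * e); split => //; first by rewrite mulr_ge0// ltW.
rewrite /Stheta /Etheta Ee TPG ge0_muleDr ?lee_fin//; last first.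
  by rewrite mule_ge0 ?poweR_ge0// lee_fin ltW.
rewrite EFinM; congr (_ + _)%E; rewrite muleCA; congr (_ * _)%E.
rewrite poweRM ?TP_ge0 ?lee_fin ?powR_ge0// poweR_EFin -powRrM div1r divff.
  by rewrite powRr1 ?ltW.
by rewrite gt_eqF// subr_gt0.
Qed.

Lemma minimizer_finite (R : realType) (q theta m : R) (g0 : R -> 'rV[R]_3) :
  2 < q -> 0 < theta -> 0 <= m ->
  ereal_inf [set Stheta q theta g | g in SigmaK g0] = m%:E ->
  exists2 g, (exists v al, admissible g0 g v /\
    forall k, \sum_(i < 3) dyadic_energy (fun s => v s ord0 i) k <= al) &
    (Stheta q theta g <= m%:E)%E.
Proof.
move=> q2 t0 m0 Em; pose r := 1 / (q - 2).
have qp : 0 < q - 2 by rewrite subr_gt0.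
have r0 : 0 < r by rewrite divr_gt0.
have H n : exists x : (R -> 'rV[R]_3) * (R -> 'rV[R]_3) * (R * R),
    [/\ admissible g0 x.1.1 x.1.2, 0 <= x.2.1,
      (forall k, \sum_(i < 3) dyadic_energy (fun s => x.1.2 s ord0 i) k <= x.2.1),
      0 <= x.2.2 /\ TP q x.1.1 = x.2.2%:E &
      x.2.1 + theta * x.2.2 `^ r <= m + n.+1%:R^-1].
  have n0 : 0 < n.+1%:R^-1 :> R by rewrite invr_gt0 ltr0n.
  have fm : ereal_inf [set Stheta q theta g | g in SigmaK g0] \is a fin_num by rewrite Em.
  have [_ [g Sg <-]] := lb_ereal_inf_adherent n0 fm.
  rewrite Em -EFinD => lt_m.
  have [G [v [a [aG a0 Ha SE]]]] := Stheta_reparam q2 t0 Sg.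
  move: lt_m (TP_ge0 q G); rewrite SE.
  (* An infinite [TP] would make the total energy infinite, since [theta] and the exponent are
     positive, against the finite infimum. *)
  case TPE : (TP q G) => [b| |]//= lt_m b0; last first.
    by move: lt_m; rewrite gt_eqF//= gt0_muley ?lte_fin.
  exists (G, v, (a, b)); split => //=.
  by move: lt_m; rewrite -EFinM -EFinD lte_fin => /ltW.
have /choice[x Hx] := H.
pose a n := (x n).2.1; pose b n := (x n).2.2.
have n1 n : n.+1%:R^-1 <= 1 :> R by rewrite invf_le1// ler1n.
(* Both terms of [a + theta b^r <= m + 1] are nonnegative and [r = 1 / (q - 2)], which bounds [a]
   and [b] separately. *)
pose C := Num.max (m + 1) (((m + 1) / theta) `^ (q - 2)).
have aC n : 0 <= a n <= C.
  have [_ a0 _ [b0 _] le_m] := Hx n; rewrite a0/= le_max; apply/orP; left.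
  apply: (@le_trans _ _ (m + n.+1%:R^-1)); last by rewrite lerD2l.
  by apply: le_trans le_m; rewrite lerDl mulr_ge0 ?powR_ge0// ltW.
have bC n : 0 <= b n <= C.
  have [_ a0 _ [b0 _] le_m] := Hx n; rewrite b0/= le_max; apply/orP; right.
  have : b n `^ r <= (m + 1) / theta.
    rewrite ler_pdivlMr// mulrC; apply: (@le_trans _ _ (m + n.+1%:R^-1)); last by rewrite lerD2l.
    by apply: le_trans le_m; rewrite lerDr.
  move=> /(@ge0_ler_powR _ (q - 2) (ltW qp) _ _); rewrite -powRrM /r mul1r mulVf ?gt_eqF//.
  rewrite powRr1//; apply; rewrite nnegrE ?powR_ge0//.
  by rewrite divr_ge0 ?(ltW t0)// addr_ge0.
have [g [w [al [bl [phi [ag Hal TPg phik [ca cb]]]]]]] :=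
  @admissible_compactness R q g0 (fun n => (x n).1.1) (fun n => (x n).1.2) a b C q2
    (fun n => let: And5 h _ _ _ _ := Hx n in h)
    (fun n => let: And5 _ _ h _ _ := Hx n in h)
    (fun n => let: And5 _ _ _ (conj _ h) _ := Hx n in
      eq_ind_r (fun y => (y <= (b n)%:E)%E) (lexx _) h) aC bC.
exists g; first by exists w, al.
have [_ _ L1 EB _] := admissible_regularity ag Hal.
have bl0 : 0 <= bl.
  by apply: (ler_cvg_to (cvg_cst 0) cb); apply: nearW => k /=; have /andP[] := bC (phi k).
rewrite /Stheta L1 mul1e /Etheta.
(* Semicontinuity is used for each term separately; the sum of the two bounds converges along [phi]
   to a limit at most [m]. *)
apply: (@le_trans _ _ (al + theta * bl `^ r)%:E).
  rewrite EFinD EFinM leeD// lee_pmul2l ?lte_fin// -poweR_EFin.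
  apply: gt0_ler_poweR => //; first exact: ltW.
    by rewrite in_itv/= TP_ge0 leey.
  by rewrite in_itv/= lee_fin bl0 leey.
rewrite lee_fin.
apply: (@ler_cvg_to _ \oo _ R (fun k => a (phi k) + theta * b (phi k) `^ r)
  (fun k => m + k.+1%:R^-1)).
- apply: cvgD => //; apply: cvgMl_tmp; apply: cvg_powR => // k.
  by have /andP[] := bC (phi k).
- rewrite -[X in _ --> X]addr0; apply: cvgD; [exact: cvg_cst|exact: cvg_harmonic].
- apply: nearW => k; have [_ _ _ _ le_m] := Hx (phi k).
  by apply: (le_trans le_m); rewrite lerD2l lef_pV2 ?posrE ?ltr0n// ler_nat ltnS.
Qed.

Theorem theorem4p1 (R : realType) (q : R) (g0 : R -> 'rV[R]_3) :
  2 < q <= 4 ->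
  simple_closed g0 ->
  (exists g, SigmaK g0 g) ->
  forall theta : R, 0 < theta ->
  exists Gamma : R -> 'rV[R]_3,
    SigmaK g0 Gamma /\ arclength Gamma /\ Len Gamma = 1 /\
    Stheta q theta Gamma = ereal_inf [set Stheta q theta g | g in SigmaK g0].
Proof.
move=> /andP[q2 _] _ [g Sg] theta t0.
set m := ereal_inf _.
have lb h : SigmaK g0 h -> (m <= Stheta q theta h)%E.
  by move=> Sh; apply: ereal_inf_lbound; exists h.
(* A value at most [m] is enough: the dyadic bound places the curve in [SigmaK], where [m] is a
   lower bound. *)
suff [G [v [al [aG Hal]]] Gm] : exists2 G, (exists v al, admissible g0 G v /\
    forall k, \sum_(i < 3) dyadic_energy (fun s => v s ord0 i) k <= al) &
    (Stheta q theta G <= m)%E.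
  have [SG ar L1 _ _] := admissible_regularity aG Hal.
  exists G; do 3![split => //].
  by apply/eqP; rewrite eq_le Gm lb.
have m0 : (0 <= m)%E.
  apply: le_ereal_inf_tmp => _ [h Sh <-]; apply: Stheta_ge0; first exact: ltW.
  by have [_ [_ [_ /ltW]]] := Sh.
case mE : m m0 => [c| |]// m0.
  by apply: minimizer_finite; rewrite // -?mE.
(* If the infimum is [+oo] every candidate attains it, and normalizing the given curve provides unit
   speed and length 1. *)
have [G [v [a [aG _ Ha _]]]] := Stheta_reparam q2 t0 Sg.
by exists G; [exists v, a|rewrite leey].
Qed.
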